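(* Let $X\subseteq\mathbb{R}^2$ be any affine algebraic set, i.e. $X=\{(x,y): f_1(x,y)=\dots=f_k(x,y)=0\}$ for some polynomials $f_1,\dots,f_k\in\mathbb{R}[x,y]$. Then $X$ has a cell decomposition $\mathcal{A}$ with the finiteness property, and $(X,\mathcal{A})$ is a CW complex.
   Context: A cell decomposition of a set $X\subseteq\mathbb{R}^2$ is a partition of $X$ into (finitely or countably many) cells, each of which is a semi-algebraic set: 0-cells are points, 1-cells are subsets homeomorphic to an open interval, 2-cells are subsets homeomorphic to an open disk. A shortest-length curve in $X$ between two points $A,B\in X$ is a piecewise $C^2$ curve $\gamma$ from $A$ to $B$ lying entirely in $X$ whose length is minimal among all piecewise $C^2$ curves in $X$ from $A$ to $B$. A geodesic line segment (relative to the decomposition) is either a straight line segment or a connected arc contained (partially or entirely) in a 1-cell. A cell decomposition $\mathcal{A}$ of $X$ has the finiteness property if for every shortest-length curve $\gamma$ in $X$ between two points of $X$ and every cell $e\in\mathcal{A}$, the set $\gamma\cap e$ is either empty or has finitely many connected components, each of which is either a singleton or a geodesic line segment. *)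

(* Defs.v *)
From Stdlib Require Import Reals List.
From Coquelicot Require Import Coquelicot.
Open Scope R_scope.

Definition pt : Type := (R * R)%type.
Definition dist2 (p q : pt) : R :=
  sqrt ((fst p - fst q) ^ 2 + (snd p - snd q) ^ 2).
Definition dist1 (s t : R) : R := Rabs (s - t).

Definition poly2 : Type := list (R * nat * nat).
Definition peval (f : poly2) (p : pt) : R :=
  fold_right (fun m acc => match m with (c, i, j) =>
     c * fst p ^ i * snd p ^ j + acc end) 0 f.

Definition alg_set (fs : list poly2) (p : pt) : Prop :=
  forall f, In f fs -> peval f p = 0.

Inductive sa_gen : (pt -> Prop) -> Prop :=
| sa_pos (f : poly2) : sa_gen (fun p => 0 < peval f p)
| sa_union S T : sa_gen S -> sa_gen T -> sa_gen (fun p => S p \/ T p)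
| sa_inter S T : sa_gen S -> sa_gen T -> sa_gen (fun p => S p /\ T p)
| sa_compl S : sa_gen S -> sa_gen (fun p => ~ S p).
Definition semialgebraic (S : pt -> Prop) : Prop :=
  exists T, sa_gen T /\ forall p, S p <-> T p.

Definition cont_on {U V : Type} (dU : U -> U -> R) (dV : V -> V -> R)
  (D : U -> Prop) (f : U -> V) : Prop :=
  forall x, D x -> forall eps, 0 < eps -> exists delta, 0 < delta /\
    forall y, D y -> dU x y < delta -> dV (f x) (f y) < eps.

Definition homeo_on {U V : Type} (dU : U -> U -> R) (dV : V -> V -> R)
  (D : U -> Prop) (E : V -> Prop) (f : U -> V) : Prop :=
  (forall x, D x -> E (f x)) /\ cont_on dU dV D f /\
  exists g : V -> U, (forall y, E y -> D (g y)) /\ cont_on dV dU E g /\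
    (forall x, D x -> g (f x) = x) /\ (forall y, E y -> f (g y) = y).

Definition open_interval (t : R) : Prop := -1 < t < 1.
Definition closed_interval (t : R) : Prop := -1 <= t <= 1.
Definition open_disk (p : pt) : Prop := fst p ^ 2 + snd p ^ 2 < 1.
Definition closed_disk (p : pt) : Prop := fst p ^ 2 + snd p ^ 2 <= 1.
Definition unit_circle (p : pt) : Prop := fst p ^ 2 + snd p ^ 2 = 1.

Definition subset (S T : pt -> Prop) : Prop := forall p, S p -> T p.
Definition same_set (S T : pt -> Prop) : Prop := forall p, S p <-> T p.
Definition open2 (U : pt -> Prop) : Prop :=
  forall p, U p -> exists r, 0 < r /\ forall q, dist2 p q < r -> U q.
Definition closure2 (S : pt -> Prop) (p : pt) : Prop :=
  forall r, 0 < r -> exists q, S q /\ dist2 p q < r.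
Definition closed2 (F : pt -> Prop) : Prop := forall p, closure2 F p -> F p.
Definition rel_closed (Y S : pt -> Prop) : Prop :=
  exists F, closed2 F /\ forall p, S p <-> (F p /\ Y p).

Definition connected2 (S : pt -> Prop) : Prop :=
  forall U V, open2 U -> open2 V -> (forall p, S p -> U p \/ V p) ->
    (exists p, S p /\ U p) -> (exists p, S p /\ V p) ->
    exists p, S p /\ U p /\ V p.

Definition conn_component (S K : pt -> Prop) : Prop :=
  (exists p, K p) /\ subset K S /\ connected2 K /\
  forall K', connected2 K' -> subset K K' -> subset K' S -> subset K' K.

Definition is_singleton (e : pt -> Prop) : Prop :=
  exists P, forall q, e q <-> q = P.
Definition cell0 (e : pt -> Prop) : Prop := is_singleton e.
Definition cell1 (e : pt -> Prop) : Prop :=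
  exists f : R -> pt, homeo_on dist1 dist2 open_interval e f.
Definition cell2 (e : pt -> Prop) : Prop :=
  exists f : pt -> pt, homeo_on dist2 dist2 open_disk e f.
Definition is_cell (e : pt -> Prop) : Prop :=
  semialgebraic e /\ (cell0 e \/ cell1 e \/ cell2 e).

Definition cell_decomposition (X : pt -> Prop) (A : (pt -> Prop) -> Prop) : Prop :=
  (exists enum : nat -> (pt -> Prop), forall c, A c -> exists n, enum n = c) /\
  (forall c, A c -> is_cell c) /\
  (forall p, X p <-> exists c, A c /\ c p) /\
  (forall c1 c2, A c1 -> A c2 -> forall p, c1 p -> c2 p -> c1 = c2).

Definition C2fun (f : R -> R) : Prop :=
  forall t, ex_derive f t /\ ex_derive (Derive f) t /\
            continuous (Derive (Derive f)) t.

Fixpoint sumR (f : nat -> R) (n : nat) : R :=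
  match n with O => 0 | S k => sumR f k + f k end.

Definition pwC2_curve_length (gamma : R -> pt) (L : R) : Prop :=
  exists (n : nat) (t : nat -> R) (g : nat -> R -> pt),
    (1 <= n)%nat /\ t O = 0 /\ t n = 1 /\
    (forall i, (i < n)%nat -> t i < t (S i)) /\
    (forall i, (i < n)%nat ->
       C2fun (fun s => fst (g i s)) /\ C2fun (fun s => snd (g i s)) /\
       forall s, t i <= s <= t (S i) -> gamma s = g i s) /\
    L = sumR (fun i => RInt (fun s =>
           sqrt ((Derive (fun u => fst (g i u)) s) ^ 2 +
                 (Derive (fun u => snd (g i u)) s) ^ 2)) (t i) (t (S i))) n.

Definition curve_in (X : pt -> Prop) (gamma : R -> pt) (P Q : pt) : Prop :=
  gamma 0 = P /\ gamma 1 = Q /\ forall s, 0 <= s <= 1 -> X (gamma s).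

Definition shortest_curve (X : pt -> Prop) (gamma : R -> pt) (P Q : pt) : Prop :=
  curve_in X gamma P Q /\
  exists L, pwC2_curve_length gamma L /\
    forall delta L', curve_in X delta P Q -> pwC2_curve_length delta L' -> L <= L'.

Definition image01 (gamma : R -> pt) (p : pt) : Prop :=
  exists s, 0 <= s <= 1 /\ gamma s = p.

Definition seg_point (P Q : pt) (s : R) : pt :=
  ((1 - s) * fst P + s * fst Q, (1 - s) * snd P + s * snd Q).
(* straight segment with endpoints P <> Q, open, half-open or closed *)
Definition straight_segment (K : pt -> Prop) : Prop :=
  exists P Q, P <> Q /\
    (forall p, K p -> exists s, 0 <= s <= 1 /\ p = seg_point P Q s) /\
    (forall s, 0 < s < 1 -> K (seg_point P Q s)).
Definition geodesic_segment (A : (pt -> Prop) -> Prop) (K : pt -> Prop) : Prop :=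
  straight_segment K \/
  (exists e, A e /\ cell1 e /\ subset K e /\ connected2 K /\ exists p, K p).

Definition finiteness_property (X : pt -> Prop) (A : (pt -> Prop) -> Prop) : Prop :=
  forall gamma P Q, X P -> X Q -> shortest_curve X gamma P Q ->
  forall e, A e ->
    let S := fun p => image01 gamma p /\ e p in
    (forall p, ~ S p) \/
    ((exists Ks : list (pt -> Prop), forall K, conn_component S K ->
         exists K', In K' Ks /\ same_set K K') /\
     (forall K, conn_component S K -> is_singleton K \/ geodesic_segment A K)).

Definition char_map1 (A : (pt -> Prop) -> Prop) (e : pt -> Prop) : Prop :=
  exists Phi : R -> pt,
    cont_on dist1 dist2 closed_interval Phi /\
    homeo_on dist1 dist2 open_interval e Phi /\
    forall t, (t = -1 \/ t = 1) -> exists c, A c /\ cell0 c /\ c (Phi t).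
Definition char_map2 (A : (pt -> Prop) -> Prop) (e : pt -> Prop) : Prop :=
  exists Phi : pt -> pt,
    cont_on dist2 dist2 closed_disk Phi /\
    homeo_on dist2 dist2 open_disk e Phi /\
    forall p, unit_circle p -> exists c, A c /\ (cell0 c \/ cell1 c) /\ c (Phi p).

Definition CW_complex (X : pt -> Prop) (A : (pt -> Prop) -> Prop) : Prop :=
  (forall e, A e -> cell1 e -> char_map1 A e) /\
  (forall e, A e -> cell2 e -> char_map2 A e) /\
  (forall e, A e -> exists L : list (pt -> Prop), forall c, A c ->
      (exists p, closure2 e p /\ c p) -> exists c', In c' L /\ same_set c c') /\
  (forall S, subset S X ->
     (rel_closed X S <->
      forall e, A e -> rel_closed (closure2 e) (fun p => S p /\ closure2 e p))).

(* Main.v *)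
(* If the equations vanish identically, X is the plane with the unit grid: shortest curves are
   segments, and they meet each (convex) cell in a segment, a point or not at all.
   Otherwise X is the zero set of a single nonzero polynomial f.  After a shear x = u + c v the
   polynomial F(u, v) = f(u + c v, v) has constant leading coefficient in v, so its roots in v are
   locally bounded.  Gcd computations in R[u][v] show that, off finitely many u, the signs of all
   v-derivatives of F are locally constant along F = 0 and F = 0 projects openly to the u-axis.
   By Thom's lemma these signs determine v, so between consecutive cuts (the bad u and the
   integers) every sign class is the graph of a continuous function, which extends to the ends of
   the interval.  These graphs, and the points of X above the cuts, are the cells.  A connected
   subset of X meets such an open arc in at most two subarcs, which is the finiteness property;
   local finiteness of the family gives the CW axioms. *)
Require Import Defs.
From Stdlib Require Import Reals List.
From Stdlib Require Import Lra Lia Cantor Classical ClassicalEpsilon FunctionalExtensionality PropExtensionality.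
From Coquelicot Require Import Coquelicot.
From mathcomp Require all_boot all_order all_algebra Rstruct.
Open Scope R_scope.

(** * Polynomial functions *)

(** Over R[u] only pseudo-division is available: gcd and Bezout relations in [v] hold after
    multiplication by nonzero elements of R[u], and every bad abscissa is a root of such a
    multiplier. Splitting off common factors by induction on the degree in [v] then takes the place
    of a squarefree part and a discriminant.

    The shear excludes vertical lines and branches that escape to infinity. Bounded roots make the
    relevant part of each fibre compact, and this is what lets an arc reach across its whole gap and
    makes it a continuous graph.

    A connected piece of a 1-cell is a geodesic segment by definition, so on a curve the whole
    question is the number of components, decided by continuity of the path. Minimal length does its
    work in the plane, where pieces inside 2-cells have to be straight.

    [CW_complex] demands characteristic maps of all cells that are homeomorphic to an interval or a
    disk, so the dimensions must be told apart topologically. *)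

Definition poly_fun (g : pt -> R) : Prop := exists h : poly2, forall p, peval h p = g p.

Lemma peval_app (f g : poly2) (p : pt) : peval (f ++ g) p = peval f p + peval g p.
Proof.
  induction f as [|[[c i] j] f IH]; simpl; [ring|].
  unfold peval in *; simpl; rewrite IH; ring.
Qed.

Lemma poly_fun_ext (g h : pt -> R) : (forall p, g p = h p) -> poly_fun g -> poly_fun h.
Proof. intros E [l Hl]; exists l; intros p; rewrite Hl; apply E. Qed.

Lemma poly_fun_const (c : R) : poly_fun (fun _ => c).
Proof. exists ((c, 0%nat, 0%nat) :: nil); intros p; unfold peval; simpl; ring. Qed.

Lemma poly_fun_fst : poly_fun fst.
Proof. exists ((1, 1%nat, 0%nat) :: nil); intros p; unfold peval; simpl; ring. Qed.

Lemma poly_fun_snd : poly_fun snd.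
Proof. exists ((1, 0%nat, 1%nat) :: nil); intros p; unfold peval; simpl; ring. Qed.

Lemma poly_fun_plus (g h : pt -> R) :
  poly_fun g -> poly_fun h -> poly_fun (fun p => g p + h p).
Proof.
  intros [a Ha] [b Hb]; exists (a ++ b); intros p; rewrite peval_app, Ha, Hb; reflexivity.
Qed.

Lemma poly_fun_mult (g h : pt -> R) :
  poly_fun g -> poly_fun h -> poly_fun (fun p => g p * h p).
Proof.
  intros [a Ha] [b Hb].
  apply (poly_fun_ext (fun p => peval a p * peval b p)).
  { intros p; rewrite Ha, Hb; reflexivity. }
  clear Ha Hb.
  induction a as [|[[c i] j] a IH].
  - apply (poly_fun_ext (fun _ => 0)); [intros p; unfold peval; simpl; ring | apply poly_fun_const].
  - apply (poly_fun_ext (fun p => c * fst p ^ i * snd p ^ j * peval b p + peval a p * peval b p)).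
    { intros p; unfold peval; simpl; ring. }
    apply poly_fun_plus; [clear IH | exact IH].
    exists (map (fun m => match m with (d, k, l) => (c * d, (i + k)%nat, (j + l)%nat) end) b).
    intros p; induction b as [|[[d k] l] b IH]; unfold peval in *; simpl; [ring|].
    rewrite IH, !pow_add; ring.
Qed.

Lemma poly_fun_opp (g : pt -> R) : poly_fun g -> poly_fun (fun p => - g p).
Proof.
  intros H; apply (poly_fun_ext (fun p => -1 * g p)); [intros; ring|].
  apply poly_fun_mult; [apply poly_fun_const | exact H].
Qed.

Lemma poly_fun_pow (g : pt -> R) (n : nat) : poly_fun g -> poly_fun (fun p => g p ^ n).
Proof.
  intros H; induction n as [|n IH]; simpl; [apply poly_fun_const|].
  apply poly_fun_mult; assumption.
Qed.

Lemma poly_fun_comp (g a b : pt -> R) :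
  poly_fun g -> poly_fun a -> poly_fun b -> poly_fun (fun p => g (a p, b p)).
Proof.
  intros [h Hh] Ha Hb.
  apply (poly_fun_ext (fun p => peval h (a p, b p))); [intros p; apply Hh|]; clear Hh.
  induction h as [|[[c i] j] h IH]; [apply (poly_fun_const 0)|].
  apply (poly_fun_ext (fun p => c * a p ^ i * b p ^ j + peval h (a p, b p))); [reflexivity|].
  apply poly_fun_plus; [|exact IH].
  repeat apply poly_fun_mult; try apply poly_fun_const; apply poly_fun_pow; assumption.
Qed.

Lemma poly_fun_continuous (g : pt -> R) (p : R * R) :
  poly_fun g -> continuous (g : R * R -> R) p.
Proof.
  intros [h Hh].
  apply (continuous_ext (fun q => peval h q)); [exact Hh|]; clear Hh.
  induction h as [|[[c i] j] h IH]; [apply continuous_const|].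
  apply (continuous_plus (fun q : R * R => c * fst q ^ i * snd q ^ j) (fun q => peval h q)); [|exact IH].
  assert (Hpow : forall (k : R * R -> R) n, continuous k p -> continuous (fun q => k q ^ n) p).
  { intros k n Hk; induction n as [|n IHn]; simpl; [apply continuous_const|].
    apply (continuous_mult k (fun q => k q ^ n)); assumption. }
  apply (continuous_mult (fun q : R * R => c * fst q ^ i) (fun q => snd q ^ j)).
  - apply (continuous_mult (fun q : R * R => c) (fun q => fst q ^ i)); [apply continuous_const|].
    apply Hpow, continuous_fst.
  - apply Hpow, continuous_snd.
Qed.

(** Equality of signs in {-, 0, +}: the case of zero is implied by the other two. As a Boolean
    combination of strict inequalities it is semialgebraic, and [lra] can use it directly. *)
Definition same_sign (a b : R) : Prop := (0 < a <-> 0 < b) /\ (a < 0 <-> b < 0).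

Lemma same_sign_refl (a : R) : same_sign a a.
Proof. unfold same_sign; tauto. Qed.

Lemma same_sign_sym (a b : R) : same_sign a b -> same_sign b a.
Proof. unfold same_sign; tauto. Qed.

Lemma same_sign_trans (a b c : R) : same_sign a b -> same_sign b c -> same_sign a c.
Proof. unfold same_sign; tauto. Qed.

Lemma same_sign_locally {U : UniformSpace} (g : U -> R) (x : U) :
  continuous g x -> g x <> 0 -> locally x (fun y => same_sign (g y) (g x)).
Proof.
  intros Hc Hn.
  assert (Hp : 0 < Rabs (g x)) by (apply Rabs_pos_lt; exact Hn).
  apply (filter_imp (fun y => ball (g x) (mkposreal _ Hp) (g y))).
  - intros y Hy; unfold ball in Hy; simpl in Hy; unfold AbsRing_ball, abs, minus, plus, opp in Hy; simpl in Hy.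
    revert Hy; unfold same_sign, Rabs; destruct (Rcase_abs (g x)), (Rcase_abs (g y + - g x)); lra.
  - apply Hc, locally_ball.
Qed.

(** The summands come in the order in which [derivMXaddC] differentiates a Horner step, ready for
    the induction in [ev_derive]. *)
Lemma is_derive_horner (f : R -> R) (a v df : R) :
  is_derive f v df -> is_derive (fun w => f w * w + a) v (f v + df * v).
Proof.
  intros H; auto_derive; [exists df; exact H|].
  replace (Derive (fun x : R => f x) v) with df by (symmetry; apply is_derive_unique; exact H); ring.
Qed.

Lemma same_sign_neq0 (a b : R) : same_sign a b -> b <> 0 -> a <> 0.
Proof. unfold same_sign; lra. Qed.

Lemma locally_imp {U : UniformSpace} (x : U) (P Q : U -> Prop) :
  locally x P -> (forall y, P y -> Q y) -> locally x Q.
Proof. intros H K; exact (filter_imp P Q K H). Qed.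

Lemma locally_and {U : UniformSpace} (x : U) (P Q : U -> Prop) :
  locally x P -> locally x Q -> locally x (fun y => P y /\ Q y).
Proof. exact (filter_and P Q). Qed.

(** A nonzero derivative puts points with opposite signs of [F] on the two sides of [v], as close to
    it as desired. The signs persist for nearby abscissae, and the intermediate value theorem gives
    a root in between, hence inside [U]. *)
Lemma simple_root_open (F : R * R -> R) (u v d : R) (U : R * R -> Prop) :
  (forall q : R * R, continuous F q) -> is_derive (fun w => F (u, w)) v d -> d <> 0 ->
  F (u, v) = 0 -> locally (u, v) U ->
  locally u (fun u' => exists v', U (u', v') /\ F (u', v') = 0).
Proof.
  intros Fc Fd d0 F0 [eps HU].
  assert (Hch : exists v1 v2, Rabs (v1 - v) < eps /\ Rabs (v2 - v) < eps /\
                              F (u, v1) < 0 /\ 0 < F (u, v2)).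
  { apply is_derive_Reals in Fd.
    destruct (Fd (Rabs d / 2)) as [delta Hd].
    { apply Rabs_pos_lt in d0; lra. }
    assert (Hm : 0 < Rmin eps delta) by (apply Rmin_pos; apply cond_pos).
    set (h := Rmin eps delta / 2).
    assert (Hh : 0 < h < Rmin eps delta) by (unfold h; lra).
    assert (Hh1 : h < eps) by (pose proof (Rmin_l eps delta); lra).
    assert (Hh2 : h < delta) by (pose proof (Rmin_r eps delta); lra).
    (* The error of the linear approximation is less than half of the linear term [k * d], which
       therefore decides the sign. *)
    assert (Q : forall k, k = h \/ k = - h -> Rabs (F (u, v + k) - k * d) < h * (Rabs d / 2)).
    { intros k Hk.
      assert (Hk0 : k <> 0) by (destruct Hk; lra).
      assert (Hka : Rabs k = h) by (destruct Hk; subst k; [|rewrite Rabs_Ropp]; apply Rabs_pos_eq; lra).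
      specialize (Hd k Hk0); cbv beta in Hd; change (@eq R (F (@pair R R u v)) 0) in F0; change (Rabs k < delta -> Rabs ((F (@pair R R u (v + k)) - F (@pair R R u v)) / k - d) < Rabs d / 2) in Hd; rewrite Hka, F0 in Hd; specialize (Hd Hh2).
      replace (F (u, v + k) - k * d) with (k * ((F (u, v + k) - 0) / k - d)) by (field; exact Hk0).
      rewrite Rabs_mult, Hka; apply Rmult_lt_compat_l; lra. }
    pose proof (Q h (or_introl eq_refl)) as Qp.
    pose proof (Q (- h) (or_intror eq_refl)) as Qn.
    assert (Ep : Rabs (v + h - v) < eps) by (replace (v + h - v) with h by ring; rewrite Rabs_pos_eq; lra).
    assert (En : Rabs (v + - h - v) < eps)
      by (replace (v + - h - v) with (- h) by ring; rewrite Rabs_Ropp, Rabs_pos_eq; lra).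
    apply Rabs_def2 in Qp; apply Rabs_def2 in Qn.
    destruct (Rtotal_order d 0) as [Hneg|[Hz|Hpos]]; [|lra|].
    - rewrite (Rabs_left d Hneg) in Qp, Qn.
      exists (v + h), (v + - h); repeat split; try assumption; nra.
    - rewrite (Rabs_pos_eq d) in Qp, Qn by lra.
      exists (v + - h), (v + h); repeat split; try assumption; nra. }
  destruct Hch as (v1 & v2 & E1 & E2 & S1 & S2).
  assert (C1 : forall w, continuous (fun u' : R => F (u', w)) u).
  { intros w; apply (continuous_comp_2 (fun x : R => x) (fun _ => w) (fun x y => F (x, y))).
    - apply continuous_id.
    - apply continuous_const.
    - apply (continuous_ext F); [intros [x y]; reflexivity | apply Fc]. }
  assert (L1 := same_sign_locally _ u (C1 v1) ltac:(lra)).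
  assert (L2 := same_sign_locally _ u (C1 v2) ltac:(lra)).
  assert (L3 : locally u (fun u' => Rabs (u' - u) < eps)) by (exists eps; intros y Hy; exact Hy).
  apply (locally_imp _ _ _ (filter_and _ _ L1 (filter_and _ _ L2 L3))).
  intros u' [T1 [T2 T3]].
  assert (C2 : forall w, continuous (fun w' : R => F (u', w')) w).
  { intros w; apply (continuous_comp_2 (fun _ => u') (fun x : R => x) (fun x y => F (x, y))).
    - apply continuous_const.
    - apply continuous_id.
    - apply (continuous_ext F); [intros [x y]; reflexivity | apply Fc]. }
  destruct (IVT_gen (fun w => F (u', w)) v1 v2 0) as [v' [Hb Hv]].
  - intros w; apply continuity_pt_filterlim, C2.
  - assert (T1' : F (u', v1) < 0) by (apply (proj2 (proj2 T1)); exact S1).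
    assert (T2' : 0 < F (u', v2)) by (apply (proj2 (proj1 T2)); exact S2).
    rewrite Rmin_left, Rmax_right; lra.
  - exists v'; split; [|exact Hv].
    apply HU; split; [exact T3|].
    change (Rabs (v' - v) < eps).
    apply Rabs_def2 in E1; apply Rabs_def2 in E2.
    revert Hb; unfold Rmin, Rmax; destruct (Rle_dec v1 v2); intros; apply Rabs_def1; lra.
Qed.

Lemma continuous_zero_off_point (g : R -> R) (a : R) :
  continuous g a -> (forall x, x <> a -> g x = 0) -> g a = 0.
Proof.
  intros Hc H; apply NNPP; intros Hn.
  destruct (same_sign_locally g a Hc Hn) as [eps He].
  specialize (He (a + eps / 2)); pose proof (cond_pos eps) as Hp.
  assert (Hz : g (a + eps / 2) = 0) by (apply H; lra).
  refine (same_sign_neq0 _ _ (He _) Hn Hz).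
  change (Rabs (a + eps / 2 - a) < eps).
  replace (a + eps / 2 - a) with (eps / 2) by ring; rewrite Rabs_pos_eq; lra.
Qed.

(** * Leading forms and the choice of the shear *)

Definition degree_le (D : nat) (f : poly2) : Prop :=
  forall c i j, In (c, i, j) f -> (i + j <= D)%nat.

(** Monomials of the list may cancel, so this form can vanish as a function without being empty;
    [exists_shear] then discards it. *)
Definition top_part (D : nat) (f : poly2) : poly2 :=
  filter (fun m => match m with (_, i, j) => Nat.eqb (i + j) D end) f.

Lemma peval_filter (b : R * nat * nat -> bool) (f : poly2) (p : pt) :
  peval f p = peval (filter b f) p + peval (filter (fun m => negb (b m)) f) p.
Proof.
  induction f as [|[[c i] j] f IH]; [unfold peval; simpl; ring|].
  change (c * fst p ^ i * snd p ^ j + peval f p =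
    peval (filter b ((c, i, j) :: f)) p + peval (filter (fun m => negb (b m)) ((c, i, j) :: f)) p).
  rewrite IH; simpl; destruct (b (c, i, j)); simpl; unfold peval; simpl; ring.
Qed.

Lemma peval_top_part (D : nat) (f : poly2) (x y : R) : y <> 0 ->
  peval (top_part D f) (x, y) = y ^ D * peval (top_part D f) (x / y, 1).
Proof.
  intros Hy; induction f as [|[[c i] j] f IH]; [unfold peval; simpl; ring|].
  unfold top_part in *; simpl; destruct (Nat.eqb_spec (i + j) D) as [E|E]; [|exact IH].
  unfold peval in *; simpl in *; rewrite IH, <- E, pow1, pow_add.
  unfold Rdiv; rewrite Rpow_mult_distr, pow_inv; field; apply pow_nonzero, Hy.
Qed.

(* Substituting [x = u + c v] gives [v ^ D] the constant coefficient [peval (top_part D f) (c, 1)]. *)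
Lemma exists_shear (D : nat) (f : poly2) :
  degree_le D f -> (exists p, peval f p <> 0) ->
  exists f' D' c, (forall p, peval f' p = peval f p) /\ degree_le D' f' /\
    peval (top_part D' f') (c, 1) <> 0.
Proof.
  revert f; induction D as [D IH] using (well_founded_induction Nat.lt_wf_0); intros f Hd Hnz.
  destruct (classic (exists c, peval (top_part D f) (c, 1) <> 0)) as [[c Hc]|H0].
  { exists f, D, c; auto. }
  (* A form that vanishes on the line [y = 1] vanishes off [y = 0] by homogeneity and on [y = 0] by
     continuity. Its monomials can then be dropped, which lowers the degree bound. *)
  assert (Hoff : forall x y, y <> 0 -> peval (top_part D f) (x, y) = 0).
  { intros x y Hy; rewrite peval_top_part by exact Hy.
    destruct (Req_dec (peval (top_part D f) (x / y, 1)) 0) as [E|E]; [rewrite E; ring|].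
    exfalso; apply H0; eauto. }
  assert (Hall : forall p, peval (top_part D f) p = 0).
  { intros [x y]; destruct (Req_dec y 0) as [->|Hy]; [|apply Hoff, Hy].
    apply (continuous_zero_off_point (fun y => peval (top_part D f) (x, y)) 0).
    - apply (continuous_comp_2 (fun _ => x) (fun y : R => y) (fun x y => peval (top_part D f) (x, y))).
      + apply continuous_const.
      + apply continuous_id.
      + apply (continuous_ext (peval (top_part D f))); [intros [a b]; reflexivity|].
        apply poly_fun_continuous; exists (top_part D f); reflexivity.
    - intros y Hy; apply Hoff, Hy. }
  set (f1 := filter (fun m => negb match m with (_, i, j) => Nat.eqb (i + j) D end) f).
  assert (E1 : forall p, peval f1 p = peval f p).
  { intros p.
    rewrite (peval_filter (fun m => match m with (_, i, j) => Nat.eqb (i + j) D end) f p).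
    fold (top_part D f); rewrite Hall; unfold f1; ring. }
  assert (Hd1 : forall c i j, In (c, i, j) f1 -> (i + j < D)%nat).
  { intros c i j Hin; apply filter_In in Hin; destruct Hin as [Hin Hb].
    specialize (Hd c i j Hin); destruct (Nat.eqb_spec (i + j) D); simpl in Hb; [discriminate|lia]. }
  destruct D as [|D].
  { destruct Hnz as [p Hp]; exfalso; apply Hp; rewrite <- E1.
    destruct f1 as [|[[c i] j] f1]; [reflexivity|].
    specialize (Hd1 c i j (or_introl eq_refl)); lia. }
  destruct (IH D) with (f := f1) as (f' & D' & c & E' & Hd' & Hc').
  - lia.
  - intros c i j Hin; specialize (Hd1 c i j Hin); lia.
  - destruct Hnz as [p Hp]; exists p; rewrite E1; exact Hp.
  - exists f', D', c; repeat split; try assumption; intros p; rewrite E', E1; reflexivity.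
Qed.

Lemma exists_degree_le (f : poly2) : exists D, degree_le D f.
Proof.
  induction f as [|[[c i] j] f [D H]]; [exists 0%nat; intros c i j []|].
  exists (D + i + j)%nat; intros c' i' j' [E|Hin].
  - inversion E; lia.
  - specialize (H c' i' j' Hin); lia.
Qed.

Lemma horner_step_bound (w a u C N : R) :
  Rabs w <= C -> Rabs u <= N -> Rabs (w * u + a) <= C * N + Rabs a.
Proof.
  intros Hw Hu; apply Rle_trans with (1 := Rabs_triang _ _); rewrite Rabs_mult.
  apply Rplus_le_compat_r, Rmult_le_compat; auto using Rabs_pos.
Qed.

Lemma ev_step_bound (w b v C C' : R) (D : nat) :
  Rabs w * Rabs v <= C * Rabs v ^ D -> Rabs b <= C' -> 1 <= Rabs v ->
  Rabs (w * v + b) * Rabs v <= (C + C') * Rabs v ^ S D.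
Proof.
  intros Hw Hb Hv.
  assert (H1 : Rabs v <= Rabs v ^ S D).
  { rewrite <- (pow_1 (Rabs v)) at 1; apply Rle_pow; [exact Hv|lia]. }
  assert (H2 : Rabs (w * v + b) <= Rabs w * Rabs v + Rabs b).
  { apply Rle_trans with (1 := Rabs_triang _ _); rewrite Rabs_mult; lra. }
  pose proof (Rabs_pos b).
  apply Rle_trans with ((Rabs w * Rabs v + Rabs b) * Rabs v).
  { apply Rmult_le_compat_r; lra. }
  simpl pow in *; nra.
Qed.

(** Cauchy's root bound: at a root the lower terms add up to [- (a * v ^ D)]. For [|v| >= 1] their
    estimate may be divided by [|v| ^ D]; the summand [1] covers the remaining roots. *)
Lemma root_bound (D : nat) (a v C : R) : a <> 0 ->
  (1 <= Rabs v -> Rabs (- (a * v ^ D)) * Rabs v <= C * Rabs v ^ D) ->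
  Rabs v <= Rabs C / Rabs a + 1.
Proof.
  intros Ha H; apply Rabs_pos_lt in Ha.
  assert (HC0 : 0 <= Rabs C / Rabs a) by (apply Rdiv_le_0_compat; [apply Rabs_pos|lra]).
  destruct (Rle_lt_dec 1 (Rabs v)) as [Hv|Hv]; [|lra].
  specialize (H Hv); rewrite Rabs_Ropp, Rabs_mult, <- RPow_abs in H.
  assert (Hp : 0 < Rabs v ^ D) by (apply pow_lt; lra).
  assert (HC : Rabs a * Rabs v <= C).
  { apply Rmult_le_reg_r with (1 := Hp); lra. }
  assert (Rabs v <= Rabs C / Rabs a); [|lra].
  apply Rle_div_r; [lra|]; pose proof (Rle_abs C); lra.
Qed.

(* [G k] is the [k]-th derivative in [v] of [F (u, v) = f (u + c v, v)], where [X = {f = 0}];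
   [B] contains the abscissae where [curve_sign] or [curve_open] may fail. *)
Record sheared_curve (X : pt -> Prop) (c : R) (D : nat) (G : nat -> pt -> R) (B : list R) : Prop := {
  curve_zero : forall x y, X (x, y) <-> G 0%nat (x - c * y, y) = 0;
  curve_poly : forall k, poly_fun (G k);
  curve_derive : forall k u v, is_derive (fun w => G k (u, w)) v (G (S k) (u, v));
  curve_top : exists a, a <> 0 /\ forall q, G D q = a;
  curve_bounded : forall N, exists M, forall u v, Rabs u <= N -> G 0%nat (u, v) = 0 -> Rabs v <= M;
  curve_roots : forall u, exists L : list R, forall v, G 0%nat (u, v) = 0 -> In v L;
  curve_sign : forall k (q : R * R), ~ In (fst q) B -> G 0%nat q = 0 ->
    locally q (fun q' : R * R => G 0%nat q' = 0 -> same_sign (G k q') (G k q));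
  curve_open : forall q : R * R, ~ In (fst q) B -> G 0%nat q = 0 ->
    forall U : R * R -> Prop, locally q U ->
    locally (fst q) (fun u => exists v, U (u, v) /\ G 0%nat (u, v) = 0)
}.

(** * Bivariate polynomials off a finite set of abscissae *)

Module Algebra.
Import all_boot all_order all_algebra Rstruct.
Import GRing.Theory Num.Theory.
Local Open Scope ring_scope.

(** The outer indeterminate is [v], with coefficients in R[u], so that [gcdp] and the formal
    derivative act in [v]. *)
Definition ev (P : {poly {poly R}}) (q : R * R) : R := (P.[(q.2)%:P]).[q.1].

Lemma evD P Q q : ev (P + Q) q = (ev P q + ev Q q)%R.
Proof. by rewrite /ev !hornerD. Qed.

Lemma evM P Q q : ev (P * Q) q = (ev P q * ev Q q)%R.
Proof. by rewrite /ev !hornerM. Qed.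

Lemma evC c q : ev c%:P q = c.[q.1].
Proof. by rewrite /ev hornerC. Qed.

Lemma evX q : ev 'X q = q.2.
Proof. by rewrite /ev hornerX hornerC. Qed.

Lemma evZ c P q : ev (c *: P) q = (c.[q.1] * ev P q)%R.
Proof. by rewrite -mul_polyC evM evC. Qed.

Lemma horner_poly_fun (c : {poly R}) : poly_fun (fun q => c.[q.1]).
Proof.
elim/poly_ind: c => [|c a IH].
  by apply: (@poly_fun_ext (fun=> 0)) => [q|]; [rewrite horner0|exact: poly_fun_const].
apply: (@poly_fun_ext (fun q => (c.[q.1] * q.1 + a)%R)) => [q|].
  by rewrite hornerMXaddC.
apply: poly_fun_plus; last exact: poly_fun_const.
by apply: poly_fun_mult => //; exact: poly_fun_fst.
Qed.

Lemma ev_poly_fun (P : {poly {poly R}}) : poly_fun (ev P).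
Proof.
elim/poly_ind: P => [|P c IH].
  by apply: (@poly_fun_ext (fun=> 0)) => [q|]; [rewrite /ev !horner0|exact: poly_fun_const].
apply: (@poly_fun_ext (fun q => (ev P q * q.2 + c.[q.1])%R)) => [q|].
  by rewrite evD evM evX evC.
apply: poly_fun_plus; last exact: horner_poly_fun.
by apply: poly_fun_mult => //; exact: poly_fun_snd.
Qed.

Lemma ev_derive (P : {poly {poly R}}) (u v : R) :
  is_derive (fun w : R => ev P (u, w)) v (ev P^`() (u, v)).
Proof.
elim/poly_ind: P v => [|P c IH] v.
  apply: (@is_derive_ext R_AbsRing R_NormedModule (fun=> 0%R)) => [w|]; first by rewrite /ev !horner0.
  by rewrite deriv0 /ev !horner0; exact: is_derive_const.
apply: (@is_derive_ext R_AbsRing R_NormedModule (fun w : R => (ev P (u, w) * w + c.[u])%R)) => [w|].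
  by rewrite evD evM evX evC.
rewrite derivMXaddC evD evM evX /=.
apply: (@is_derive_horner (fun w => ev P (u, w))); exact: IH.
Qed.

Lemma finite_roots (p : {poly R}) : p != 0 ->
  exists B : list R, forall x, p.[x] = 0 -> In x B.
Proof.
move=> p0; apply: NNPP => H.
(* If no finite list held all roots, distinct roots could be collected one by one up to any length,
   against the bound by the degree. *)
have L n : exists s : seq R, [/\ uniq s, all (root p) s & size s = n].
  elim: n => [|n [s [us rs ss]]]; first by exists [::].
  have [x [px xs]] : exists x, p.[x] = 0 /\ ~ In x s.
    apply: NNPP => K; apply: H; exists s => x px.
    by apply: NNPP => xs; apply: K; exists x.
  exists (x :: s); split => /=; last by rewrite ss.
    rewrite us andbT; apply/negP => xs'; apply: xs.
    elim: s {us rs ss} xs' => //= y s IHs; rewrite inE => /orP[/eqP ->|]; first by left.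
    by move/IHs; right.
  by rewrite rs andbT; apply/rootP.
have [s [us rs ss]] := L (size p).
by have := max_poly_roots p0 rs us; rewrite ss ltnn.
Qed.

(** Bezout's identity and division by the gcd hold only up to nonzero factors from R[u], whence [c]
    and [d]. A nontrivial gcd has positive degree in [v], so the cofactor [k] is smaller than [f].
    The bound on [h] serves [roots_open], where [g] is the derivative of [f]. *)
Lemma coprime_or_factor (f g : {poly {poly R}}) : f != 0 ->
  (exists d : {poly R}, exists a b : {poly {poly R}}, d != 0 /\ a * f + b * g = d%:P) \/
  (exists c d : {poly R}, exists h k l : {poly {poly R}},
    [/\ (c != 0) && (d != 0), c *: f = h * k, d *: g = h * l,
      (size k < size f)%N & (g != 0 -> (size h <= size g)%N) /\ k != 0]).
Proof.
move=> f0; case: (boolP (coprimep f g)) => [/Bezout_coprimepP[[a b] /= /eqpP[[c d] /=]]|co].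
  case/andP=> c0 d0 e; left; exists d, (c *: a), (c *: b); split=> //.
  by rewrite -!scalerAl -scalerDr e -mul_polyC mulr1.
right.
have h0 : gcdp f g != 0 by rewrite gcdp_eq0 negb_and f0.
have /Pdiv.Idomain.dvdpP[[c k] /= c0 ek] := dvdp_gcdl f g.
have /Pdiv.Idomain.dvdpP[[d l] /= d0 el] := dvdp_gcdr f g.
have k0 : k != 0.
  apply: contraNneq f0 => k0; move: ek; rewrite k0 mul0r => /eqP.
  by rewrite -mul_polyC mulf_eq0 polyC_eq0 (negPf c0).
exists c, d, (gcdp f g), k, l; split => //.
- by rewrite c0.
- by rewrite mulrC.
- by rewrite mulrC.
- have := congr1 (fun p : {poly {poly R}} => size p) ek; rewrite size_scale // size_mul // => ->.
  have : (1 < size (gcdp f g))%N by rewrite ltn_neqAle eq_sym -coprimep_def co lt0n size_poly_eq0.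
  by case: (size _) => // n n1; rewrite addnS /= -[X in (X < _)%N]addn0 ltn_add2l.
- by split=> // g0; exact: leq_gcdpr.
Qed.

Lemma ev_continuous (P : {poly {poly R}}) (q : R * R) : continuous (ev P : R * R -> R) q.
Proof. by apply: poly_fun_continuous; exact: ev_poly_fun. Qed.

Lemma horner_nonzero_locally (c : {poly R}) (q : R * R) :
  c.[q.1] <> 0%R -> locally q (fun q' : R * R => c.[q'.1] <> 0%R).
Proof.
move=> H; have := @same_sign_locally _ (fun q : R * R => c.[q.1]) q.
move=> /(_ _ H) K; move: (K (poly_fun_continuous _ q (horner_poly_fun c))).
by apply: filter_imp => q' /same_sign_neq0; apply.
Qed.

Lemma ev_mul_eq0 c f h k q : c *: f = h * k -> c.[q.1] <> 0%R ->
  ev f q = 0%R <-> ev h q = 0%R \/ ev k q = 0%R.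
Proof.
move=> e c0; have := congr1 (ev^~ q) e; rewrite /= evZ evM => {}e; split => [f0|hk].
  by apply: Rmult_integral; rewrite -[LHS]e f0 mulr0.
have : (c.[q.1] * ev f q = 0)%R by rewrite e; case: hk => ->; rewrite ?mul0r ?mulr0.
by case/Rmult_integral.
Qed.

(* Write [c f = h k] with [h = gcd f g]: [g] vanishes on [h = 0], and [k] has smaller degree. *)
Lemma sign_locally_constant (f g : {poly {poly R}}) : f != 0 ->
  exists B : list R, forall q : R * R, ~ In (fst q) B -> ev f q = 0%R ->
    locally q (fun q' : R * R => ev f q' = 0%R -> same_sign (ev g q') (ev g q)).
Proof.
have [n] := ubnP (size f); elim: n f => // n IH f; rewrite ltnS => sf f0.
case: (coprime_or_factor f g f0) => [[d [a [b [d0 e]]]]|].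
  have [B HB] := finite_roots d d0; exists B => q qB fq.
  (* At a common zero of [f] and [g] the Bezout identity would make [d] vanish at an abscissa
     outside [B]. *)
  have gq : ev g q <> 0%R.
    move=> gq; apply: qB; apply: HB.
    by rewrite -evC -e evD !evM fq gq !mulr0 addr0.
  have := same_sign_locally (ev g : R * R -> R) q (ev_continuous g q) gq.
  by apply: filter_imp.
case=> c [d [h [k [l [/andP[c0 d0] ef eg sk [_ k0]]]]]].
have [B1 HB1] := finite_roots c c0; have [B2 HB2] := finite_roots d d0.
have [B3 HB3] := IH k (leq_trans sk sf) k0.
exists (B1 ++ B2 ++ B3)%list => q qB fq.
have cq : c.[q.1] <> 0%R by move=> /HB1 K; apply: qB; rewrite !in_app_iff; left.
have dq : d.[q.1] <> 0%R by move=> /HB2 K; apply: qB; rewrite !in_app_iff; right; left.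
have qB3 : ~ In (fst q) B3 by move=> K; apply: qB; rewrite !in_app_iff; right; right.
have hg q' : d.[q'.1] <> 0%R -> ev h q' = 0%R -> ev g q' = 0%R.
  by move=> d' h'; apply/(ev_mul_eq0 _ _ _ _ _ eg d'); left.
have Lc := horner_nonzero_locally c q cq.
have Ld := horner_nonzero_locally d q dq.
case: (classic (ev k q = 0%R)) => kq.
(* The branch [k = 0] is covered by the induction hypothesis. Zeros of [h] close to [q] occur only
   if [h] vanishes at [q] too, and then [g] is zero at both points. *)
- have Lk := HB3 q qB3 kq.
  case: (classic (ev h q = 0%R)) => hq.
    apply: (locally_imp _ _ _ (filter_and _ _ Lk (filter_and _ _ Lc Ld))) => q' [] Hk [Hc Hd].
    move/(ev_mul_eq0 _ _ _ _ _ ef Hc) => [h'|/Hk//].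
    by rewrite (hg q) // (hg q') //; exact: same_sign_refl.
  have Lh := same_sign_locally (ev h : R * R -> R) q (ev_continuous h q) hq.
  apply: (locally_imp _ _ _ (filter_and _ _ (filter_and _ _ Lk Lh) (filter_and _ _ Lc Ld))) => q' [[Hk Hh]] [Hc Hd].
  move/(ev_mul_eq0 _ _ _ _ _ ef Hc) => [h'|/Hk//].
  by case: (same_sign_neq0 _ _ Hh hq h').
(* Here [k] stays nonzero near [q], so the curve is locally [h = 0], on which [g] is zero. *)
- have hq : ev h q = 0%R by case/(ev_mul_eq0 _ _ _ _ _ ef cq): fq.
  have Lk := same_sign_locally (ev k : R * R -> R) q (ev_continuous k q) kq.
  apply: (locally_imp _ _ _ (filter_and _ _ Lk (filter_and _ _ Lc Ld))) => q' [] Hk [Hc Hd].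
  move/(ev_mul_eq0 _ _ _ _ _ ef Hc) => [h'|k'].
    by rewrite (hg q) // (hg q') //; exact: same_sign_refl.
  by case: (same_sign_neq0 _ _ Hk kq k').
Qed.


(** Characteristic zero: the coefficient of index [(size f).-2] in the derivative is [(size f).-1]
    times the leading coefficient of [f]. *)
Lemma deriv_neq0 (f : {poly {poly R}}) : (1 < size f)%N -> f^`() != 0.
Proof.
move=> sf; apply/eqP => /polyP /(_ (size f).-2); rewrite coef_deriv coef0.
have e : (size f).-2.+1 = (size f).-1 by case: (size f) sf => [|[|]].
rewrite e => /polyP H.
have f0 : lead_coef f != 0 by rewrite lead_coef_eq0 -size_poly_eq0; case: (size f) sf.
case/eqP: f0; apply/polyP => i; move: (H i); rewrite coefMn !coef0 => /eqP.
by rewrite mulrn_eq0 /= -lead_coefE; case: (size f) sf => [|[|n]] //= _ /eqP.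
Qed.

(* At a simple root the intermediate value theorem applies; common factors of [f] and its
   derivative are split off as in [sign_locally_constant]. *)
Lemma roots_open (f : {poly {poly R}}) : f != 0 ->
  exists B : list R, forall q : R * R, ~ In (fst q) B -> ev f q = 0 ->
    forall U : R * R -> Prop, locally q U ->
    locally (fst q) (fun u => exists v, U (u, v) /\ ev f (u, v) = 0).
Proof.
have [n] := ubnP (size f); elim: n f => // n IH f; rewrite ltnS => sf f0.
case: (coprime_or_factor f f^`() f0) => [[d [a [b [d0 e]]]]|].
  have [B HB] := finite_roots d d0; exists B => -[u v] qB fq U HU.
  have gq : ev f^`() (u, v) <> 0.
    move=> gq; apply: qB; apply: HB.
    by rewrite -(evC d (u, v)) -e evD !evM fq gq !mulr0 addr0.
  apply: (simple_root_open (ev f) u v _ U _ (ev_derive f u v) gq fq HU).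
  exact: ev_continuous.
case=> c [d [h [k [l [/andP[c0 d0] ef eg sk [sg k0]]]]]].
have h0 : h != 0.
  apply: contraNneq f0 => h0; move: ef; rewrite h0 mul0r => /eqP.
  by rewrite -mul_polyC mulf_eq0 polyC_eq0 (negPf c0).
(* Both factors must be smaller for the induction. For [h] this comes from the degree of the
   derivative; size at most one is impossible, since [k] would be zero. *)
have sh' : (size h < size f)%N.
  have [s1|s1] := leqP (size f) 1.
    by have := leq_trans sk s1; rewrite ltnS leqn0 size_poly_eq0 (negPf k0).
  apply: leq_ltn_trans (sg (deriv_neq0 f s1)) _; exact: lt_size_deriv.
have [B1 HB1] := finite_roots c c0.
have [B2 HB2] := IH k (leq_trans sk sf) k0.
have [B3 HB3] := IH h (leq_trans sh' sf) h0.
exists (B1 ++ B2 ++ B3)%list => q qB fq U HU.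
have cq : c.[q.1] <> 0 by move=> /HB1 K; apply: qB; rewrite !in_app_iff; left.
have qB2 : ~ In (fst q) B2 by move=> K; apply: qB; rewrite !in_app_iff; right; left.
have qB3 : ~ In (fst q) B3 by move=> K; apply: qB; rewrite !in_app_iff; right; right.
have HU' := locally_and _ _ _ HU (horner_nonzero_locally c q cq).
have fact q' := ev_mul_eq0 _ _ _ _ q' ef.
case: (iffLR (fact q cq) fq) => H.
- refine (locally_imp _ _ _ (HB3 q qB3 H _ HU') _) => u [v [[Uv cv] hv]].
  by exists v; split=> //; apply/(fact (u, v) cv); left.
- refine (locally_imp _ _ _ (HB2 q qB2 H _ HU') _) => u [v [[Uv cv] hv]].
  by exists v; split=> //; apply/(fact (u, v) cv); right.
Qed.

(** * Root bounds and the sheared polynomial *)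

Lemma horner_bounded (c : {poly R}) (N : R) :
  exists C : R, forall u, Rle (Rabs u) N -> Rle (Rabs c.[u]) C.
Proof.
elim/poly_ind: c => [|c a [C HC]].
  by exists R0 => u _; rewrite horner0; exact: (Req_le _ _ Rabs_R0).
exists (Rplus (Rmult C N) (Rabs a)) => u Hu; rewrite hornerMXaddC.
exact: (horner_step_bound _ _ _ _ _ (HC u Hu) Hu).
Qed.

(** Degree below [D] means growth at most like [|v| ^ (D - 1)]; the extra factor [|v|] avoids the
    subtraction and includes [D = 0]. *)
Lemma ev_bounded (D : nat) (P : {poly {poly R}}) (N : R) : (size P <= D)%N ->
  exists C : R, forall u v, Rle (Rabs u) N -> Rle R1 (Rabs v) ->
    Rle (Rmult (Rabs (ev P (u, v))) (Rabs v)) (Rmult C (pow (Rabs v) D)).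
Proof.
elim: D P => [|D IH] P.
  rewrite leqn0 size_poly_eq0 => /eqP ->; exists R0 => u v _ _.
  by rewrite /ev !horner0 (Rabs_R0 : Rabs 0 = R0) !Rmult_0_l; exact: Rle_refl.
elim/poly_ind: P => [|P c _] sP.
  exists R0 => u v _ _.
  by rewrite /ev !horner0 (Rabs_R0 : Rabs 0 = R0) !Rmult_0_l; exact: Rle_refl.
have sP' : (size P <= D)%N.
  by move: sP; rewrite size_MXaddC; case: ifP => // /andP[/eqP -> _]; rewrite size_poly0.
have [C HC] := IH P sP'; have [C' HC'] := horner_bounded c N.
exists (Rplus C C') => u v Hu Hv; rewrite evD evM evX evC /=.
exact: (ev_step_bound _ _ _ _ _ _ (HC u v Hu Hv) (HC' u Hu) Hv).
Qed.

Lemma roots_bounded (D : nat) (F : {poly {poly R}}) (a N : R) : a <> 0 ->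
  size F = D.+1 -> lead_coef F = a%:P ->
  exists M : R, forall u v, Rle (Rabs u) N -> ev F (u, v) = 0 -> Rle (Rabs v) M.
Proof.
move=> a0 sF lF.
(* Without its leading term [F] has size at most [D], and at a root the rest equals minus that
   term. *)
have [|C HC] := ev_bounded D (F - a%:P%:P * 'X^D) N.
  apply/leq_sizeP => j; rewrite leq_eqVlt coefB coefCM coefXn => /orP[/eqP <-|Dj].
    by rewrite eqxx mulr1 -lF lead_coefE sF subrr.
  rewrite (gtn_eqF Dj) mulr0 subr0.
  by apply: nth_default; rewrite sF.
exists (Rplus (Rdiv (Rabs C) (Rabs a)) R1) => u v Hu Fv.
have evXn n : ev ('X^n) (u, v) = pow v n.
  by elim: n => [|n IHn]; [rewrite expr0 /ev !hornerC|rewrite exprS evM IHn evX].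
apply: (root_bound D _ _ _ a0) => Hv.
have := HC u v Hu Hv.
suff -> : ev (F - a%:P%:P * 'X^D) (u, v) = Ropp (Rmult a (pow v D)) by [].
by rewrite evD Fv add0r -mulNr evM evXn -!polyCN !evC hornerC mulNr.
Qed.

Definition shear_mono (c : R) (m : R * nat * nat) : {poly {poly R}} :=
  (m.1.1)%:P%:P * ('X%:P + c%:P%:P * 'X) ^+ m.1.2 * 'X^(m.2).

Lemma ev_exp P n q : ev (P ^+ n) q = pow (ev P q) n.
Proof. by elim: n => [|n IHn]; [rewrite expr0 /ev !hornerC|rewrite exprS evM IHn]. Qed.

Lemma ev_shear (c : R) (f : poly2) (u v : R) :
  ev (\sum_(m <- f) shear_mono c m) (u, v) = peval f (Rplus u (Rmult c v), v).
Proof.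
elim: f => [|[[a i] j] f IH]; first by rewrite big_nil /ev !horner0.
by rewrite big_cons evD IH /shear_mono !evM !ev_exp evD evM !evX !evC hornerX !hornerC.
Qed.

(** The offset [k] carries two facts through one induction: the degree in [v] is at most [i], and
    the coefficient at [i] is [c ^ i]. The same device yields size and leading coefficient in
    [coef_shear]. *)
Lemma coef_shear_exp (c : R) (i k : nat) :
  (('X%:P + c%:P%:P * 'X : {poly {poly R}}) ^+ i)`_(i + k) = if k == 0%N then (c ^+ i)%:P else 0.
Proof.
elim: i k => [|i IH] k; first by rewrite expr0 add0n coef1 expr0; case: k.
rewrite exprS mulrDl coefD coefCM -mulrA coefCM coefXM /=.
have -> : (i.+1 + k = i + k.+1)%N by rewrite addSnnS.
rewrite IH /= mulr0 add0r IH.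
by case: k => [|k]; rewrite ?mulr0 //= -polyCM -exprS.
Qed.

Lemma coef_shear_mono (c a : R) (i j D k : nat) : (i + j <= D)%N ->
  (shear_mono c (a, i, j))`_(D + k) =
  if (i + j == D)%N && (k == 0)%N then (a * c ^+ i)%:P else 0.
Proof.
move=> ijD; rewrite /shear_mono /= coefMXn ltnNge.
have jD : (j <= D + k)%N by rewrite (leq_trans (leq_addl i j)) // (leq_trans ijD) // leq_addr.
rewrite jD /= coefCM.
have -> : (D + k - j = i + (D - (i + j) + k))%N.
  by rewrite -{1}(subnKC ijD) -!addnA (addnC j) !addnA addnK -!addnA.
rewrite coef_shear_exp addn_eq0 subn_eq0.
have -> : (D <= i + j)%N = (i + j == D)%N by rewrite eqn_leq ijD.
by case: ifP; rewrite ?mulr0 // polyCM.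
Qed.

Lemma coef_shear (c : R) (D : nat) (f : poly2) (k : nat) : degree_le D f ->
  (\sum_(m <- f) shear_mono c m)`_(D + k) =
  if k == 0%N then (peval (top_part D f) (c, R1))%:P else 0.
Proof.
elim: f => [|[[a i] j] f IH] Hd; first by rewrite big_nil coef0; case: ifP.
have ijD : (i + j <= D)%N by apply/leP/(Hd a i j); left.
have Hd' : degree_le D f by move=> b m n Hin; apply: (Hd b m n); right.
rewrite big_cons coefD IH // (coef_shear_mono _ _ _ _ _ _ ijD) /=.
case: (Nat.eqb_spec (i + j) D) => [/eqP->|/eqP/negPf->] /=; case: ifP => _; rewrite ?addr0 ?add0r //.
rewrite -polyCD; congr (_%:P).
by rewrite /peval /= pow1 Rmult_1_r -RpowE.
Qed.

Lemma curve_shear (f : poly2) : (exists p, peval f p <> R0) ->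
  exists c D G B, sheared_curve (fun p => peval f p = R0) c D G B.
Proof.
move=> Hnz; have [D0 HD0] := exists_degree_le f.
have [f' [D [c [Ef [Hd Hc]]]]] := exists_shear D0 f HD0 Hnz.
pose F := \sum_(m <- f') shear_mono c m; pose a := peval (top_part D f') (c, R1).
have FD k : F`_(D + k) = if k == 0%N then a%:P else 0 by exact: coef_shear.
have FD0 : F`_D = a%:P by have := FD 0; rewrite addn0.
have a0 : a%:P != 0 :> {poly R} by rewrite polyC_eq0; apply/eqP.
have sF : size F = D.+1.
  apply/eqP; rewrite eqn_leq; apply/andP; split.
    by apply/leq_sizeP => j Dj; rewrite -(subnKC (ltnW Dj)) FD subn_eq0 leqNgt Dj.
  by rewrite ltnNge; apply/negP => /leq_sizeP /(_ D (leqnn D)); rewrite FD0; apply/eqP.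
have lF : lead_coef F = a%:P by rewrite lead_coefE sF.
have F0 : F != 0 by rewrite -size_poly_eq0 sF.
have [B0 HB0] := roots_open F F0.
have HB k := sign_locally_constant F F^`(k) F0.
(* Choice makes the bad set a function of the order [k]. Derivatives of order above [D] vanish, so
   finitely many of these sets suffice. *)
pose Bk k := proj1_sig (constructive_indefinite_description _ (HB k)).
have HBk k : forall q : R * R, ~ In (fst q) (Bk k) -> ev F q = R0 ->
    locally q (fun q' : R * R => ev F q' = R0 -> same_sign (ev F^`(k) q') (ev F^`(k) q)).
  by rewrite /Bk; case: constructive_indefinite_description.
(* [D!] times the leading coefficient: the nonzero constant at which the induction of Thom's lemma
   starts. *)
have topD : F^`(D) = (a *+ D`!)%:P%:P.
  apply/polyP => i; rewrite coef_derivn FD coefC; case: i => [|i] /=; last by rewrite mul0rn.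
  by rewrite addn0 ffactnn polyCMn.
exists c, D, (fun k => ev F^`(k)), (B0 ++ flat_map Bk (List.seq 0 (S D)))%list.
split.
- move=> x y; rewrite derivn0 ev_shear Ef.
  suff -> : Rplus (Rminus x (Rmult c y)) (Rmult c y) = x by [].
  by rewrite /Rminus Rplus_assoc Rplus_opp_l Rplus_0_r.
- by move=> k; exact: ev_poly_fun.
- by move=> k u v; rewrite derivnS; exact: ev_derive.
- exists (a *+ D`!); split; last by move=> q; rewrite topD !evC hornerC.
  by apply/eqP; rewrite mulrn_eq0 negb_or -lt0n fact_gt0 -polyC_eq0.
- by move=> N; apply: (roots_bounded D F a N) => //; apply/eqP; rewrite -polyC_eq0.
- move=> u.
  (* For fixed [u] the leading coefficient is still [a], so the polynomial in [v] is nonzero and has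
     finitely many roots. *)
  have Hm v : ev F (u, v) = (map_poly (horner_eval u) F).[v].
    by rewrite /ev -[in RHS](hornerC v u) -horner_evalE horner_map.
  have [|L HL] := finite_roots (map_poly (horner_eval u) F).
    apply/eqP => /polyP /(_ D); rewrite coef0 coef_map FD0 /= horner_evalE hornerC.
    by move/eqP; rewrite -polyC_eq0 (negPf a0).
  by exists L => v; rewrite derivn0 Hm; exact: HL.
- move=> k q qB; rewrite derivn0 => Fq.
  have [kD|Dk] := leqP k D.
    apply: HBk => // qk; apply: qB; rewrite in_app_iff in_flat_map; right.
    by exists k; split=> //; apply/in_seq; split; [exact: Nat.le_0_l|apply/leP].
  have -> : F^`(k) = 0.
    by apply: derivn_poly0; rewrite sF.
  by apply: filter_forall => q' _; rewrite /ev !horner0; exact: same_sign_refl.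
- move=> q qB; rewrite derivn0; apply: HB0 => qk; apply: qB.
  by rewrite in_app_iff; left.
Qed.

End Algebra.

(** * Locally finite families of cells *)

Lemma fst_le_dist2 (p q : pt) : Rabs (fst p - fst q) <= dist2 p q.
Proof.
  unfold dist2; rewrite <- sqrt_Rsqr_abs, Rsqr_pow2; apply sqrt_le_1_alt.
  pose proof (pow2_ge_0 (snd p - snd q)); lra.
Qed.

Lemma snd_le_dist2 (p q : pt) : Rabs (snd p - snd q) <= dist2 p q.
Proof.
  unfold dist2; rewrite <- sqrt_Rsqr_abs, Rsqr_pow2; apply sqrt_le_1_alt.
  pose proof (pow2_ge_0 (fst p - fst q)); lra.
Qed.

Lemma dist2_le (p q : pt) : dist2 p q <= Rabs (fst p - fst q) + Rabs (snd p - snd q).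
Proof.
  unfold dist2; pose proof (Rabs_pos (fst p - fst q)); pose proof (Rabs_pos (snd p - snd q)).
  rewrite <- (sqrt_Rsqr (Rabs (fst p - fst q) + Rabs (snd p - snd q))) by lra.
  apply sqrt_le_1_alt; unfold Rsqr.
  rewrite <- (pow2_abs (fst p - fst q)), <- (pow2_abs (snd p - snd q)); nra.
Qed.

Lemma dist2_refl (p : pt) : dist2 p p = 0.
Proof.
  unfold dist2; replace ((fst p - fst p) ^ 2 + (snd p - snd p) ^ 2) with 0 by ring.
  apply sqrt_0.
Qed.

Lemma dist2_sym (p q : pt) : dist2 p q = dist2 q p.
Proof. unfold dist2; f_equal; ring. Qed.

(** Passage between the product uniform space, whose balls are squares, and Euclidean distance. *)
Lemma locally_dist2 (p : R * R) (U : R * R -> Prop) :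
  locally p U <-> exists r, 0 < r /\ forall q, dist2 p q < r -> U q.
Proof.
  split.
  - intros [eps H]; exists eps; split; [apply cond_pos|]; intros [x y] Hq; apply H.
    pose proof (fst_le_dist2 p (x, y)) as H1; pose proof (snd_le_dist2 p (x, y)) as H2.
    rewrite Rabs_minus_sym in H1, H2; simpl in H1, H2.
    split; [change (Rabs (x - fst p) < eps) | change (Rabs (y - snd p) < eps)]; lra.
  - intros [r [Hr H]].
    assert (Hr2 : 0 < r / 2) by lra.
    exists (mkposreal _ Hr2); intros [x y] [H1 H2]; apply H.
    assert (H1' : Rabs (fst p - x) < r / 2) by (rewrite Rabs_minus_sym; exact H1).
    assert (H2' : Rabs (snd p - y) < r / 2) by (rewrite Rabs_minus_sym; exact H2).
    apply (Rle_lt_trans _ _ _ (dist2_le p (x, y))); simpl; lra.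
Qed.

Lemma poly_fun_dist2 (g : pt -> R) (p : pt) (eps : R) : poly_fun g -> 0 < eps ->
  exists r, 0 < r /\ forall q, dist2 p q < r -> Rabs (g q - g p) < eps.
Proof.
  intros Hg He; apply locally_dist2.
  exact (poly_fun_continuous g p Hg _ (locally_ball (g p) (mkposreal _ He))).
Qed.

Lemma poly_fun_same_sign (g : pt -> R) (p : pt) : poly_fun g -> g p <> 0 ->
  exists r, 0 < r /\ forall q, dist2 p q < r -> same_sign (g q) (g p).
Proof.
  intros Hg Hp; apply locally_dist2.
  exact (same_sign_locally (g : R * R -> R) p (poly_fun_continuous g p Hg) Hp).
Qed.

Lemma closed2_zero_set (g : pt -> R) : poly_fun g -> closed2 (fun p => g p = 0).
Proof.
  intros Hg p Hp; apply NNPP; intros Hn.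
  destruct (poly_fun_same_sign g p Hg Hn) as (r & Hr & H).
  destruct (Hp r Hr) as (q & Hq & Hd).
  exact (same_sign_neq0 _ _ (H q Hd) Hn Hq).
Qed.

(** * Semialgebraic sets *)

Lemma semialgebraic_ext (S T : pt -> Prop) :
  (forall p, S p <-> T p) -> semialgebraic S -> semialgebraic T.
Proof.
  intros E [U [HU H]]; exists U; split; [exact HU|]; intros p; rewrite <- E; apply H.
Qed.

Lemma semialgebraic_pos (g : pt -> R) : poly_fun g -> semialgebraic (fun p => 0 < g p).
Proof.
  intros [h Hh]; exists (fun p => 0 < peval h p); split; [constructor|].
  intros p; rewrite Hh; tauto.
Qed.

Lemma semialgebraic_and (S T : pt -> Prop) :
  semialgebraic S -> semialgebraic T -> semialgebraic (fun p => S p /\ T p).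
Proof.
  intros [S' [HS ES]] [T' [HT ET]]; exists (fun p => S' p /\ T' p).
  split; [constructor; assumption|]; intros p; rewrite ES, ET; tauto.
Qed.

Lemma semialgebraic_not (S : pt -> Prop) : semialgebraic S -> semialgebraic (fun p => ~ S p).
Proof.
  intros [S' [HS ES]]; exists (fun p => ~ S' p); split; [constructor; assumption|].
  intros p; rewrite ES; tauto.
Qed.

Lemma semialgebraic_lt (g h : pt -> R) : poly_fun g -> poly_fun h ->
  semialgebraic (fun p => g p < h p).
Proof.
  intros Hg Hh; apply (semialgebraic_ext (fun p => 0 < h p + - g p)).
  - intros p; split; lra.
  - apply semialgebraic_pos, poly_fun_plus; [exact Hh|apply poly_fun_opp, Hg].
Qed.

Lemma semialgebraic_eq (g h : pt -> R) : poly_fun g -> poly_fun h ->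
  semialgebraic (fun p => g p = h p).
Proof.
  intros Hg Hh; apply (semialgebraic_ext (fun p => ~ g p < h p /\ ~ h p < g p)).
  - intros p; split; lra.
  - apply semialgebraic_and; apply semialgebraic_not, semialgebraic_lt; assumption.
Qed.

Lemma semialgebraic_point (P : pt) : semialgebraic (fun p => p = P).
Proof.
  apply (semialgebraic_ext (fun p => fst p = fst P /\ snd p = snd P)).
  - intros [x y]; destruct P as [a b]; simpl; split.
    + intros [-> ->]; reflexivity.
    + intros H; inversion H; auto.
  - apply semialgebraic_and; apply semialgebraic_eq; apply poly_fun_fst || apply poly_fun_snd || apply poly_fun_const.
Qed.

Lemma semialgebraic_same_sign (g : pt -> R) (a : R) : poly_fun g ->
  semialgebraic (fun p => same_sign (g p) a).
Proof.
  intros Hg; unfold same_sign.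
  assert (Hiff : forall S (P : Prop), semialgebraic S -> semialgebraic (fun p => S p <-> P)).
  { intros S P HS; destruct (classic P).
    - apply (semialgebraic_ext S); [intros; tauto|exact HS].
    - apply (semialgebraic_ext (fun p => ~ S p)); [intros; tauto|apply semialgebraic_not, HS]. }
  apply semialgebraic_and; apply Hiff, semialgebraic_lt; exact Hg || apply poly_fun_const.
Qed.

Lemma semialgebraic_forall_le (S : nat -> pt -> Prop) (D : nat) :
  (forall k, semialgebraic (S k)) -> semialgebraic (fun p => forall k, (k <= D)%nat -> S k p).
Proof.
  intros H; induction D as [|D IH].
  - apply (semialgebraic_ext (S 0%nat)); [|apply H].
    intros p; split; [intros Hp k Hk; replace k with 0%nat by lia; exact Hp|intros Hp; apply Hp; lia].
  - apply (semialgebraic_ext (fun p => (forall k, (k <= D)%nat -> S k p) /\ S (Datatypes.S D) p)).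
    + intros p; split.
      * intros [H1 H2] k Hk; destruct (Nat.eq_dec k (Datatypes.S D)) as [->|]; [exact H2|apply H1; lia].
      * intros Hp; split; [intros k Hk|]; apply Hp; lia.
    + apply semialgebraic_and; [exact IH|apply H].
Qed.

(** * Cells of different dimension are not homeomorphic *)

Lemma cont_on_path (D : pt -> Prop) (h : pt -> R) (a b : R -> R) (t : R) :
  cont_on dist2 dist1 D h -> (forall s, D (a s, b s)) ->
  continuous a t -> continuous b t -> continuous (fun s => h (a s, b s)) t.
Proof.
  intros Hh HD Ha Hb; apply filterlim_locally; intros eps.
  destruct (Hh (a t, b t) (HD t) eps (cond_pos eps)) as (delta & Hd & H).
  assert (Hd2 : 0 < delta / 2) by lra.
  pose proof (proj1 (filterlim_locally a (a t)) Ha (mkposreal _ Hd2)) as La.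
  pose proof (proj1 (filterlim_locally b (b t)) Hb (mkposreal _ Hd2)) as Lb.
  apply (locally_imp _ _ _ (locally_and _ _ _ La Lb)); intros s [H1 H2].
  change (Rabs (a s - a t) < delta / 2) in H1; change (Rabs (b s - b t) < delta / 2) in H2.
  change (Rabs (h (a s, b s) - h (a t, b t)) < eps).
  rewrite Rabs_minus_sym; apply (H (a s, b s) (HD s)).
  pose proof (dist2_le (a t, b t) (a s, b s)) as H3; simpl in H3.
  rewrite Rabs_minus_sym in H1, H2; lra.
Qed.

(* Borsuk-Ulam in dimension one, on the circle of radius 1/2. *)
Lemma no_disk_into_line (h : pt -> R) : cont_on dist2 dist1 open_disk h ->
  ~ (forall p q, open_disk p -> open_disk q -> h p = h q -> p = q).
Proof.
  intros Hc Hinj.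
  (* The difference of [h] at antipodal points is opposite at [0] and [PI], so it vanishes in
     between, against injectivity. *)
  set (k := fun t => h (cos t / 2, sin t / 2) - h (- cos t / 2, - sin t / 2)).
  assert (Hcos : forall (s t : R), continuous (fun x => s * cos x / 2) t).
  { intros s t; apply (ex_derive_continuous (fun x => s * cos x / 2)); auto_derive; auto. }
  assert (Hsin : forall (s t : R), continuous (fun x => s * sin x / 2) t).
  { intros s t; apply (ex_derive_continuous (fun x => s * sin x / 2)); auto_derive; auto. }
  assert (Hdisk : forall s t, s = 1 \/ s = -1 -> open_disk (s * cos t / 2, s * sin t / 2)).
  { intros s t Hs; unfold open_disk; simpl; pose proof (sin2_cos2 t) as E; unfold Rsqr in E.
    destruct Hs; subst s; nra. }
  assert (Hk : forall t, continuous k t).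
  { intros t.
    apply (continuous_ext (fun t => h (1 * cos t / 2, 1 * sin t / 2) - h (-1 * cos t / 2, -1 * sin t / 2))).
    { intros x; unfold k.
      replace (1 * cos x / 2) with (cos x / 2) by field; replace (1 * sin x / 2) with (sin x / 2) by field.
      replace (-1 * cos x / 2) with (- cos x / 2) by field.
      replace (-1 * sin x / 2) with (- sin x / 2) by field; reflexivity. }
    apply (continuous_minus (fun t => h (1 * cos t / 2, 1 * sin t / 2)) (fun t => h (-1 * cos t / 2, -1 * sin t / 2)));
      apply (cont_on_path open_disk h); auto. }
  destruct (IVT_gen k 0 PI 0) as [t [_ Ht]].
  - intros t; apply continuity_pt_filterlim, Hk.
  - unfold k; rewrite cos_0, sin_0, cos_PI, sin_PI.
    replace (- (-1) / 2) with (1 / 2) by field; change (-1) with (Ropp 1); replace (- 0 / 2) with (0 / 2) by field.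
    unfold Rmin, Rmax; destruct (Rle_dec _ _); lra.
  - unfold k in Ht.
    assert (E : (cos t / 2, sin t / 2) = (- cos t / 2, - sin t / 2)).
    { apply Hinj; [| |lra].
      - replace (cos t / 2) with (1 * cos t / 2) by field; replace (sin t / 2) with (1 * sin t / 2) by field; auto.
      - replace (- cos t / 2) with (-1 * cos t / 2) by field; replace (- sin t / 2) with (-1 * sin t / 2) by field; auto. }
    inversion E; pose proof (sin2_cos2 t) as E2; unfold Rsqr in E2; nra.
Qed.

Lemma cont_on_comp {U V W : Type} (dU : U -> U -> R) (dV : V -> V -> R) (dW : W -> W -> R)
  (D : U -> Prop) (E : V -> Prop) (f : U -> V) (g : V -> W) :
  (forall x, D x -> E (f x)) -> cont_on dU dV D f -> cont_on dV dW E g ->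
  cont_on dU dW D (fun x => g (f x)).
Proof.
  intros HDE Hf Hg x Hx eps Heps.
  destruct (Hg (f x) (HDE x Hx) eps Heps) as (d & Hd & H).
  destruct (Hf x Hx d Hd) as (d' & Hd' & H').
  exists d'; split; [exact Hd'|]; intros y Hy Hxy; apply H; auto.
Qed.

(** The two homeomorphisms would combine into a continuous injection of the disk into the line. *)
Lemma cell1_not_cell2 (e : pt -> Prop) : cell1 e -> ~ cell2 e.
Proof.
  intros [f (_ & _ & g & Hg & Hgc & _ & Hfg)] [f2 (Hf2 & Hf2c & g2 & _ & _ & Hgf2 & _)].
  apply (no_disk_into_line (fun p => g (f2 p))).
  - exact (cont_on_comp dist2 dist2 dist1 open_disk e f2 g Hf2 Hf2c Hgc).
  - intros p q Hp Hq E.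
    rewrite <- (Hgf2 p Hp), <- (Hgf2 q Hq), <- (Hfg (f2 p) (Hf2 p Hp)), <- (Hfg (f2 q) (Hf2 q Hq)).
    rewrite E; reflexivity.
Qed.

Lemma cell0_not_cell1 (e : pt -> Prop) : cell0 e -> ~ cell1 e.
Proof.
  intros [P HP] [f (Hf & _ & g & _ & _ & Hgf & _)].
  assert (H0 : Defs.open_interval 0) by (unfold Defs.open_interval; lra).
  assert (H1 : Defs.open_interval (1 / 2)) by (unfold Defs.open_interval; lra).
  pose proof (Hgf 0 H0) as E0; pose proof (Hgf _ H1) as E1.
  rewrite (proj1 (HP _) (Hf _ H0)) in E0; rewrite (proj1 (HP _) (Hf _ H1)) in E1; lra.
Qed.

Lemma cell0_not_cell2 (e : pt -> Prop) : cell0 e -> ~ cell2 e.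
Proof.
  intros [P HP] [f (Hf & _ & g & _ & _ & Hgf & _)].
  assert (H0 : open_disk (0, 0)) by (unfold open_disk; simpl; lra).
  assert (H1 : open_disk (1 / 2, 0)) by (unfold open_disk; simpl; lra).
  pose proof (Hgf _ H0) as E0; pose proof (Hgf _ H1) as E1.
  rewrite (proj1 (HP _) (Hf _ H0)) in E0; rewrite (proj1 (HP _) (Hf _ H1)) in E1.
  rewrite E0 in E1; inversion E1; lra.
Qed.

Lemma char_map1_cell1 (A : (pt -> Prop) -> Prop) (e : pt -> Prop) : char_map1 A e -> cell1 e.
Proof. intros (Phi & _ & H & _); exists Phi; exact H. Qed.

Lemma char_map2_cell2 (A : (pt -> Prop) -> Prop) (e : pt -> Prop) : char_map2 A e -> cell2 e.
Proof. intros (Phi & _ & H & _); exists Phi; exact H. Qed.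

Definition in_box (N : R) (p : pt) : Prop := Rabs (fst p) <= N /\ Rabs (snd p) <= N.

Lemma in_box_near (N r : R) (p q : pt) : in_box N p -> dist2 p q < r -> in_box (N + r) q.
Proof.
  intros [H1 H2] H; pose proof (fst_le_dist2 p q) as H3; pose proof (snd_le_dist2 p q) as H4.
  split.
  - replace (fst q) with (fst p + - (fst p - fst q)) by ring.
    apply Rle_trans with (1 := Rabs_triang _ _); rewrite Rabs_Ropp; lra.
  - replace (snd q) with (snd p + - (snd p - snd q)) by ring.
    apply Rle_trans with (1 := Rabs_triang _ _); rewrite Rabs_Ropp; lra.
Qed.

Lemma exists_in_box (p : pt) : exists n : nat, in_box (INR n) p.
Proof.
  destruct (INR_unbounded (Rabs (fst p) + Rabs (snd p))) as [n Hn]; exists n.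
  pose proof (Rabs_pos (fst p)); pose proof (Rabs_pos (snd p)); split; lra.
Qed.

(** The closure of a finite union is the union of the closures: if [p] were outside each of them,
    the least of finitely many radii would give a ball that misses every member. *)
Lemma closure2_finite_union (S : pt -> Prop) (L : list (pt -> Prop)) (p : pt) :
  (forall r, 0 < r -> exists q c, S q /\ dist2 p q < r /\ In c L /\ c q) ->
  exists c, In c L /\ closure2 (fun q => S q /\ c q) p.
Proof.
  intros H; apply NNPP; intros Hn.
  assert (K : forall L', (forall c, In c L' -> In c L) ->
    exists r, 0 < r /\ forall q c, In c L' -> S q -> c q -> ~ dist2 p q < r).
  { induction L' as [|c L' IH]; intros Hsub; [exists 1; split; [lra|intros q c []]|].
    destruct IH as (r & Hr & IH); [intros c' Hc'; apply Hsub; right; exact Hc'|].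
    destruct (classic (closure2 (fun q => S q /\ c q) p)) as [Hc|Hc].
    { exfalso; apply Hn; exists c; split; [apply Hsub; left; reflexivity|exact Hc]. }
    apply not_all_ex_not in Hc; destruct Hc as [r' Hr']; apply imply_to_and in Hr'.
    destruct Hr' as [Hr' Hc]; exists (Rmin r r'); split; [apply Rmin_pos; assumption|].
    intros q c' [<-|Hin] HS Hq Hd.
    - apply Hc; exists q; split; [auto|]; pose proof (Rmin_r r r'); lra.
    - apply (IH q c' Hin HS Hq); pose proof (Rmin_l r r'); lra. }
  destruct (K L (fun c H => H)) as (r & Hr & HK).
  destruct (H r Hr) as (q & c & HS & Hd & Hin & Hc); exact (HK q c Hin HS Hc Hd).
Qed.

Lemma closure2_mono (S T : pt -> Prop) : subset S T -> subset (closure2 S) (closure2 T).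
Proof. intros H p Hp r Hr; destruct (Hp r Hr) as (q & Hq & Hd); exists q; auto. Qed.

Lemma closure2_incl (S : pt -> Prop) : subset S (closure2 S).
Proof. intros p Hp r Hr; exists p; rewrite dist2_refl; auto. Qed.

(** [Cantor.of_nat] runs through all pairs of a stage [n] and a position in its finite list; [t0]
    fills the positions past the end. *)
Lemma countable_of_locally_finite {T : Type} (A : T -> Prop) (F : nat -> T -> Prop) (t0 : T) :
  (forall n, exists L, forall c, A c -> F n c -> In c L) ->
  (forall c, A c -> exists n, F n c) ->
  exists enum : nat -> T, forall c, A c -> exists n, enum n = c.
Proof.
  intros HL HF.
  set (L := fun n => proj1_sig (constructive_indefinite_description _ (HL n))).
  exists (fun n => nth (snd (Cantor.of_nat n)) (L (fst (Cantor.of_nat n))) t0).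
  intros c Hc; destruct (HF c Hc) as [n Hn].
  assert (Hin : In c (L n)).
  { unfold L; destruct (constructive_indefinite_description _ _) as [l Hl]; simpl; auto. }
  destruct (In_nth _ _ t0 Hin) as (m & _ & Hm).
  exists (Cantor.to_nat (n, m)); rewrite Cantor.cancel_of_to; exact Hm.
Qed.

(** The closure of a bounded cell stays in a slightly larger box, so it meets finitely many cells.
    For the weak topology: the points of [S] near a limit point [p] lie in finitely many cells, so
    [p] is a limit of [S] inside a single cell [c], and closedness relative to the closure of [c]
    applies. *)
Lemma cw_of_locally_finite (X : pt -> Prop) (A : (pt -> Prop) -> Prop) :
  closed2 X ->
  (forall c, A c -> semialgebraic c) ->
  (forall c, A c -> cell0 c \/ char_map1 A c \/ char_map2 A c) ->
  (forall p, X p <-> exists c, A c /\ c p) ->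
  (forall c1 c2, A c1 -> A c2 -> forall p, c1 p -> c2 p -> c1 = c2) ->
  (forall c, A c -> exists N, forall p, c p -> in_box N p) ->
  (forall N, exists L, forall c, A c -> (exists p, c p /\ in_box N p) -> In c L) ->
  cell_decomposition X A /\ CW_complex X A.
Proof.
  intros HX Hsa Htype Hcover Hdisj Hbd HLF.
  assert (Hne : forall c, A c -> exists p, c p).
  { intros c Hc; destruct (Htype c Hc) as [[P HP]|[(f & _ & (Hf & _) & _)|(f & _ & (Hf & _) & _)]].
    - exists P; apply HP; reflexivity.
    - exists (f 0); apply Hf; unfold Defs.open_interval; lra.
    - exists (f (0, 0)); apply Hf; unfold open_disk; simpl; lra. }
  assert (HcX : forall c, A c -> subset (closure2 c) X).
  { intros c Hc p Hp; apply HX, (closure2_mono c); [|exact Hp].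
    intros q Hq; apply Hcover; exists c; auto. }
  split; [split; [|split; [|split]]|split; [|split; [|split]]].
  - apply (countable_of_locally_finite A (fun n c => exists p, c p /\ in_box (INR n) p) (fun _ => True)).
    + intros n; apply HLF.
    + intros c Hc; destruct (Hne c Hc) as [p Hp]; destruct (exists_in_box p) as [n Hn].
      exists n, p; auto.
  - intros c Hc; split; [apply Hsa, Hc|].
    destruct (Htype c Hc) as [H|[H|H]]; [left; exact H|right; left|right; right].
    + apply char_map1_cell1 with A, H.
    + apply char_map2_cell2 with A, H.
  - exact Hcover.
  - exact Hdisj.
  - intros e He H1; destruct (Htype e He) as [H|[H|H]]; [|exact H|].
    + destruct (cell0_not_cell1 e H H1).
    + destruct (cell1_not_cell2 e H1 (char_map2_cell2 A e H)).
  - intros e He H2; destruct (Htype e He) as [H|[H|H]]; [| |exact H].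
    + destruct (cell0_not_cell2 e H H2).
    + destruct (cell1_not_cell2 e (char_map1_cell1 A e H) H2).
  - intros e He; destruct (Hbd e He) as [N HN]; destruct (HLF (N + 1)) as [L HL].
    exists L; intros c Hc (p & Hp & Hcp); exists c; split; [|intros q; tauto].
    apply HL; [exact Hc|]; exists p; split; [exact Hcp|].
    destruct (Hp 1 ltac:(lra)) as (q & Hq & Hd).
    apply (in_box_near N 1 q p); [apply HN, Hq|rewrite dist2_sym; exact Hd].
  - intros S HS; split.
    + intros (F & HF & HFS) e He; exists F; split; [exact HF|]; intros p; rewrite HFS; split.
      * tauto.
      * intros [H1 H2]; repeat split; try assumption; apply (HcX e He), H2.
    + intros H; exists S; split; [|intros p; split; [intros Hp; split; auto|tauto]].
      intros p Hp.
      destruct (exists_in_box p) as [n Hn]; destruct (HLF (INR n + 1)) as [L HL].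
      (* The list from local finiteness may also hold sets outside [A]; the filter removes them,
         because the hypothesis [H] concerns cells only. *)
      destruct (closure2_finite_union (fun q => S q) (filter (fun c => if excluded_middle_informative (A c) then true else false) L) p) as (c & Hin & Hc).
      { intros r Hr; destruct (Hp (Rmin r 1)) as (q & Hq & Hd); [apply Rmin_pos; lra|].
        destruct (proj1 (Hcover q) (HS q Hq)) as (c & HAc & Hcq).
        exists q, c; pose proof (Rmin_l r 1); pose proof (Rmin_r r 1).
        repeat split; try assumption; [lra|].
        apply filter_In; split.
        - apply HL; [exact HAc|]; exists q; split; [exact Hcq|].
          apply (in_box_near (INR n) 1 p q); [exact Hn|lra].
        - destruct (excluded_middle_informative (A c)); [reflexivity|contradiction]. }
      apply filter_In in Hin; destruct Hin as [_ HA].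
      destruct (excluded_middle_informative (A c)) as [HAc|]; [clear HA|discriminate].
      destruct (H c HAc) as (F & HF & HFS).
      apply (HFS p); split; [|apply (closure2_mono (fun q => S q /\ c q)); [intros q; tauto|exact Hc]].
      apply HF, (closure2_mono (fun q => S q /\ c q)); [|exact Hc].
      intros q [Hq1 Hq2]; apply HFS; split; [exact Hq1|apply closure2_incl, Hq2].
Qed.

(** * One real variable *)

(** Connectedness of [[a, b]], for an arbitrary predicate: consider the supremum of the points up to
    which [P] keeps its value at [a]. Local constancy there carries the agreement beyond it, so the
    supremum cannot stop short of [b]. *)
Lemma locally_constant_interval (P : R -> Prop) (a b : R) : a <= b ->
  (forall s, a <= s <= b -> exists delta, 0 < delta /\
    forall s', a <= s' <= b -> Rabs (s' - s) < delta -> (P s' <-> P s)) ->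
  (P a <-> P b).
Proof.
  intros Hab H.
  set (E := fun s => a <= s <= b /\ forall s', a <= s' <= s -> (P s' <-> P a)).
  destruct (completeness E) as [m [Hub Hlub]].
  { exists b; intros s [Hs _]; lra. }
  { exists a; split; [lra|]; intros s' Hs'; replace s' with a by lra; tauto. }
  assert (Ham : a <= m).
  { apply Hub; split; [lra|]; intros s' Hs'; replace s' with a by lra; tauto. }
  assert (Hmb : m <= b) by (apply Hlub; intros s [Hs _]; lra).
  destruct (H m (conj Ham Hmb)) as (delta & Hd & Hm).
  assert (Hex : exists s, E s /\ m - delta < s).
  { apply NNPP; intros Hn; assert (m <= m - delta); [|lra].
    apply Hlub; intros s Hs; apply Rnot_lt_le; intros Hlt; apply Hn; exists s; auto. }
  destruct Hex as (s & [Hs1 Hs2] & Hs3).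
  assert (Hsm : s <= m) by (apply Hub; split; assumption).
  assert (Key : forall s', a <= s' <= b -> s' < m + delta -> (P s' <-> P a)).
  { intros s' H1 H2; destruct (Rle_lt_dec s' s) as [Hle|Hlt]; [apply Hs2; lra|].
    rewrite (Hm s'), <- (Hm s), (Hs2 s); [tauto|lra|lra| |lra|]; apply Rabs_def1; lra. }
  destruct (Rlt_le_dec b (m + delta)) as [Hlt|Hle].
  - symmetry; apply Key; lra.
  - exfalso; assert (m + delta / 2 <= m); [|lra].
    apply Hub; split; [lra|]; intros s' Hs'; apply Key; lra.
Qed.

(** Compactness of [[-M, M]]: finitely many of the neighbourhoods cover the fibre, so one radius in
    [u] serves every [v]. *)
Lemma tube (M u : R) (N : R * R -> Prop) :
  (forall v, Rabs v <= M -> locally (u, v) N) ->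
  locally u (fun u' => forall v, Rabs v <= M -> N (u', v)).
Proof.
  intros H.
  assert (K : forall v, exists d : posreal, Rabs v <= M ->
    forall u' v', Rabs (u' - u) < d -> Rabs (v' - v) < d -> N (u', v')).
  { intros v; destruct (classic (Rabs v <= M)) as [Hv|Hv].
    - destruct (H v Hv) as [d Hd]; exists d; intros _ u' v' H1 H2; apply Hd; split; assumption.
    - exists (mkposreal 1 Rlt_0_1); intros Hv'; contradiction. }
  set (delta := fun v => proj1_sig (constructive_indefinite_description _ (K v))).
  destruct (compactness_value_1d (- M) M delta) as [d Hd].
  exists d; intros u' Hu' v Hv.
  apply NNPP; intros Hn; apply (Hd v); [apply Rabs_le_between, Hv|].
  intros (t & Ht & Htv & Hdt); apply Hn.
  assert (HtM : Rabs t <= M) by (apply Rabs_le, Ht).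
  unfold delta in Htv, Hdt; destruct (constructive_indefinite_description _ (K t)) as [d' Hd']; simpl in *.
  apply (Hd' HtM); [change (Rabs (u' - u) < d) in Hu'; lra|exact Htv].
Qed.

Lemma mvt_interval (h h' : R -> R) (a b : R) : (forall v, is_derive h v (h' v)) -> a < b ->
  exists x, a <= x <= b /\ h b - h a = h' x * (b - a).
Proof.
  intros Hd Hab; destruct (MVT_gen h a b h') as (x & Hx & E).
  - intros x _; apply Hd.
  - intros x _; apply continuity_pt_filterlim.
    apply (ex_derive_continuous h); exists (h' x); apply Hd.
  - exists x; rewrite Rmin_left, Rmax_right in Hx by lra; auto.
Qed.

(* Thom's lemma, in the one case that matters here: a root is determined by the signs of the
   higher derivatives there. *)
Lemma thom (D : nat) (h : nat -> R -> R) (v1 v2 a : R) :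
  (forall k v, is_derive (h k) v (h (S k) v)) -> a <> 0 -> (forall v, h D v = a) -> v1 < v2 ->
  (forall k, (k <= D)%nat -> same_sign (h k v1) (h k v2)) ->
  h 0%nat v1 <> 0 /\ forall v, v1 <= v <= v2 -> same_sign (h 0%nat v) (h 0%nat v1).
Proof.
  revert h; induction D as [|D IH]; intros h Hd Ha Htop Hv Hs.
  { split; [rewrite Htop; exact Ha|]; intros v _; rewrite !Htop; apply same_sign_refl. }
  destruct (IH (fun k => h (S k))) as [Hn Hc]; auto.
  { intros k Hk; apply Hs; lia. }
  (* By induction the first derivative has one strict sign on the interval, so [h 0] is strictly
     monotone there. Equal signs at the ends then exclude a zero at an end and a sign change in
     between. *)
  assert (Hmono : forall x y, v1 <= x -> x < y -> y <= v2 ->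
    (0 < h 1%nat v1 -> h 0%nat x < h 0%nat y) /\ (h 1%nat v1 < 0 -> h 0%nat y < h 0%nat x)).
  { intros x y Hx Hxy Hy.
    destruct (mvt_interval (h 0%nat) (h 1%nat) x y (Hd 0%nat) Hxy) as (z & Hz & E).
    destruct (Hc z) as [H1 H2]; [lra|].
    split; intros H; [apply H1 in H|apply H2 in H]; nra. }
  pose proof (Hs 0%nat ltac:(lia)) as [H01 H02].
  split.
  - intros H0; destruct (Hmono v1 v2); lra.
  - intros v [[Hv1|<-] [Hv2| ->]]; try apply same_sign_refl.
    + destruct (Hmono v1 v) as [M1 M2]; try lra.
      destruct (Hmono v v2) as [M3 M4]; try lra.
      destruct H01 as [A1 A2]; destruct H02 as [A3 A4].
      destruct (Rtotal_order (h 1%nat v1) 0) as [L|[L|L]];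
        [specialize (M2 L); specialize (M4 L)|contradiction|specialize (M1 L); specialize (M3 L)];
        repeat split; intros K;
        first [lra | apply A2; lra | pose proof (A1 K); lra | apply A4; lra | pose proof (A3 K); lra].
    + apply same_sign_sym, Hs; lia.
Qed.

Lemma exists_outside_list (L : list R) (a b : R) : a < b -> exists y, a < y < b /\ ~ In y L.
Proof.
  revert a b; induction L as [|x L IH]; intros a b Hab.
  { exists ((a + b) / 2); split; [lra|intros []]. }
  destruct (Rle_lt_dec x a) as [H|H].
  { destruct (IH a b Hab) as (y & Hy & Hn); exists y; split; [exact Hy|].
    intros [E|E]; [lra|contradiction]. }
  destruct (IH a (Rmin x b)) as (y & Hy & Hn); [apply Rmin_glb_lt; lra|].
  pose proof (Rmin_l x b); pose proof (Rmin_r x b).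
  exists y; split; [lra|]; intros [E|E]; [lra|contradiction].
Qed.

(* Values that are eventually avoided near [l] are dense, so the eventual lower bounds of [h]
   and its eventual upper bounds meet. *)
Lemma right_limit_exists (l r M : R) (h : R -> R) : l < r ->
  (forall u, l < u < r -> continuous h u) -> (forall u, l < u < r -> Rabs (h u) <= M) ->
  (forall a b, a < b -> exists y, a < y < b /\
    exists delta, 0 < delta /\ forall u, l < u < l + delta -> u < r -> h u <> y) ->
  exists w, forall eps, 0 < eps -> exists delta, 0 < delta /\
    forall u, l < u < l + delta -> u < r -> Rabs (h u - w) < eps.
Proof.
  intros Hlr Hc HM Havoid.
  set (E := fun y => exists delta, 0 < delta /\ forall u, l < u < l + delta -> u < r -> y < h u).
  destruct (completeness E) as [w [Hub Hlub]].
  { exists M; intros y (d & Hd & H).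
    set (u := l + Rmin d (r - l) / 2).
    assert (0 < Rmin d (r - l)) by (apply Rmin_pos; lra).
    pose proof (Rmin_l d (r - l)); pose proof (Rmin_r d (r - l)).
    assert (Hu : l < u < r) by (unfold u; lra).
    pose proof (HM u Hu) as HMu; apply Rabs_le_between in HMu.
    assert (y < h u) by (apply H; unfold u in *; lra); lra. }
  { exists (- M - 1); exists 1; split; [lra|]; intros u H1 H2.
    pose proof (HM u ltac:(lra)) as H3; apply Rabs_le_between in H3; lra. }
  exists w; intros eps Heps.
  assert (Hlow : exists y, E y /\ w - eps < y).
  { apply NNPP; intros Hn; assert (w <= w - eps); [|lra].
    apply Hlub; intros y Hy; apply Rnot_lt_le; intros Hlt; apply Hn; exists y; auto. }
  destruct Hlow as (y1 & (d1 & Hd1 & H1) & Hy1).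
  (* An avoided value just above [w]: near [l] the function stays on one side of it, and staying
     above would make [y2 > w] an eventual lower bound. *)
  destruct (Havoid w (w + eps) ltac:(lra)) as (y2 & Hy2 & d2 & Hd2 & H2).
  assert (Hup : exists d3, 0 < d3 /\ forall u, l < u < l + d3 -> u < r -> h u < y2).
  { exists d2; split; [exact Hd2|]; intros u Hu1 Hu2; apply Rnot_le_lt; intros Hle.
    assert (y2 <= w); [|lra]; apply Hub; exists d2; split; [exact Hd2|].
    assert (Hconst : forall x y, l < x -> x <= y -> y < l + d2 -> y < r -> (y2 < h x <-> y2 < h y)).
    { intros x y Hx Hxy Hy1' Hy2'; apply (locally_constant_interval (fun s => y2 < h s)); [exact Hxy|].
      intros s Hs; assert (Hs0 : h s - y2 <> 0) by (pose proof (H2 s ltac:(lra) ltac:(lra)); lra).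
      destruct (same_sign_locally (fun s => h s - y2) s) as [d Hd]; [|exact Hs0|].
      - apply (continuous_minus h (fun _ => y2)); [apply Hc; lra|apply continuous_const].
      - exists d; split; [apply cond_pos|]; intros s' _ Hss.
        destruct (Hd s' Hss) as [K _]; split; intros; [apply (proj1 (Rlt_0_minus _ _)), K; lra|].
        assert (0 < h s' - y2) by (apply K; lra); lra. }
    assert (Hu3 : y2 < h u) by (pose proof (H2 u Hu1 Hu2); lra).
    intros x Hx1 Hx2; destruct (Rle_lt_dec x u) as [Hxu|Hxu].
    - apply (Hconst x u); lra.
    - apply (Hconst u x); lra. }
  destruct Hup as (d3 & Hd3 & H3).
  exists (Rmin d1 d3); split; [apply Rmin_pos; assumption|]; intros u Hu1 Hu2.
  pose proof (Rmin_l d1 d3); pose proof (Rmin_r d1 d3).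
  pose proof (H1 u ltac:(lra) Hu2); pose proof (H3 u ltac:(lra) Hu2).
  apply Rabs_def1; lra.
Qed.

Lemma left_limit_exists (l r M : R) (h : R -> R) : l < r ->
  (forall u, l < u < r -> continuous h u) -> (forall u, l < u < r -> Rabs (h u) <= M) ->
  (forall a b, a < b -> exists y, a < y < b /\
    exists delta, 0 < delta /\ forall u, r - delta < u < r -> l < u -> h u <> y) ->
  exists w, forall eps, 0 < eps -> exists delta, 0 < delta /\
    forall u, r - delta < u < r -> l < u -> Rabs (h u - w) < eps.
Proof.
  intros Hlr Hc HM Havoid.
  destruct (right_limit_exists (- r) (- l) M (fun u => h (- u))) as [w Hw].
  - lra.
  - intros u Hu; apply (continuous_comp Ropp h).
    + apply (continuous_opp (fun x : R => x)), continuous_id.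
    + apply Hc; lra.
  - intros u Hu; apply HM; lra.
  - intros a b Hab; destruct (Havoid a b Hab) as (y & Hy & d & Hd & H).
    exists y; split; [exact Hy|]; exists d; split; [exact Hd|]; intros u Hu1 Hu2; apply H; lra.
  - exists w; intros eps Heps; destruct (Hw eps Heps) as (d & Hd & H).
    exists d; split; [exact Hd|]; intros u Hu1 Hu2.
    rewrite <- (Ropp_involutive u); apply H; lra.
Qed.

(** * Arcs of a sheared curve *)

Lemma locally_between (l u r : R) : l < u < r -> locally u (fun s => l < s < r).
Proof.
  intros Hu; assert (Hd : 0 < Rmin (u - l) (r - u)) by (apply Rmin_pos; lra).
  exists (mkposreal _ Hd); intros s H; change (Rabs (s - u) < Rmin (u - l) (r - u)) in H.
  pose proof (Rmin_l (u - l) (r - u)); pose proof (Rmin_r (u - l) (r - u)).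
  apply Rabs_def2 in H; lra.
Qed.

Section ShearedCurve.
Context (X : pt -> Prop) (c : R) (D : nat) (G : nat -> pt -> R) (B : list R)
  (HC : sheared_curve X c D G B).

Let F : R * R -> R := G 0%nat.

Lemma G_continuous (k : nat) (q : R * R) : continuous (G k : R * R -> R) q.
Proof. apply poly_fun_continuous, (curve_poly _ _ _ _ _ HC). Qed.

Lemma signs_locally (q : R * R) : ~ In (fst q) B -> F q = 0 ->
  locally q (fun q' : R * R => F q' = 0 -> forall k, (k <= D)%nat -> same_sign (G k q') (G k q)).
Proof.
  intros HB HF; generalize D; intros n; induction n as [|n IH].
  - apply (locally_imp _ _ _ (curve_sign _ _ _ _ _ HC 0%nat q HB HF)).
    intros q' H Hq' k Hk; replace k with 0%nat by lia; auto.
  - apply (locally_imp _ _ _ (locally_and _ _ _ IH (curve_sign _ _ _ _ _ HC (S n) q HB HF))).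
    intros q' [H1 H2] Hq' k Hk; destruct (Nat.eq_dec k (S n)) as [->|]; [auto|apply H1; [auto|lia]].
Qed.

(* By Thom's lemma a class of constant derivative signs has at most one point over each [u]. *)
Definition arc (l r : R) (q0 q : pt) : Prop :=
  G 0%nat q = 0 /\ l < fst q < r /\ forall k, (k <= D)%nat -> same_sign (G k q) (G k q0).

(** Local constancy of the signs along [F = 0] makes an arc both open and closed in the part of the
    curve over the gap. Off the curve the claim is vacuous, since [F] stays nonzero nearby. *)
Lemma arc_clopen (l r : R) (q0 : pt) (q : R * R) :
  (forall u, l < u < r -> ~ In u B) -> l < fst q < r ->
  locally q (fun q' : R * R => F q' = 0 -> (arc l r q0 q' <-> arc l r q0 q)).
Proof.
  intros HB Hq; destruct (Req_dec (F q) 0) as [HF|HF].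
  - assert (Hlr : locally q (fun q' : R * R => l < fst q' < r)).
    { destruct (locally_between l (fst q) r Hq) as [d Hd].
      exists d; intros q' [H _]; apply Hd, H. }
    apply (locally_imp _ _ _ (locally_and _ _ _ (signs_locally q (HB _ Hq) HF) Hlr)).
    intros q' [H1 H2] Hq'; specialize (H1 Hq').
    split; intros (_ & _ & H3); (split; [assumption|split; [assumption|]]); intros k Hk.
    + apply (same_sign_trans _ (G k q')); auto using same_sign_sym.
    + apply (same_sign_trans _ (G k q)); auto.
  - apply (locally_imp _ _ _ (same_sign_locally F q (G_continuous 0%nat q) HF)).
    intros q' H Hq'; exfalso; exact (same_sign_neq0 _ _ H HF Hq').
Qed.

Lemma arc_avoid (l r : R) (q0 : pt) (q : R * R) :
  (forall u, l < u < r -> ~ In u B) -> l < fst q < r -> ~ arc l r q0 q ->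
  locally q (fun q' : R * R => ~ arc l r q0 q').
Proof.
  intros HB Hq Hn; apply (locally_imp _ _ _ (arc_clopen l r q0 q HB Hq)).
  intros q' H Ha; apply Hn, (proj1 (H (proj1 Ha))), Ha.
Qed.

Lemma arc_fiber_unique (l r u v1 v2 : R) (q0 : pt) :
  arc l r q0 (u, v1) -> arc l r q0 (u, v2) -> v1 = v2.
Proof.
  assert (K : forall v1 v2, arc l r q0 (u, v1) -> arc l r q0 (u, v2) -> ~ v1 < v2).
  { clear v1 v2; intros v1 v2 (F1 & _ & S1) (F2 & _ & S2) Hlt.
    destruct (curve_top _ _ _ _ _ HC) as (a & Ha & Htop).
    destruct (thom D (fun k v => G k (u, v)) v1 v2 a) as [Hn _]; auto.
    - intros k v; apply (curve_derive _ _ _ _ _ HC).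
    - intros k Hk; apply (same_sign_trans _ (G k q0)); auto using same_sign_sym. }
  intros H1 H2; destruct (Rtotal_order v1 v2) as [L|[E|L]]; [|exact E|].
  - destruct (K v1 v2 H1 H2 L).
  - destruct (K v2 v1 H2 H1 L).
Qed.

Lemma roots_bounded_interval (l r : R) :
  exists M, forall u v, l <= u <= r -> F (u, v) = 0 -> Rabs v <= M.
Proof.
  destruct (curve_bounded _ _ _ _ _ HC (Rabs l + Rabs r)) as [M HM].
  exists M; intros u v Hu; apply HM; apply Rabs_le.
  pose proof (Rle_abs l); pose proof (Rle_abs (- l)); pose proof (Rle_abs r); pose proof (Rle_abs (- r)).
  rewrite Rabs_Ropp in *; pose proof (Rabs_pos l); pose proof (Rabs_pos r); lra.
Qed.

(** The abscissae below the arc form an open and closed subset of the gap. Open, because roots and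
    their signs persist; closed, because the roots are bounded and the tube lemma applies to a fibre
    without arc points. *)
Lemma arc_domain (l r : R) (q0 q : pt) :
  (forall u, l < u < r -> ~ In u B) -> arc l r q0 q ->
  forall u, l < u < r -> exists v, arc l r q0 (u, v).
Proof.
  intros HB Hq u Hu.
  destruct (roots_bounded_interval l r) as [M HM].
  set (P := fun u => exists v, arc l r q0 (u, v)).
  assert (Hloc : forall s, l < s < r -> locally s (fun s' => P s' <-> P s)).
  { intros s Hs.
    assert (Hlr : locally s (fun s' => l < s' < r)) by (apply locally_between; assumption).
    destruct (classic (P s)) as [HP|HP].
    - destruct HP as [v Hv].
      apply (locally_imp s _ _ (curve_open _ _ _ _ _ HC (s, v) (HB s Hs) (proj1 Hv) _ (arc_clopen l r q0 (s, v) HB Hs))).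
      intros s' [v' [H1 H2]]; split; intros _; [exists v; exact Hv|exists v'; apply H1; assumption].
    - assert (Ht := tube M s (fun q' : R * R => ~ arc l r q0 q')).
      apply (locally_imp s _ _ (locally_and s _ _ Hlr (Ht (fun v _ => arc_avoid l r q0 (s, v) HB Hs (fun H => HP (ex_intro _ v H)))))).
      intros s' [H1 H2]; split; [|contradiction]; intros [v Hv]; exfalso; apply (H2 v); [|exact Hv].
      apply (HM s'); [lra|exact (proj1 Hv)]. }
  assert (Hconst : forall a b, l < a -> a <= b -> b < r -> (P a <-> P b)).
  { intros a b Ha Hab Hb; apply locally_constant_interval; [exact Hab|].
    intros s Hs; destruct (Hloc s ltac:(lra)) as [d Hd].
    exists d; split; [apply cond_pos|]; intros s' _ Hss; apply Hd; exact Hss. }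
  assert (HPq : P (fst q)) by (exists (snd q); destruct q; exact Hq).
  destruct Hq as (_ & Hq & _).
  destruct (Rle_lt_dec u (fst q)); [apply (Hconst u (fst q))|apply (Hconst (fst q) u)]; assumption || lra.
Qed.

(** The fibre over [s] is finite even if [s] is a bad abscissa, so almost every [y] is not a root
    there, nor nearby. This supplies the dense avoided values behind the one-sided limits of an
    arc. *)
Lemma near_endpoint_avoids (s a b : R) : a < b ->
  exists y, a < y < b /\ exists delta, 0 < delta /\
    forall u, Rabs (u - s) < delta -> F (u, y) <> 0.
Proof.
  intros Hab; destruct (curve_roots _ _ _ _ _ HC s) as [L HL].
  destruct (exists_outside_list L a b Hab) as (y & Hy & Hn).
  exists y; split; [exact Hy|].
  assert (Hs : F (s, y) <> 0) by (intros E; apply Hn, HL, E).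
  destruct (same_sign_locally F (s, y) (G_continuous 0%nat (s, y)) Hs) as [d Hd].
  exists d; split; [apply cond_pos|]; intros u Hu.
  refine (same_sign_neq0 _ _ (Hd (u, y) _) Hs).
  split; [exact Hu|apply ball_center].
Qed.

Lemma limit_root (s w : R) :
  (forall eps, 0 < eps -> exists u v, Rabs (u - s) < eps /\ Rabs (v - w) < eps /\ F (u, v) = 0) ->
  F (s, w) = 0.
Proof.
  intros H; apply NNPP; intros Hn.
  destruct (same_sign_locally F (s, w) (G_continuous 0%nat (s, w)) Hn) as [d Hd].
  destruct (H d (cond_pos d)) as (u & v & Hu & Hv & HF).
  refine (same_sign_neq0 _ _ (Hd (u, v) _) Hn HF); split; assumption.
Qed.

(** Existence of an ordinate over each [u] is [arc_domain], uniqueness is Thom's lemma. The ends of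
    the graph lie on the curve as limits of roots. *)
Lemma arc_graph (l r : R) (q0 q1 : pt) : l < r ->
  (forall u, l < u < r -> ~ In u B) -> arc l r q0 q1 ->
  exists psi : R -> R, (forall u, continuous psi u) /\
    (forall q, arc l r q0 q <-> l < fst q < r /\ snd q = psi (fst q)) /\
    F (l, psi l) = 0 /\ F (r, psi r) = 0.
Proof.
  intros Hlr HB Hq1.
  pose proof (arc_domain l r q0 q1 HB Hq1) as Hdom.
  destruct (roots_bounded_interval l r) as [M HM].
  set (xi := fun u => epsilon (inhabits 0) (fun v => arc l r q0 (u, v))).
  assert (Hxi : forall u, l < u < r -> arc l r q0 (u, xi u)).
  { intros u Hu; apply (epsilon_spec (inhabits 0) (fun v => arc l r q0 (u, v))), Hdom, Hu. }
  assert (HxiM : forall u, l < u < r -> Rabs (xi u) <= M).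
  { intros u Hu; apply (HM u); [lra|apply (Hxi u Hu)]. }
  assert (Hxic : forall u, l < u < r -> continuous xi u).
  { intros u Hu; apply filterlim_locally; intros eps.
    assert (Hlr' : locally u (fun s' => l < s' < r)) by (apply locally_between; assumption).
    assert (Ht : locally u (fun u' => forall v, Rabs v <= M -> arc l r q0 (u', v) -> ball (xi u) eps v)).
    { apply (tube M u (fun q' : R * R => arc l r q0 q' -> ball (xi u) eps (snd q'))).
      intros v Hv; destruct (classic (arc l r q0 (u, v))) as [Ha|Ha].
      - rewrite (arc_fiber_unique l r u v (xi u) q0 Ha (Hxi u Hu)).
        exists eps; intros q' [_ H] _; exact H.
      - apply (locally_imp (u, v) _ _ (arc_avoid l r q0 (u, v) HB Hu Ha)).
        intros q' H Ha'; contradiction. }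
    apply (locally_imp u _ _ (locally_and u _ _ Hlr' Ht)); intros u' [H1 H2].
    apply H2; auto. }
  destruct (right_limit_exists l r M xi Hlr Hxic HxiM) as [w1 Hw1].
  { intros a b Hab; destruct (near_endpoint_avoids l a b Hab) as (y & Hy & d & Hd & H).
    exists y; split; [exact Hy|]; exists d; split; [exact Hd|]; intros u Hu Hur E.
    apply (H u); [apply Rabs_def1; lra|]; rewrite <- E; apply Hxi; lra. }
  destruct (left_limit_exists l r M xi Hlr Hxic HxiM) as [w2 Hw2].
  { intros a b Hab; destruct (near_endpoint_avoids r a b Hab) as (y & Hy & d & Hd & H).
    exists y; split; [exact Hy|]; exists d; split; [exact Hd|]; intros u Hu Hur E.
    apply (H u); [apply Rabs_def1; lra|]; rewrite <- E; apply Hxi; lra. }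
  (* Constant extension by the limits makes [psi] continuous on the whole line, so that it can
     parametrize the closed arc. *)
  set (psi := fun u => if Rle_dec u l then w1 else if Rle_dec r u then w2 else xi u).
  assert (Pl : forall u, u <= l -> psi u = w1).
  { intros u Hu; unfold psi; destruct (Rle_dec u l); [reflexivity|contradiction]. }
  assert (Pr : forall u, r <= u -> psi u = w2).
  { intros u Hu; unfold psi; destruct (Rle_dec u l); [lra|]; destruct (Rle_dec r u); [reflexivity|contradiction]. }
  assert (Pm : forall u, l < u < r -> psi u = xi u).
  { intros u Hu; unfold psi; destruct (Rle_dec u l); [lra|]; destruct (Rle_dec r u); [lra|reflexivity]. }
  assert (Hnear : forall u d, 0 < d -> locally u (fun s => Rabs (s - u) < d)).
  { intros u d Hd; exists (mkposreal _ Hd); intros s Hs; exact Hs. }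
  exists psi; split; [|split; [|split]].
  - intros u; destruct (Rtotal_order u l) as [Hul|[->|Hul]];
      [| |destruct (Rtotal_order u r) as [Hur|[->|Hur]]].
    + apply (continuous_ext_loc _ (fun _ => w1)); [|apply continuous_const].
      apply (locally_imp u _ _ (Hnear u (l - u) ltac:(lra))); intros s Hs.
      symmetry; apply Pl; apply Rabs_def2 in Hs; lra.
    + apply filterlim_locally; intros eps; destruct (Hw1 eps (cond_pos eps)) as (d & Hd & H).
      apply (locally_imp l _ _ (Hnear l (Rmin d (r - l)) ltac:(apply Rmin_pos; lra))); intros s Hs.
      pose proof (Rmin_l d (r - l)); pose proof (Rmin_r d (r - l)); apply Rabs_def2 in Hs.
      rewrite (Pl l) by lra; destruct (Rle_lt_dec s l) as [Hsl|Hsl].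
      * rewrite Pl by exact Hsl; apply ball_center.
      * rewrite Pm by lra; apply H; lra.
    + apply (continuous_ext_loc _ xi); [|apply Hxic; lra].
      apply (locally_imp u _ _ (Hnear u (Rmin (u - l) (r - u)) ltac:(apply Rmin_pos; lra))); intros s Hs.
      pose proof (Rmin_l (u - l) (r - u)); pose proof (Rmin_r (u - l) (r - u)).
      symmetry; apply Pm; apply Rabs_def2 in Hs; lra.
    + apply filterlim_locally; intros eps; destruct (Hw2 eps (cond_pos eps)) as (d & Hd & H).
      apply (locally_imp r _ _ (Hnear r (Rmin d (r - l)) ltac:(apply Rmin_pos; lra))); intros s Hs.
      pose proof (Rmin_l d (r - l)); pose proof (Rmin_r d (r - l)); apply Rabs_def2 in Hs.
      rewrite (Pr r) by lra; destruct (Rle_lt_dec r s) as [Hsl|Hsl].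
      * rewrite Pr by exact Hsl; apply ball_center.
      * rewrite Pm by lra; apply H; lra.
    + apply (continuous_ext_loc _ (fun _ => w2)); [|apply continuous_const].
      apply (locally_imp u _ _ (Hnear u (u - r) ltac:(lra))); intros s Hs.
      symmetry; apply Pr; apply Rabs_def2 in Hs; lra.
  - intros [u v]; simpl; split.
    + intros Ha; assert (Hu : l < u < r) by apply Ha; split; [exact Hu|].
      rewrite Pm by exact Hu; apply (arc_fiber_unique l r u v (xi u) q0 Ha), Hxi, Hu.
    + intros [Hu ->]; rewrite Pm by exact Hu; apply Hxi, Hu.
  - rewrite Pl by lra; apply limit_root; intros eps Heps.
    destruct (Hw1 eps Heps) as (d & Hd & H).
    assert (Hm : 0 < Rmin (Rmin d eps) (r - l)) by (repeat apply Rmin_pos; lra).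
    pose proof (Rmin_l (Rmin d eps) (r - l)); pose proof (Rmin_r (Rmin d eps) (r - l)).
    pose proof (Rmin_l d eps); pose proof (Rmin_r d eps).
    set (u := l + Rmin (Rmin d eps) (r - l) / 2).
    assert (Hu : l < u < r) by (unfold u; lra).
    exists u, (xi u); split; [apply Rabs_def1; unfold u; lra|split].
    + apply H; unfold u in *; lra.
    + apply (Hxi u Hu).
  - rewrite Pr by lra; apply limit_root; intros eps Heps.
    destruct (Hw2 eps Heps) as (d & Hd & H).
    assert (Hm : 0 < Rmin (Rmin d eps) (r - l)) by (repeat apply Rmin_pos; lra).
    pose proof (Rmin_l (Rmin d eps) (r - l)); pose proof (Rmin_r (Rmin d eps) (r - l)).
    pose proof (Rmin_l d eps); pose proof (Rmin_r d eps).
    set (u := r - Rmin (Rmin d eps) (r - l) / 2).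
    assert (Hu : l < u < r) by (unfold u; lra).
    exists u, (xi u); split; [apply Rabs_def1; unfold u; lra|split].
    + apply H; unfold u in *; lra.
    + apply (Hxi u Hu).
Qed.

End ShearedCurve.

(** * Curves meeting an arc *)

Lemma cont_on_glue {V : Type} (dV : V -> V -> R) (f : R -> V) (a b d : R) :
  a <= b <= d ->
  cont_on dist1 dV (fun s => a <= s <= b) f -> cont_on dist1 dV (fun s => b <= s <= d) f ->
  cont_on dist1 dV (fun s => a <= s <= d) f.
Proof.
  intros Habd H1 H2 s Hs eps Heps; unfold dist1 in *.
  destruct (Rtotal_order s b) as [Hsb|[->|Hsb]].
  - destruct (H1 s ltac:(lra) eps Heps) as (d1 & Hd1 & K).
    exists (Rmin d1 (b - s)); split; [apply Rmin_pos; lra|]; intros s' Hs' Hss.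
    pose proof (Rmin_l d1 (b - s)); pose proof (Rmin_r d1 (b - s)).
    apply K; [|lra]; assert (Hss' : Rabs (s - s') < b - s) by lra; apply Rabs_def2 in Hss'; lra.
  - destruct (H1 b ltac:(lra) eps Heps) as (d1 & Hd1 & K1).
    destruct (H2 b ltac:(lra) eps Heps) as (d2 & Hd2 & K2).
    exists (Rmin d1 d2); split; [apply Rmin_pos; lra|]; intros s' Hs' Hss.
    pose proof (Rmin_l d1 d2); pose proof (Rmin_r d1 d2).
    destruct (Rle_lt_dec s' b); [apply K1|apply K2]; lra.
  - destruct (H2 s ltac:(lra) eps Heps) as (d2 & Hd2 & K).
    exists (Rmin d2 (s - b)); split; [apply Rmin_pos; lra|]; intros s' Hs' Hss.
    pose proof (Rmin_l d2 (s - b)); pose proof (Rmin_r d2 (s - b)).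
    apply K; [|lra]; assert (Hss' : Rabs (s - s') < s - b) by lra; apply Rabs_def2 in Hss'; lra.
Qed.

Lemma cont_on_of_continuous (D : R -> Prop) (f g : R -> R) :
  (forall t, D t -> continuous f t) -> (forall t, D t -> continuous g t) ->
  cont_on dist1 dist2 D (fun t => (f t, g t)).
Proof.
  intros Hf Hg t Ht eps Heps; assert (He : 0 < eps / 2) by lra.
  pose proof (proj1 (filterlim_locally f (f t)) (Hf t Ht) (mkposreal _ He)) as Lf.
  pose proof (proj1 (filterlim_locally g (g t)) (Hg t Ht) (mkposreal _ He)) as Lg.
  destruct (locally_and t _ _ Lf Lg) as [d Hd].
  exists d; split; [apply cond_pos|]; intros s _ Hs; unfold dist1 in Hs.
  destruct (Hd s) as [H1 H2]; [change (Rabs (s - t) < d); rewrite Rabs_minus_sym; exact Hs|].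
  change (Rabs (f s - f t) < eps / 2) in H1; change (Rabs (g s - g t) < eps / 2) in H2.
  apply Rle_lt_trans with (1 := dist2_le _ _); simpl.
  rewrite (Rabs_minus_sym (f t)), (Rabs_minus_sym (g t)); lra.
Qed.

Lemma cont_on_ext {U V : Type} (dU : U -> U -> R) (dV : V -> V -> R) (D : U -> Prop) (f g : U -> V) :
  (forall x, D x -> f x = g x) -> cont_on dU dV D f -> cont_on dU dV D g.
Proof.
  intros E Hf x Hx eps Heps; destruct (Hf x Hx eps Heps) as (d & Hd & H).
  exists d; split; [exact Hd|]; intros y Hy Hxy; rewrite <- (E x Hx), <- (E y Hy); auto.
Qed.

Lemma C2fun_continuous (f : R -> R) (t : R) : C2fun f -> continuous f t.
Proof. intros H; apply (ex_derive_continuous f), H. Qed.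

Lemma pwC2_continuous (gamma : R -> pt) (L : R) : pwC2_curve_length gamma L ->
  cont_on dist1 dist2 (fun s => 0 <= s <= 1) gamma.
Proof.
  intros (n & t & g & Hn & H0 & H1 & Hinc & Hpiece & _).
  assert (K : forall m, (m <= n)%nat -> t 0%nat <= t m /\
    cont_on dist1 dist2 (fun s => t 0%nat <= s <= t m) gamma).
  { induction m as [|m IH]; intros Hm.
    - split; [lra|]; intros s Hs eps Heps; exists 1; split; [lra|]; intros s' Hs' _.
      replace s' with s by lra; rewrite dist2_refl; exact Heps.
    - destruct IH as [IH1 IH2]; [lia|]; pose proof (Hinc m ltac:(lia)) as Hm'.
      split; [lra|]; apply cont_on_glue with (t m); [lra|exact IH2|].
      destruct (Hpiece m ltac:(lia)) as (C1 & C2 & E).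
      apply cont_on_ext with (fun s => (fst (g m s), snd (g m s))).
      + intros s Hs; rewrite (E s Hs); destruct (g m s); reflexivity.
      + apply cont_on_of_continuous; intros s _.
        * exact (C2fun_continuous (fun s => fst (g m s)) s C1).
        * exact (C2fun_continuous (fun s => snd (g m s)) s C2). }
  destruct (K n (Nat.le_refl n)) as [_ H]; rewrite H0, H1 in H; exact H.
Qed.

(** If [U] and [V] had no common point on the path, membership in [U] would be locally constant in
    the parameter, hence constant. *)
Lemma connected2_path_image (I : R -> Prop) (f : R -> pt) :
  (forall a b s, I a -> I b -> a <= s <= b -> I s) ->
  cont_on dist1 dist2 I f -> connected2 (fun p => exists s, I s /\ f s = p).
Proof.
  intros HI Hf U V HU HV Hcov (p & (a & Ha & <-) & Hpa) (q & (b & Hb & <-) & Hqb).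
  apply NNPP; intros Hn.
  assert (Hloc : forall W, open2 W -> forall s, I s -> W (f s) ->
    exists d, 0 < d /\ forall s', I s' -> Rabs (s' - s) < d -> W (f s')).
  { intros W HW s Hs Hfs; destruct (HW _ Hfs) as (r & Hr & H).
    destruct (Hf s Hs r Hr) as (d & Hd & K); exists d; split; [exact Hd|].
    intros s' Hs' Hss; apply H, K; [exact Hs'|unfold dist1; rewrite Rabs_minus_sym; exact Hss]. }
  assert (Hc : forall x y, I x -> I y -> x <= y -> (U (f x) <-> U (f y))).
  { intros x y Hx Hy Hxy; apply (locally_constant_interval (fun s => U (f s))); [exact Hxy|].
    intros s Hs; assert (HIs : I s) by (apply (HI x y); assumption).
    destruct (classic (U (f s))) as [HUs|HUs].
    - destruct (Hloc U HU s HIs HUs) as (d & Hd & H); exists d; split; [exact Hd|].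
      intros s' Hs' Hss; split; [auto|intros _; apply H; [apply (HI x y); assumption|exact Hss]].
    - assert (HVs : V (f s)) by (destruct (Hcov (f s)); [exists s; auto|contradiction|assumption]).
      destruct (Hloc V HV s HIs HVs) as (d & Hd & H); exists d; split; [exact Hd|].
      intros s' Hs' Hss; split; [intros HU'|contradiction].
      assert (HIs' : I s') by (apply (HI x y); assumption).
      exfalso; apply Hn; exists (f s'); split; [exists s'; auto|auto]. }
  apply Hn; exists (f b); split; [exists b; auto|]; split; [|exact Hqb].
  destruct (Rle_lt_dec a b); [apply (Hc a b)|apply (Hc b a)]; auto; lra.
Qed.

(* A connected curve missing two points of the relatively open arc [e] cannot both enter and leave
   the subarc between them, so it meets [e] in at most two subarcs. *)
Lemma curve_meets_arc_finitely (X e : pt -> Prop) (ell : pt -> R) (f : R -> pt) (l r : R)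
  (gamma : R -> pt) :
  (forall p, e p <-> exists u, l < u < r /\ f u = p) -> (forall u, ell (f u) = u) ->
  cont_on dist1 dist2 (fun u => l < u < r) f -> poly_fun ell ->
  (forall p, X p -> l < ell p < r ->
    exists d, 0 < d /\ forall q, X q -> dist2 p q < d -> (e q <-> e p)) ->
  cont_on dist1 dist2 (fun s => 0 <= s <= 1) gamma -> (forall s, 0 <= s <= 1 -> X (gamma s)) ->
  let S := fun p => image01 gamma p /\ e p in
  (exists Ks : list (pt -> Prop), forall K, conn_component S K ->
         exists K', In K' Ks /\ same_set K K').
Proof.
  intros He Hell Hf Hpoly Hopen Hg HgX S.
  assert (Hfe : forall p, e p -> l < ell p < r /\ f (ell p) = p).
  { intros p Hp; apply He in Hp; destruct Hp as (u & Hu & <-); rewrite Hell; auto. }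
  assert (Hef : forall u, l < u < r -> e (f u)) by (intros u Hu; apply He; exists u; auto).
  set (T := fun u => l < u < r /\ image01 gamma (f u)).
  assert (HST : forall p, S p -> T (ell p)).
  { intros p [Hp1 Hp2]; destruct (Hfe p Hp2) as [H1 H2]; split; [exact H1|rewrite H2; exact Hp1]. }
  assert (HTS : forall u, T u -> S (f u)) by (intros u [H1 H2]; split; auto).
  (* [T] holds the parameters of the arc that the curve visits. The pattern visited, missed,
     visited, missed, visited is impossible, and this bounds the number of pieces by two. *)
  assert (Hgap : forall x a y b z, T x -> x < a -> ~ T a -> a < y -> T y -> y < b -> ~ T b -> b < z -> T z -> False).
  { intros x a y b z Hx Hxa Ha Hay Hy Hyb Hb Hbz Hz.
    assert (Hlr : l < x /\ z < r) by (destruct Hx, Hz; lra).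
    (* The curve misses the arc points at [a] and [b], and over the gap it cannot pass continuously
       between the arc and the rest of [X]. So [P] is constant in time, but it holds at the visit of
       [y] and fails at that of [x]. *)
    set (P := fun s => e (gamma s) /\ a < ell (gamma s) < b).
    assert (Hc : forall s s', 0 <= s <= 1 -> 0 <= s' <= 1 -> s <= s' -> (P s <-> P s')).
    { intros s1 s2 H1 H2 H12; apply locally_constant_interval; [exact H12|].
      intros s Hs; assert (Hs01 : 0 <= s <= 1) by lra.
      assert (Hnear : exists d, 0 < d /\ forall q, X q -> dist2 (gamma s) q < d ->
        (e q /\ a < ell q < b <-> P s)).
      { assert (Hlt : forall w, ell (gamma s) <> w -> exists d, 0 < d /\ forall q, dist2 (gamma s) q < d ->
            same_sign (ell q - w) (ell (gamma s) - w)).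
        { intros w Hw; apply (poly_fun_same_sign (fun p => ell p - w)); [|lra].
          apply (poly_fun_plus ell (fun _ => - w)); [exact Hpoly|apply poly_fun_const]. }
        assert (Hfar : forall w, ell (gamma s) <> w -> exists d, 0 < d /\ forall q, dist2 (gamma s) q < d ->
            (ell q < w <-> ell (gamma s) < w) /\ (w < ell q <-> w < ell (gamma s))).
        { intros w Hw; destruct (Hlt w Hw) as (d & Hd & H); exists d; split; [exact Hd|].
          intros q Hq; destruct (H q Hq) as [[A1 A2] [A3 A4]]; repeat split; intros.
          - enough (ell (gamma s) - w < 0) by lra; apply A3; lra.
          - enough (ell q - w < 0) by lra; apply A4; lra.
          - enough (0 < ell (gamma s) - w) by lra; apply A1; lra.
          - enough (0 < ell q - w) by lra; apply A2; lra. }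
        (* Over [[a, b]] the arc is relatively open and closed; elsewhere the value of [ell] alone
           refutes [P] nearby. *)
        destruct (classic (a <= ell (gamma s) <= b)) as [Hin|Hout].
        - destruct (Hopen (gamma s) (HgX s Hs01) ltac:(lra)) as (d1 & Hd1 & K1).
          destruct (classic (e (gamma s))) as [Hes|Hes].
          + assert (HTs : T (ell (gamma s))) by (apply HST; split; [exists s; auto|exact Hes]).
            assert (Hna : ell (gamma s) <> a) by (intros E; rewrite E in HTs; contradiction).
            assert (Hnb : ell (gamma s) <> b) by (intros E; rewrite E in HTs; contradiction).
            destruct (Hfar a Hna) as (d2 & Hd2 & K2); destruct (Hfar b Hnb) as (d3 & Hd3 & K3).
            exists (Rmin d1 (Rmin d2 d3)); split; [repeat apply Rmin_pos; assumption|].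
            intros q HXq Hq; pose proof (Rmin_l d1 (Rmin d2 d3)); pose proof (Rmin_r d1 (Rmin d2 d3)).
            pose proof (Rmin_l d2 d3); pose proof (Rmin_r d2 d3).
            specialize (K1 q HXq ltac:(lra)); specialize (K2 q ltac:(lra)); specialize (K3 q ltac:(lra)).
            unfold P; tauto.
          + exists d1; split; [exact Hd1|]; intros q HXq Hq; specialize (K1 q HXq Hq).
            unfold P; tauto.
        - destruct (Rlt_le_dec (ell (gamma s)) a) as [Hsa|Hsa].
          + destruct (Hfar a ltac:(lra)) as (d & Hd & K); exists d; split; [exact Hd|].
            intros q _ Hq; specialize (K q Hq); unfold P; split; intros [_ [H _]]; exfalso; [|lra].
            apply K in H; lra.
          + assert (Hsb : b < ell (gamma s)) by lra.
            destruct (Hfar b ltac:(lra)) as (d & Hd & K); exists d; split; [exact Hd|].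
            intros q _ Hq; specialize (K q Hq); unfold P; split; intros [_ [_ H]]; exfalso; [|lra].
            apply K in H; lra. }
      destruct Hnear as (d & Hd & Hnear); destruct (Hg s Hs01 d Hd) as (d' & Hd' & Hgd).
      exists d'; split; [exact Hd'|]; intros s' Hs' Hss.
      apply Hnear; [apply HgX; lra|].
      apply Hgd; [lra|unfold dist1; rewrite Rabs_minus_sym; exact Hss]. }
    destruct Hx as [Hx (sx & Hsx & Ex)]; destruct Hy as [Hy (sy & Hsy & Ey)].
    assert (HPy : P sy) by (split; rewrite Ey; [apply Hef; exact Hy|rewrite Hell; lra]).
    assert (HPx : P sx).
    { destruct (Rle_lt_dec sx sy); [apply (Hc sx sy)|apply (Hc sy sx)]; auto; lra. }
    destruct HPx as [_ HPx]; rewrite Ex, Hell in HPx; lra. }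
  set (linked := fun x y => forall u, x <= u <= y \/ y <= u <= x -> T u).
  (* The candidate for the component of [p]. A connected subset of [S] cannot jump over a missed
     parameter [u], being split by the open sets [ell < u] and [u < ell]; conversely a linked set is
     the image of an interval. *)
  set (Kof := fun p q => S q /\ linked (ell p) (ell q)).
  assert (Hcomp : forall K, conn_component S K -> forall p, K p -> same_set K (Kof p)).
  { intros K (_ & HKS & HKc & HKmax) p Hp.
    assert (H1 : subset K (Kof p)).
    { intros q Hq; split; [apply HKS, Hq|]; intros u Hu; apply NNPP; intros Hn.
      assert (Hhalf : forall w, open2 (fun p => ell p < w) /\ open2 (fun p => w < ell p)).
      { intros w; assert (Hpw : poly_fun (fun p => ell p - w)).
        { apply (poly_fun_plus ell (fun _ => - w)); [exact Hpoly|apply poly_fun_const]. }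
        split; intros x Hx.
        - destruct (poly_fun_same_sign (fun p => ell p - w) x Hpw ltac:(lra)) as (d & Hd & H).
          exists d; split; [exact Hd|]; intros y Hy; destruct (H y Hy) as [_ [_ A]].
          enough (ell y - w < 0) by lra; apply A; lra.
        - destruct (poly_fun_same_sign (fun p => ell p - w) x Hpw ltac:(lra)) as (d & Hd & H).
          exists d; split; [exact Hd|]; intros y Hy; destruct (H y Hy) as [[_ A] _].
          enough (0 < ell y - w) by lra; apply A; lra. }
      assert (Hne : forall x, K x -> ell x <> u).
      { intros x Hx E; apply Hn; rewrite <- E; apply HST, HKS, Hx. }
      pose proof (Hne p Hp); pose proof (Hne q Hq).
      destruct (HKc (fun p => ell p < u) (fun p => u < ell p)) as (x & Hx & Hx1 & Hx2);
        [apply Hhalf|apply Hhalf| | | |lra].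
      - intros x Hx; pose proof (Hne x Hx); lra.
      - destruct Hu; [exists p|exists q]; split; try assumption; lra.
      - destruct Hu; [exists q|exists p]; split; try assumption; lra. }
    intros q; split; [apply H1|]; intros Hq.
    apply (HKmax (Kof p)); [|exact H1|intros x [Hx _]; exact Hx|exact Hq].
    assert (Hconn : connected2 (fun q => exists s, linked (ell p) s /\ f s = q)).
    { apply connected2_path_image.
      - intros x y s Hx Hy Hs u Hu.
        destruct (Rle_lt_dec (ell p) s); [apply Hy|apply Hx]; lra.
      - intros s Hs eps Heps; destruct (Hf s) with (eps := eps) as (d & Hd & H); [|exact Heps|].
        + apply (Hs s); lra.
        + exists d; split; [exact Hd|]; intros s' Hs' Hss; apply H; [apply (Hs' s'); lra|exact Hss]. }
    replace (Kof p) with (fun q => exists s, linked (ell p) s /\ f s = q); [exact Hconn|].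
    apply functional_extensionality; intros x; apply propositional_extensionality; split.
    - intros (s & Hs & <-); split; [apply HTS, Hs; lra|rewrite Hell; exact Hs].
    - intros [Hx1 Hx2]; exists (ell x); split; [exact Hx2|apply Hfe, Hx1]. }
  assert (Hlink_sym : forall x y, linked x y -> linked y x).
  { intros x y H u Hu; apply H; tauto. }
  assert (Hlink_trans : forall x y z, linked x y -> linked y z -> linked x z).
  { intros x y z H1 H2 u Hu.
    destruct Hu, (Rle_lt_dec u y), (Rle_lt_dec x y), (Rle_lt_dec y z);
      first [apply H1; lra | apply H2; lra]. }
  assert (Hnolink : forall x y, x < y -> T x -> T y -> ~ linked x y -> exists a, x < a < y /\ ~ T a).
  { intros x y Hxy Hx Hy H; apply not_all_ex_not in H; destruct H as [a Ha].
    apply imply_to_and in Ha; destruct Ha as [Ha1 Ha2]; exists a; split; [|exact Ha2].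
    assert (a <> x) by (intros ->; contradiction).
    assert (a <> y) by (intros ->; contradiction); lra. }
  assert (Hsorted : forall x y z, x <= y <= z -> T x -> T y -> T z -> linked x y \/ linked y z).
  { intros x y z Hxyz Hx Hy Hz; apply NNPP; intros Hn; apply not_or_and in Hn; destruct Hn as [N1 N2].
    assert (Hself : forall w, T w -> linked w w) by (intros w Hw u Hu; replace u with w by lra; exact Hw).
    assert (x <> y) by (intros ->; apply N1, Hself, Hy).
    assert (y <> z) by (intros ->; apply N2, Hself, Hz).
    destruct (Hnolink x y ltac:(lra) Hx Hy N1) as (a & Ha & Ta).
    destruct (Hnolink y z ltac:(lra) Hy Hz N2) as (b & Hb & Tb).
    apply (Hgap x a y b z); try assumption; lra. }
  (* Two of any three visited parameters are linked, so one or two classes [Kof] exhaust a nonempty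
     [S]. *)
  assert (Hthree : forall x y z, T x -> T y -> T z -> linked x y \/ linked y z \/ linked x z).
  { intros x y z Hx Hy Hz.
    assert (Hs : linked x y \/ linked y z \/ linked x z \/ linked y x \/ linked z y \/ linked z x).
    { destruct (Rle_lt_dec x y), (Rle_lt_dec y z), (Rle_lt_dec x z);
        first [ destruct (Hsorted x y z ltac:(lra) Hx Hy Hz); tauto
              | destruct (Hsorted x z y ltac:(lra) Hx Hz Hy); tauto
              | destruct (Hsorted y x z ltac:(lra) Hy Hx Hz); tauto
              | destruct (Hsorted y z x ltac:(lra) Hy Hz Hx); tauto
              | destruct (Hsorted z x y ltac:(lra) Hz Hx Hy); tauto
              | destruct (Hsorted z y x ltac:(lra) Hz Hy Hx); tauto ]. }
    pose proof (Hlink_sym y x); pose proof (Hlink_sym z y); pose proof (Hlink_sym z x); tauto. }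
  assert (HKof : forall p q, S p -> S q -> linked (ell p) (ell q) -> same_set (Kof q) (Kof p)).
  { intros p q Hp Hq Hpq x; split; intros [H1 H2]; (split; [exact H1|]).
    - apply (Hlink_trans _ (ell q)); assumption.
    - apply (Hlink_trans _ (ell p)); [apply Hlink_sym|]; assumption. }
  assert (Hfinal : forall Ks : list (pt -> Prop), (forall p, S p -> exists K', In K' Ks /\ same_set (Kof p) K') ->
    exists Ks : list (pt -> Prop), forall K, conn_component S K -> exists K', In K' Ks /\ same_set K K').
  { intros Ks H; exists Ks; intros K HK; assert (HK' := HK); destruct HK' as ((p & Hp) & HKS & _).
    destruct (H p (HKS p Hp)) as (K' & Hin & E); exists K'; split; [exact Hin|].
    intros x; rewrite <- (E x); apply (Hcomp K HK p Hp). }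
  destruct (classic (exists p, S p)) as [[p1 Hp1]|Hempty].
  - destruct (classic (exists p2, S p2 /\ ~ linked (ell p1) (ell p2))) as [(p2 & Hp2 & Hn)|Hall].
    + apply (Hfinal (Kof p1 :: Kof p2 :: nil)); intros p Hp.
      destruct (Hthree (ell p1) (ell p2) (ell p)) as [H|[H|H]]; auto; [contradiction| |].
      * exists (Kof p2); split; [right; left; reflexivity|apply HKof; assumption].
      * exists (Kof p1); split; [left; reflexivity|apply HKof; assumption].
    + apply (Hfinal (Kof p1 :: nil)); intros p Hp; exists (Kof p1); split; [left; reflexivity|].
      apply HKof; try assumption; apply NNPP; intros Hn; apply Hall; exists p; auto.
  - apply (Hfinal nil); intros p Hp; exfalso; apply Hempty; exists p; exact Hp.
Qed.

(** * The cells of a plane curve *)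

(* Cutting at the integers too makes all cells bounded and the family locally finite. *)
Definition cut (B : list R) (u : R) : Prop := In u B \/ exists z : Z, u = IZR z.
Definition gap (B : list R) (l r : R) : Prop :=
  l < r /\ cut B l /\ cut B r /\ forall u, l < u < r -> ~ cut B u.

Lemma finite_integers (N : R) : exists L : list Z, forall z, Rabs (IZR z) <= N -> In z L.
Proof.
  destruct (INR_unbounded N) as [n Hn].
  exists (map (fun k => (Z.of_nat k - Z.of_nat n)%Z) (seq 0 (S (2 * n)))); intros z Hz.
  apply Rabs_le_between in Hz; rewrite INR_IZR_INZ in Hn.
  assert (H1 : IZR z < IZR (Z.of_nat n)) by lra.
  assert (H2 : IZR (- Z.of_nat n) < IZR z) by (rewrite opp_IZR; lra).
  apply lt_IZR in H1; apply lt_IZR in H2.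
  apply in_map_iff; exists (Z.to_nat (z + Z.of_nat n)); split; [lia|apply in_seq; lia].
Qed.

Lemma finite_cuts (B : list R) (N : R) : exists L, forall u, cut B u -> Rabs u <= N -> In u L.
Proof.
  destruct (finite_integers N) as [L HL]; exists (B ++ map IZR L); intros u [H|[z ->]] Hu.
  - apply in_or_app; left; exact H.
  - apply in_or_app; right; apply in_map, HL, Hu.
Qed.

Lemma finite_max (L : list R) (P : R -> Prop) : (exists x, In x L /\ P x) ->
  exists x, P x /\ forall y, In y L -> P y -> y <= x.
Proof.
  induction L as [|a L IH]; intros (x & Hin & Hx); [destruct Hin|].
  destruct (classic (exists x, In x L /\ P x)) as [Hex|Hno].
  - destruct (IH Hex) as (m & Hm & Hmax).
    destruct (classic (P a)) as [Ha|Ha]; [destruct (Rle_lt_dec a m)|].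
    + exists m; split; [exact Hm|]; intros y [<-|Hy]; auto.
    + exists a; split; [exact Ha|]; intros y [<-|Hy] HPy; [lra|]; specialize (Hmax y Hy HPy); lra.
    + exists m; split; [exact Hm|]; intros y [<-|Hy]; [contradiction|auto].
  - destruct Hin as [<-|Hin]; [|destruct Hno; eauto].
    exists a; split; [exact Hx|]; intros y [<-|Hy] HPy; [lra|destruct Hno; eauto].
Qed.

Lemma cut_opp (B : list R) (u : R) : cut (map Ropp B) u <-> cut B (- u).
Proof.
  split; (intros [H|[z Hz]]; [left|right]).
  - apply in_map_iff in H; destruct H as (x & <- & Hx); rewrite Ropp_involutive; exact Hx.
  - exists (- z)%Z; rewrite opp_IZR; lra.
  - apply in_map_iff; exists (- u); split; [ring|exact H].
  - exists (- z)%Z; rewrite opp_IZR; lra.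
Qed.

(** Only finitely many cuts lie in [[u - 1, u)], and the integer [up u - 1] is one of them, so there
    is a greatest. *)
Lemma previous_cut (B : list R) (u : R) : ~ cut B u ->
  exists l, cut B l /\ l < u /\ forall x, l < x < u -> ~ cut B x.
Proof.
  intros Hu; destruct (finite_cuts B (Rabs u + 1)) as [L HL].
  assert (Hin : forall x, cut B x -> u - 1 <= x -> x < u -> In x L).
  { intros x Hx H1 H2; apply HL; [exact Hx|]; apply Rabs_le.
    pose proof (Rle_abs u); pose proof (Rle_abs (- u)); rewrite Rabs_Ropp in *; lra. }
  destruct (finite_max L (fun x => cut B x /\ x < u)) as (l & [Hl1 Hl2] & Hmax).
  - destruct (archimed u) as [H1 H2].
    assert (Hc : cut B (IZR (up u) - 1)) by (right; exists (up u - 1)%Z; rewrite minus_IZR; reflexivity).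
    assert (Hne : IZR (up u) - 1 <> u) by (intros E; rewrite E in Hc; contradiction).
    exists (IZR (up u) - 1); split; [apply Hin; [exact Hc|lra|lra]|split; [exact Hc|lra]].
  - exists l; split; [exact Hl1|split; [exact Hl2|]]; intros x Hx Hcx.
    destruct (Rle_lt_dec (u - 1) x) as [H1|H1].
    + specialize (Hmax x (Hin x Hcx H1 ltac:(lra)) ltac:(split; [exact Hcx|lra])); lra.
    + destruct (archimed u) as [H2 H3].
      assert (Hc : cut B (IZR (up u) - 1)) by (right; exists (up u - 1)%Z; rewrite minus_IZR; reflexivity).
      assert (Hne : IZR (up u) - 1 <> u) by (intros E; rewrite E in Hc; contradiction).
      specialize (Hmax (IZR (up u) - 1) (Hin _ Hc ltac:(lra) ltac:(lra)) ltac:(split; [exact Hc|lra])); lra.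
Qed.

Lemma gap_exists (B : list R) (u : R) : ~ cut B u -> exists l r, gap B l r /\ l < u < r.
Proof.
  intros Hu; destruct (previous_cut B u Hu) as (l & Hl1 & Hl2 & Hl3).
  (* The next cut above [u] is found as the previous one below [- u] after reflection, under which
     the integers are symmetric. *)
  destruct (previous_cut (map Ropp B) (- u)) as (r & Hr1 & Hr2 & Hr3).
  { rewrite cut_opp, Ropp_involutive; exact Hu. }
  exists l, (- r); split; [split; [lra|split; [exact Hl1|split; [apply cut_opp, Hr1|]]]|lra].
  intros x Hx Hcx; destruct (Rtotal_order x u) as [H|[->|H]]; [|contradiction|].
  - apply (Hl3 x); [lra|exact Hcx].
  - apply (Hr3 (- x)); [lra|]; rewrite cut_opp, Ropp_involutive; exact Hcx.
Qed.

Lemma gap_unique (B : list R) (l r l' r' u : R) :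
  gap B l r -> gap B l' r' -> l < u < r -> l' < u < r' -> l = l' /\ r = r'.
Proof.
  intros (_ & Hl & Hr & H) (_ & Hl' & Hr' & H') Hu Hu'; split.
  - destruct (Rtotal_order l l') as [K|[K|K]]; [|exact K|]; exfalso.
    + apply (H l'); [lra|exact Hl'].
    + apply (H' l); [lra|exact Hl].
  - destruct (Rtotal_order r r') as [K|[K|K]]; [|exact K|]; exfalso.
    + apply (H' r); [lra|exact Hr].
    + apply (H r'); [lra|exact Hr'].
Qed.

Lemma gap_length (B : list R) (l r : R) : gap B l r -> r <= l + 1.
Proof.
  intros (Hlr & _ & _ & H); apply Rnot_lt_le; intros Hlt; destruct (archimed l) as [H1 H2].
  apply (H (IZR (up l))); [lra|right; eauto].
Qed.

Lemma finite_bind {S T : Type} (L : list S) (Q : S -> T -> Prop) :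
  (forall s, exists Ls : list T, forall t, Q s t -> In t Ls) ->
  exists L', forall s t, In s L -> Q s t -> In t L'.
Proof.
  intros H; induction L as [|s L [L' IH]]; [exists nil; intros s t []|].
  destruct (H s) as [Ls HLs]; exists (Ls ++ L'); intros s' t [<-|Hs] Ht; apply in_or_app; eauto.
Qed.

Lemma conn_component_singleton (S K : pt -> Prop) (P : pt) :
  (forall p, S p -> p = P) -> conn_component S K -> same_set K (fun q => q = P).
Proof.
  intros HS ((p & Hp) & HKS & _) q; split.
  - intros Hq; apply HS, HKS, Hq.
  - intros ->; rewrite <- (HS p (HKS p Hp)); exact Hp.
Qed.

Section CurveCells.
Context (X : pt -> Prop) (c : R) (D : nat) (G : nat -> pt -> R) (B : list R)
  (HC : sheared_curve X c D G B).

Definition shear (p : pt) : pt := (fst p - c * snd p, snd p).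
Definition unshear (q : pt) : pt := (fst q + c * snd q, snd q).
Definition ucoord (p : pt) : R := fst p - c * snd p.

Lemma shear_unshear (q : pt) : shear (unshear q) = q.
Proof. destruct q as [u v]; unfold shear, unshear; simpl; f_equal; ring. Qed.

Lemma unshear_shear (p : pt) : unshear (shear p) = p.
Proof. destruct p as [x y]; unfold shear, unshear; simpl; f_equal; ring. Qed.

Lemma poly_fun_ucoord : poly_fun ucoord.
Proof.
  apply (poly_fun_ext (fun p => fst p + - c * snd p)); [intros p; unfold ucoord; ring|].
  apply poly_fun_plus; [apply poly_fun_fst|apply poly_fun_mult; [apply poly_fun_const|apply poly_fun_snd]].
Qed.

Lemma poly_fun_shear (g : pt -> R) : poly_fun g -> poly_fun (fun p => g (shear p)).
Proof. intros H; apply (poly_fun_comp g ucoord snd H poly_fun_ucoord poly_fun_snd). Qed.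

Lemma curve_iff (p : pt) : X p <-> G 0%nat (shear p) = 0.
Proof. destruct p as [x y]; apply (curve_zero _ _ _ _ _ HC). Qed.

Lemma curve_unshear (q : pt) : X (unshear q) <-> G 0%nat q = 0.
Proof. rewrite curve_iff, shear_unshear; tauto. Qed.

Lemma locally_shear (p : pt) (W : R * R -> Prop) : locally (shear p : R * R) W ->
  exists d, 0 < d /\ forall q, dist2 p q < d -> W (shear q).
Proof.
  intros [eps HW].
  destruct (poly_fun_dist2 ucoord p eps poly_fun_ucoord (cond_pos eps)) as (d1 & Hd1 & H1).
  destruct (poly_fun_dist2 snd p eps poly_fun_snd (cond_pos eps)) as (d2 & Hd2 & H2).
  exists (Rmin d1 d2); split; [apply Rmin_pos; assumption|]; intros q Hq.
  pose proof (Rmin_l d1 d2); pose proof (Rmin_r d1 d2).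
  apply HW; split; [apply (H1 q); lra|apply (H2 q); lra].
Qed.

Definition arc_cell (l r : R) (q0 : pt) (p : pt) : Prop := arc D G l r q0 (shear p).

(** An arc is named by any of its points: [arc D G l r q0 q0] says that [q0] lies on the curve over
    the gap. Different names of one arc give equal predicates by [arc_cell_eq], as the disjointness
    clause requires. *)
Definition curve_cells (e : pt -> Prop) : Prop :=
  (exists p, X p /\ cut B (ucoord p) /\ e = (fun q => q = p)) \/
  (exists l r q0, gap B l r /\ arc D G l r q0 q0 /\ e = arc_cell l r q0).

Lemma gap_not_bad (l r : R) : gap B l r -> forall u, l < u < r -> ~ In u B.
Proof. intros (_ & _ & _ & H) u Hu Hin; apply (H u Hu); left; exact Hin. Qed.

Lemma arc_cell_graph (l r : R) (q0 : pt) : gap B l r -> arc D G l r q0 q0 ->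
  exists psi : R -> R, (forall u, continuous psi u) /\
    (forall p, arc_cell l r q0 p <-> l < ucoord p < r /\ snd p = psi (ucoord p)) /\
    G 0%nat (l, psi l) = 0 /\ G 0%nat (r, psi r) = 0.
Proof.
  intros Hg Ha; destruct (arc_graph X c D G B HC l r q0 q0 (proj1 Hg) (gap_not_bad l r Hg) Ha)
    as (psi & H1 & H2 & H3 & H4).
  exists psi; split; [exact H1|split; [|auto]]; intros p; apply (H2 (shear p)).
Qed.

Lemma arc_cell_eq (l r : R) (q0 q1 : pt) : arc D G l r q0 q1 -> arc_cell l r q1 = arc_cell l r q0.
Proof.
  intros (_ & _ & H); apply functional_extensionality; intros p; apply propositional_extensionality.
  split; intros (H1 & H2 & H3); (split; [exact H1|split; [exact H2|]]); intros k Hk.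
  - apply (same_sign_trans _ (G k q1)); auto.
  - apply (same_sign_trans _ (G k q0)); auto using same_sign_sym.
Qed.

Lemma continuous_unshear_graph (psi : R -> R) (u : R) : continuous psi u ->
  continuous (fun t => t + c * psi t) u.
Proof.
  intros H; apply (continuous_plus (fun t : R => t) (fun t => c * psi t)); [apply continuous_id|].
  apply (continuous_mult (fun _ => c) psi); [apply continuous_const|exact H].
Qed.

(** The map follows the graph of [psi] over an affine copy of [[-1, 1]]. Its inverse reads off
    [ucoord] and is therefore polynomial. The ends lie on [X] above cuts, hence are 0-cells. *)
Lemma arc_cell_char_map (l r : R) (q0 : pt) : gap B l r -> arc D G l r q0 q0 ->
  char_map1 curve_cells (arc_cell l r q0).
Proof.
  intros Hg Ha; destruct (arc_cell_graph l r q0 Hg Ha) as (psi & Hc & Hiff & Hl & Hr).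
  assert (Hlr : l < r) by apply Hg.
  set (m := fun t => (l + r) / 2 + t * ((r - l) / 2)).
  assert (Hm : forall t, continuous m t).
  { intros t; apply (ex_derive_continuous m); unfold m; auto_derive; auto. }
  set (Phi := fun t => (m t + c * psi (m t), psi (m t))).
  assert (HPhi : forall D, cont_on dist1 dist2 D Phi).
  { intros D'; apply cont_on_of_continuous; intros t _.
    - apply (continuous_comp m (fun u => u + c * psi u)); [apply Hm|].
      apply continuous_unshear_graph, Hc.
    - apply (continuous_comp m psi); [apply Hm|apply Hc]. }
  assert (HU : forall t, ucoord (Phi t) = m t) by (intros t; unfold ucoord, Phi; simpl; ring).
  exists Phi; split; [apply HPhi|split].
  - split; [|split; [apply HPhi|]].
    + intros t Ht; apply Hiff; rewrite HU; split; [|reflexivity].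
      unfold Defs.open_interval in Ht; unfold m; nra.
    + exists (fun p => (ucoord p - (l + r) / 2) / ((r - l) / 2)); split; [|split; [|split]].
      * intros p Hp; apply Hiff in Hp; destruct Hp as [Hp _].
        unfold Defs.open_interval; split.
        -- apply Rlt_div_r; lra.
        -- apply Rlt_div_l; lra.
      * intros p _ eps Heps.
        destruct (poly_fun_dist2 (fun p => (ucoord p - (l + r) / 2) / ((r - l) / 2)) p eps) as (d & Hd & H); [|exact Heps|].
        -- apply poly_fun_mult; [|apply poly_fun_const].
           apply poly_fun_plus; [apply poly_fun_ucoord|apply poly_fun_const].
        -- exists d; split; [exact Hd|]; intros q _ Hq; unfold dist1; rewrite Rabs_minus_sym; auto.
      * intros t _; rewrite HU; unfold m; field; lra.
      * intros p Hp; apply Hiff in Hp; destruct Hp as [_ Hp]; unfold Phi.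
        replace (m ((ucoord p - (l + r) / 2) / ((r - l) / 2))) with (ucoord p) by (unfold m; field; lra).
        rewrite <- Hp; unfold ucoord; destruct p as [x y]; simpl; f_equal; ring.
  - assert (Hend : forall t, cut B (m t) -> G 0%nat (m t, psi (m t)) = 0 ->
      exists c, curve_cells c /\ cell0 c /\ c (Phi t)).
    { intros t Hct Ht; exists (fun q => q = Phi t); split; [left|split; [|reflexivity]].
      - exists (Phi t); split; [|split; [rewrite HU; exact Hct|reflexivity]].
        apply (curve_unshear (m t, psi (m t))), Ht.
      - exists (Phi t); tauto. }
    intros t [-> | ->]; apply Hend.
    + replace (m (-1)) with l by (unfold m; field); apply Hg.
    + replace (m (-1)) with l by (unfold m; field); exact Hl.
    + replace (m 1) with r by (unfold m; field); apply Hg.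
    + replace (m 1) with r by (unfold m; field); exact Hr.
Qed.

Lemma ucoord_bound (N : R) (p : pt) : in_box N p -> Rabs (ucoord p) <= N * (1 + Rabs c).
Proof.
  intros [H1 H2]; unfold ucoord, Rminus.
  apply Rle_trans with (1 := Rabs_triang _ _); rewrite Rabs_Ropp, Rabs_mult.
  pose proof (Rabs_pos c); nra.
Qed.

(** Finitely many cuts are within reach, each with finitely many points above it. A gap is
    determined by its left end, and each of its arcs crosses the vertical line through the midpoint,
    at one of finitely many roots. *)
Lemma curve_cells_locally_finite (N : R) :
  exists L, forall e, curve_cells e -> (exists p, e p /\ in_box N p) -> In e L.
Proof.
  (* The first summand bounds [ucoord] on the box; the [1] reaches the left end of the gap, which
     has length at most one. *)
  set (N' := N * (1 + Rabs c) + 1).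
  destruct (finite_cuts B N') as [L HL].
  destruct (finite_bind L (fun u e => exists p, X p /\ ucoord p = u /\ e = (fun q : pt => q = p))) as [L1 HL1].
  { intros u; destruct (curve_roots _ _ _ _ _ HC u) as [Lu HLu].
    exists (map (fun v q => q = unshear (u, v)) Lu); intros e (p & Hp & Hpu & ->).
    apply in_map_iff; exists (snd p); split.
    - rewrite <- Hpu; change (ucoord p, snd p) with (shear p); rewrite unshear_shear; reflexivity.
    - apply HLu; rewrite <- Hpu; apply curve_iff, Hp. }
  destruct (finite_bind L (fun l e => exists r q0, gap B l r /\ arc D G l r q0 q0 /\ e = arc_cell l r q0)) as [L2 HL2].
  { intros l; destruct (classic (exists r, gap B l r)) as [[r Hg]|Hno].
    - set (m := (l + r) / 2); assert (Hlr := proj1 Hg); assert (Hm : l < m < r) by (unfold m; lra).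
      destruct (curve_roots _ _ _ _ _ HC m) as [Lm HLm].
      exists (map (fun v => arc_cell l r (m, v)) Lm); intros e (r' & q0 & Hg' & Ha & ->).
      assert (r' = r) as ->.
      { destruct (Rtotal_order r r') as [K|[K|K]]; [|auto|]; exfalso.
        - apply (proj2 (proj2 (proj2 Hg')) r); [lra|apply Hg].
        - assert (Hlr' := proj1 Hg'); apply (proj2 (proj2 (proj2 Hg)) r'); [lra|apply Hg']. }
      destruct (arc_domain X c D G B HC l r q0 q0 (gap_not_bad l r Hg) Ha m Hm) as [v Hv].
      apply in_map_iff; exists v; split; [apply arc_cell_eq, Hv|apply HLm, Hv].
    - exists nil; intros e (r & q0 & Hg & _); exfalso; eauto. }
  exists (L1 ++ L2); intros e He (p & Hep & Hbox); apply in_or_app.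
  pose proof (ucoord_bound N p Hbox) as Hu.
  destruct He as [(p' & HX & Hcut & ->)|(l & r & q0 & Hg & Ha & ->)].
  - left; subst p'; apply (HL1 (ucoord p)); [apply HL; [exact Hcut|unfold N'; lra]|eauto].
  - right; apply (HL2 l); [|eauto].
    destruct Hep as (_ & Hp & _); change (fst (shear p)) with (ucoord p) in Hp.
    pose proof (gap_length B l r Hg) as Hlen.
    apply HL; [apply Hg|]; unfold N'; apply Rabs_le; apply Rabs_le_between in Hu; lra.
Qed.

Lemma curve_cell_structure :
  cell_decomposition X curve_cells /\ CW_complex X curve_cells.
Proof.
  apply cw_of_locally_finite.
  - assert (H := closed2_zero_set _ (poly_fun_shear _ (curve_poly _ _ _ _ _ HC 0%nat))).
    intros p Hp; apply curve_iff, H; revert p Hp; apply closure2_mono; intros p; apply curve_iff.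
  - intros e [(p & _ & _ & ->)|(l & r & q0 & _ & _ & ->)]; [apply semialgebraic_point|].
    unfold arc_cell, arc; apply semialgebraic_and; [|apply semialgebraic_and; [apply semialgebraic_and|]].
    + apply semialgebraic_eq; [apply poly_fun_shear, (curve_poly _ _ _ _ _ HC)|apply poly_fun_const].
    + apply semialgebraic_lt; [apply poly_fun_const|apply poly_fun_ucoord].
    + apply semialgebraic_lt; [apply poly_fun_ucoord|apply poly_fun_const].
    + apply (semialgebraic_forall_le (fun k p => same_sign (G k (shear p)) (G k q0))); intros k.
      apply semialgebraic_same_sign, poly_fun_shear, (curve_poly _ _ _ _ _ HC).
  - intros e [(p & _ & _ & ->)|(l & r & q0 & Hg & Ha & ->)].
    + left; exists p; tauto.
    + right; left; apply arc_cell_char_map; assumption.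
  - intros p; split.
    + intros Hp; destruct (classic (cut B (ucoord p))) as [Hcut|Hcut].
      * exists (fun q => q = p); split; [left; exists p; auto|reflexivity].
      * destruct (gap_exists B (ucoord p) Hcut) as (l & r & Hg & Hlr).
        assert (Ha : arc D G l r (shear p) (shear p)).
        { split; [apply curve_iff, Hp|split; [exact Hlr|intros; apply same_sign_refl]]. }
        exists (arc_cell l r (shear p)); split; [right; exists l, r, (shear p); auto|exact Ha].
    + intros (e & [(p' & HX & _ & ->)|(l & r & q0 & _ & _ & ->)] & Hp); [subst; exact HX|].
      apply curve_iff, Hp.
  - intros e1 e2 [(p1 & HX1 & Hc1 & ->)|(l1 & r1 & q1 & Hg1 & Ha1 & ->)]
      [(p2 & HX2 & Hc2 & ->)|(l2 & r2 & q2 & Hg2 & Ha2 & ->)] p Hp1 Hp2.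
    + subst; reflexivity.
    + exfalso; subst p1; destruct Hp2 as (_ & Hu & _); exact (proj2 (proj2 (proj2 Hg2)) _ Hu Hc1).
    + exfalso; subst p2; destruct Hp1 as (_ & Hu & _); exact (proj2 (proj2 (proj2 Hg1)) _ Hu Hc2).
    + destruct (gap_unique B l1 r1 l2 r2 (ucoord p) Hg1 Hg2 (proj1 (proj2 Hp1)) (proj1 (proj2 Hp2))) as [<- <-].
      rewrite <- (arc_cell_eq l1 r1 q1 (shear p) Hp1); apply arc_cell_eq, Hp2.
  - intros e [(p & _ & _ & ->)|(l & r & q0 & Hg & Ha & ->)].
    + destruct (exists_in_box p) as [n Hn]; exists (INR n); intros q ->; exact Hn.
    + destruct (roots_bounded_interval X c D G B HC l r) as [M HM].
      exists (Rabs l + Rabs r + Rabs c * M + M); intros p (HF & Hu & _).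
      change (fst (shear p)) with (ucoord p) in Hu.
      assert (Hv : Rabs (snd p) <= M) by (apply (HM (ucoord p)); [lra|exact HF]).
      pose proof (Rabs_pos l); pose proof (Rabs_pos r); pose proof (Rabs_pos (snd p)); pose proof (Rabs_pos c).
      split; [|nra].
      replace (fst p) with (ucoord p + c * snd p) by (unfold ucoord; ring).
      apply Rle_trans with (1 := Rabs_triang _ _); rewrite Rabs_mult.
      assert (Rabs (ucoord p) <= Rabs l + Rabs r).
      { apply Rabs_le; pose proof (Rle_abs r); pose proof (Rle_abs (- l)); rewrite Rabs_Ropp in *; lra. }
      nra.
  - apply curve_cells_locally_finite.
Qed.

(** A component inside an arc is geodesic as a connected subset of a 1-cell, so finiteness of their
    number is what remains. *)
Lemma curve_finiteness : finiteness_property X curve_cells.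
Proof.
  intros gamma P Q _ _ [(_ & _ & HgX) (L & HL & _)] e He S; right.
  pose proof (pwC2_continuous gamma L HL) as Hgc.
  destruct He as [(p & HX & Hcut & ->)|(l & r & q0 & Hg & Ha & ->)].
  - assert (HS : forall q, S q -> q = p) by (intros q [_ Hq]; exact Hq).
    split.
    + exists ((fun q => q = p) :: nil); intros K HK; exists (fun q => q = p).
      split; [left; reflexivity|apply (conn_component_singleton S); assumption].
    + intros K HK; left; exists p; apply (conn_component_singleton S); assumption.
  - split.
    + destruct (arc_cell_graph l r q0 Hg Ha) as (psi & Hc & Hiff & _ & _).
      apply (curve_meets_arc_finitely X (arc_cell l r q0) ucoord (fun u => (u + c * psi u, psi u)) l r gamma).
      * intros p; rewrite Hiff; split.
        -- intros [Hu Hp]; exists (ucoord p); split; [exact Hu|].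
           rewrite <- Hp; unfold ucoord; destruct p as [x y]; simpl; f_equal; ring.
        -- intros (u & Hu & <-); unfold ucoord; simpl.
           replace (u + c * psi u - c * psi u) with u by ring; auto.
      * intros u; unfold ucoord; simpl; ring.
      * apply cont_on_of_continuous; intros u _; [apply continuous_unshear_graph|]; apply Hc.
      * apply poly_fun_ucoord.
      * intros p _ Hu.
        destruct (locally_shear p _ (arc_clopen X c D G B HC l r q0 (shear p) (gap_not_bad l r Hg) Hu)) as (d & Hd & H).
        exists d; split; [exact Hd|]; intros q Hq Hpq; apply H; [exact Hpq|apply curve_iff, Hq].
      * exact Hgc.
      * exact HgX.
    + intros K (Hne & HKS & HKc & _); right; right; exists (arc_cell l r q0).
      split; [right; exists l, r, q0; auto|split; [|split; [|split; assumption]]].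
      * apply char_map1_cell1 with curve_cells, arc_cell_char_map; assumption.
      * intros p Hp; apply (HKS p Hp).
Qed.

End CurveCells.

(** * Shortest curves in the plane *)

Lemma dist2_triangle (p q r : pt) : dist2 p r <= dist2 p q + dist2 q r.
Proof.
  pose proof (triangle (fst p) (snd p) (fst r) (snd r) (fst q) (snd q)) as H.
  unfold dist_euc in H; rewrite !Rsqr_pow2 in H; exact H.
Qed.

Definition speed (x y : R -> R) (s : R) : R := sqrt (Derive x s ^ 2 + Derive y s ^ 2).

Lemma C2fun_derive_continuous (x : R -> R) (s : R) : C2fun x -> continuous (Derive x) s.
Proof. intros H; apply (ex_derive_continuous (Derive x)), H. Qed.

Lemma continuous_sqrt_comp {U : UniformSpace} (f : U -> R) (s : U) :
  continuous f s -> 0 <= f s -> continuous (fun t => sqrt (f t)) s.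
Proof.
  intros Hf H0; apply (continuous_comp f sqrt); [exact Hf|].
  apply continuity_pt_filterlim, continuity_pt_sqrt, H0.
Qed.

Lemma speed_continuous (x y : R -> R) (s : R) : C2fun x -> C2fun y -> continuous (speed x y) s.
Proof.
  intros Hx Hy.
  assert (Hsq : forall z, C2fun z -> continuous (fun t => Derive z t ^ 2) s).
  { intros z Hz; apply (continuous_ext (fun t => Derive z t * Derive z t)); [intros t; simpl; rewrite Rmult_1_r; reflexivity|].
    apply (continuous_mult (Derive z) (Derive z)); apply C2fun_derive_continuous, Hz. }
  apply continuous_sqrt_comp.
  - apply (continuous_plus (fun t => Derive x t ^ 2) (fun t => Derive y t ^ 2)); apply Hsq; assumption.
  - pose proof (pow2_ge_0 (Derive x s)); pose proof (pow2_ge_0 (Derive y s)); lra.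
Qed.

Lemma speed_ex_RInt (x y : R -> R) (a b : R) : C2fun x -> C2fun y -> ex_RInt (speed x y) a b.
Proof. intros Hx Hy; apply (@ex_RInt_continuous R_CompleteNormedModule); intros s _; apply speed_continuous; assumption. Qed.

(** Projection to a unit direction [(p, q)] moves no faster than the curve, so integration bounds
    the displacement in that direction. The direction of the chord itself gives the claim. *)
Lemma chord_le_length (x y : R -> R) (a b : R) : C2fun x -> C2fun y -> a <= b ->
  dist2 (x a, y a) (x b, y b) <= RInt (speed x y) a b.
Proof.
  intros Hx Hy Hab; set (d := dist2 (x a, y a) (x b, y b)).
  assert (Hd0 : 0 <= d) by apply sqrt_pos.
  assert (Hd2 : d * d = (x b - x a) ^ 2 + (y b - y a) ^ 2).
  { unfold d, dist2; simpl fst; simpl snd; rewrite sqrt_sqrt; [ring|].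
    pose proof (pow2_ge_0 (x a - x b)); pose proof (pow2_ge_0 (y a - y b)); lra. }
  assert (Hdir : forall p q, p ^ 2 + q ^ 2 = 1 ->
    p * (x b - x a) + q * (y b - y a) <= RInt (speed x y) a b).
  { intros p q Hpq.
    assert (Hder : is_RInt (fun s => p * Derive x s + q * Derive y s) a b
                     (p * (x b - x a) + q * (y b - y a))).
    { replace (p * (x b - x a) + q * (y b - y a)) with
        (minus ((fun s => p * x s + q * y s) b) ((fun s => p * x s + q * y s) a))
        by (unfold minus, plus, opp; simpl; ring).
      apply (is_RInt_derive (fun s => p * x s + q * y s)).
      - intros s _.
        apply (is_derive_plus (fun s => p * x s) (fun s => q * y s)); apply (is_derive_scal _ s);
          apply Derive_correct; [apply Hx|apply Hy].
      - intros s _; apply (continuous_plus (fun s => p * Derive x s) (fun s => q * Derive y s)).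
        + apply (continuous_mult (fun _ => p) (Derive x)); [apply continuous_const|apply C2fun_derive_continuous, Hx].
        + apply (continuous_mult (fun _ => q) (Derive y)); [apply continuous_const|apply C2fun_derive_continuous, Hy]. }
    rewrite <- (is_RInt_unique _ _ _ _ Hder).
    apply RInt_le; [exact Hab|eexists; exact Hder|apply speed_ex_RInt; assumption|].
    intros s _; unfold speed.
    apply Rle_trans with (1 := Rle_abs _); rewrite <- sqrt_Rsqr_abs; apply sqrt_le_1_alt.
    unfold Rsqr; set (u := Derive x s); set (v := Derive y s).
    (* Lagrange's identity for [(p, q)] of length one: [(p u + q v)^2 + (p v - q u)^2 = u^2 +
       v^2]. *)
    pose proof (pow2_ge_0 (p * v - q * u)); nra. }
  destruct (Req_dec d 0) as [E|E].
  - rewrite E; apply RInt_ge_0; [exact Hab|apply speed_ex_RInt; assumption|intros; apply sqrt_pos].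
  - specialize (Hdir ((x b - x a) / d) ((y b - y a) / d)).
    replace d with ((x b - x a) / d * (x b - x a) + (y b - y a) / d * (y b - y a)).
    + apply Hdir; replace (((x b - x a) / d) ^ 2 + ((y b - y a) / d) ^ 2) with
        (((x b - x a) ^ 2 + (y b - y a) ^ 2) / (d * d)) by (field; exact E).
      rewrite <- Hd2; field; exact E.
    + replace ((x b - x a) / d * (x b - x a) + (y b - y a) / d * (y b - y a)) with
        (((x b - x a) ^ 2 + (y b - y a) ^ 2) / d) by (field; exact E).
      rewrite <- Hd2; field; exact E.
Qed.

(** The detour through [gamma s] is recorded because, for a curve as short as its chord, it forces
    [gamma s] onto the segment. *)
Lemma two_chords_le_length (gamma : R -> pt) (L s : R) : pwC2_curve_length gamma L -> 0 <= s <= 1 ->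
  dist2 (gamma 0) (gamma s) + dist2 (gamma s) (gamma 1) <= L.
Proof.
  intros (n & t & g & Hn & H0 & H1 & Hinc & Hpiece & ->).
  set (len := fun i => RInt (fun s => sqrt (Derive (fun u => fst (g i u)) s ^ 2 +
                 Derive (fun u => snd (g i u)) s ^ 2)) (t i) (t (S i))).
  assert (Hch : forall i a b, (i < n)%nat -> t i <= a -> a <= b -> b <= t (S i) ->
    dist2 (gamma a) (gamma b) <= RInt (speed (fun u => fst (g i u)) (fun u => snd (g i u))) a b).
  { intros i a b Hi Ha Hab Hb; destruct (Hpiece i Hi) as (C1 & C2 & E).
    rewrite (E a), (E b) by lra.
    pose proof (chord_le_length _ _ a b C1 C2 Hab) as H; simpl in H.
    rewrite <- !surjective_pairing in H; exact H. }
  assert (K : forall m, (m <= n)%nat -> t 0%nat <= t m /\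
    forall s, t 0%nat <= s <= t m ->
    dist2 (gamma (t 0%nat)) (gamma s) + dist2 (gamma s) (gamma (t m)) <= sumR len m).
  { induction m as [|m IH]; intros Hm.
    - split; [lra|]; intros u Hu; replace u with (t 0%nat) by lra; rewrite dist2_refl; simpl; lra.
    - destruct IH as [IH0 IH]; [lia|]; pose proof (Hinc m ltac:(lia)) as Hm'.
      assert (Hmn : (m < n)%nat) by lia.
      split; [lra|]; intros u Hu; simpl sumR; destruct (Rle_lt_dec u (t m)) as [Hum|Hum].
      + specialize (IH u ltac:(lra)).
        pose proof (dist2_triangle (gamma u) (gamma (t m)) (gamma (t (S m)))).
        pose proof (Hch m (t m) (t (S m)) Hmn ltac:(lra) ltac:(lra) ltac:(lra)) as Hl.
        change (RInt (speed (fun u => fst (g m u)) (fun u => snd (g m u))) (t m) (t (S m))) with (len m) in Hl.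
        lra.
      + specialize (IH (t m) ltac:(lra)); rewrite dist2_refl in IH.
        pose proof (dist2_triangle (gamma (t 0%nat)) (gamma (t m)) (gamma u)).
        pose proof (Hch m (t m) u Hmn ltac:(lra) ltac:(lra) ltac:(lra)).
        pose proof (Hch m u (t (S m)) Hmn ltac:(lra) ltac:(lra) ltac:(lra)).
        destruct (Hpiece m Hmn) as (C1 & C2 & _).
        assert (Hsum : RInt (speed (fun u => fst (g m u)) (fun u => snd (g m u))) (t m) u +
          RInt (speed (fun u => fst (g m u)) (fun u => snd (g m u))) u (t (S m)) = len m).
        { apply (RInt_Chasles (speed (fun u => fst (g m u)) (fun u => snd (g m u)))); apply speed_ex_RInt; assumption. }
        lra. }
  intros Hs; destruct (K n (Nat.le_refl n)) as [_ H]; rewrite H0, H1 in H; apply H, Hs.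
Qed.

Lemma C2fun_affine (a b : R) : C2fun (fun s => (1 - s) * a + s * b).
Proof.
  assert (E : forall s, Derive (fun s => (1 - s) * a + s * b) s = b - a).
  { intros s; apply is_derive_unique; auto_derive; [auto|ring]. }
  intros t; split; [auto_derive; auto|split].
  - apply (ex_derive_ext (fun _ => b - a)); [intros s; symmetry; apply E|auto_derive; auto].
  - apply (continuous_ext (fun _ => 0)); [|apply continuous_const].
    intros s; symmetry; rewrite (Derive_ext _ (fun _ => b - a) s E); apply Derive_const.
Qed.

Lemma straight_curve_length (P Q : pt) : pwC2_curve_length (seg_point P Q) (dist2 P Q).
Proof.
  (* A single piece, for which [INR] supplies the breakpoints 0 and 1. *)
  exists 1%nat, INR, (fun _ => seg_point P Q).
  split; [auto|split; [reflexivity|split; [reflexivity|split; [|split]]]].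
  - intros i _; rewrite S_INR; lra.
  - intros i _; split; [apply C2fun_affine|split; [apply C2fun_affine|reflexivity]].
  - assert (E : forall a b s, Derive (fun s => (1 - s) * a + s * b) s = b - a).
    { intros a b s; apply is_derive_unique; auto_derive; [auto|ring]. }
    simpl sumR; rewrite (RInt_ext _ (fun _ => dist2 P Q)).
    + rewrite RInt_const; unfold scal; simpl; unfold mult; simpl; ring.
    + intros s _; unfold seg_point, dist2; simpl fst; simpl snd; rewrite !E; f_equal; ring.
Qed.

Lemma dist2_sqr (p q : pt) : dist2 p q * dist2 p q = (fst p - fst q) ^ 2 + (snd p - snd q) ^ 2.
Proof.
  unfold dist2; apply sqrt_sqrt.
  pose proof (pow2_ge_0 (fst p - fst q)); pose proof (pow2_ge_0 (snd p - snd q)); lra.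
Qed.

Lemma between_on_segment (P Q w : pt) : dist2 P w + dist2 w Q <= dist2 P Q ->
  exists s, 0 <= s <= 1 /\ w = seg_point P Q s.
Proof.
  intros H; pose proof (dist2_triangle P w Q) as Ht.
  pose proof (dist2_sqr P w) as Ea; pose proof (dist2_sqr w Q) as Eb; pose proof (dist2_sqr P Q) as Ed.
  assert (Ha : 0 <= dist2 P w) by apply sqrt_pos; assert (Hb : 0 <= dist2 w Q) by apply sqrt_pos.
  set (a := dist2 P w) in *; set (b := dist2 w Q) in *; set (d := dist2 P Q) in *.
  destruct (Req_dec d 0) as [E|E].
  - exists 0; split; [lra|].
    assert (Ea0 : a = 0) by lra; rewrite Ea0 in Ea.
    pose proof (pow2_ge_0 (fst P - fst w)); pose proof (pow2_ge_0 (snd P - snd w)).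
    destruct w as [x y]; unfold seg_point; simpl in *; f_equal; nra.
  - exists (a / d); assert (Hd : 0 < d) by lra; split.
    + split; [apply Rdiv_le_0_compat; lra|apply Rle_div_l; lra].
    + assert (Hb' : b = d - a) by lra; rewrite Hb' in Eb.
      set (s := a / d); assert (Hs : a = s * d) by (unfold s; field; exact E).
      destruct P as [px py], Q as [qx qy], w as [x y]; unfold seg_point; cbn [fst snd] in *.
      assert (Hsq : (x - px - s * (qx - px)) ^ 2 + (y - py - s * (qy - py)) ^ 2 = 0).
      (* Stewart's identity for the squared distance from [w] to the point dividing [P Q] at [s];
         with the distances [s * d] and [(1 - s) * d] it vanishes. *)
      { replace ((x - px - s * (qx - px)) ^ 2 + (y - py - s * (qy - py)) ^ 2) with
          ((1 - s) * ((px - x) ^ 2 + (py - y) ^ 2) + s * ((x - qx) ^ 2 + (y - qy) ^ 2)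
           - s * (1 - s) * ((px - qx) ^ 2 + (py - qy) ^ 2)) by ring.
        rewrite <- Ea, <- Eb, <- Ed, Hs; ring. }
      pose proof (pow2_ge_0 (x - px - s * (qx - px))); pose proof (pow2_ge_0 (y - py - s * (qy - py))).
      assert (x - px - s * (qx - px) = 0) by nra; assert (y - py - s * (qy - py) = 0) by nra.
      f_equal; lra.
Qed.

Lemma shortest_curve_on_segment (X : pt -> Prop) (gamma : R -> pt) (P Q : pt) :
  (forall p, X p) -> shortest_curve X gamma P Q ->
  forall p, image01 gamma p -> exists s, 0 <= s <= 1 /\ p = seg_point P Q s.
Proof.
  intros HX ((H0 & H1 & _) & L & HL & Hmin) p (s & Hs & <-).
  apply between_on_segment.
  pose proof (two_chords_le_length gamma L s HL Hs) as H; rewrite H0, H1 in H.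
  assert (L <= dist2 P Q); [|lra].
  (* The straight segment is a competitor because [X] is the whole plane. *)
  apply (Hmin (seg_point P Q)); [|apply straight_curve_length].
  split; [|split; [|auto]]; unfold seg_point; [destruct P|destruct Q]; simpl; f_equal; ring.
Qed.

Lemma convex_subset_of_unit_interval (T : R -> Prop) :
  (forall s, T s -> 0 <= s <= 1) -> (exists s, T s) ->
  (forall x y z, T x -> T y -> x <= z <= y -> T z) ->
  (exists t, forall s, T s <-> s = t) \/
  (exists a b, a < b /\ (forall s, T s -> a <= s <= b) /\ (forall s, a < s < b -> T s)).
Proof.
  intros H01 [s0 Hs0] Hc.
  destruct (completeness T) as [b [Hub Hlub]]; [exists 1; intros s Hs; apply (H01 s Hs)|exists s0; exact Hs0|].
  (* Here [a] is the supremum of the reflected set, so [- a] is the infimum of [T]. *)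
  destruct (completeness (fun s => T (- s))) as [a [Hua Hlua]].
  { exists 0; intros s Hs; specialize (H01 _ Hs); lra. }
  { exists (- s0); rewrite Ropp_involutive; exact Hs0. }
  assert (HT : forall s, T s -> - a <= s <= b).
  { intros s Hs; split; [|apply Hub, Hs].
    assert (- s <= a) by (apply Hua; rewrite Ropp_involutive; exact Hs); lra. }
  pose proof (HT s0 Hs0) as Hs0'.
  destruct (Req_dec (- a) b) as [E|E].
  - left; exists b; intros s; split; [intros Hs; specialize (HT s Hs); lra|].
    intros ->; replace b with s0 by lra; exact Hs0.
  - right; exists (- a), b; split; [lra|split; [exact HT|]]; intros s Hs.
    assert (Hx : exists x, T x /\ x < s).
    { apply NNPP; intros Hn; assert (a <= - s); [|lra].
      apply Hlua; intros x Hx; apply Rnot_lt_le; intros Hlt; apply Hn; exists (- x); split; [exact Hx|lra]. }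
    assert (Hy : exists y, T y /\ s < y).
    { apply NNPP; intros Hn; assert (b <= s); [|lra].
      apply Hlub; intros y Hy; apply Rnot_lt_le; intros Hlt; apply Hn; exists y; auto. }
    destruct Hx as (x & Hx & Hxs); destruct Hy as (y & Hy & Hys); apply (Hc x y); auto; lra.
Qed.

Definition convex (e : pt -> Prop) : Prop :=
  forall p q s, e p -> e q -> 0 <= s <= 1 -> e (seg_point p q s).

(** The curve stays on the segment from [P] to [Q]. Connectedness of its image and convexity of [e]
    make the intersection an interval of that segment, so [S] is its own only component. *)
Lemma shortest_curve_meets_convex (X e : pt -> Prop) (A : (pt -> Prop) -> Prop)
  (gamma : R -> pt) (P Q : pt) :
  (forall p, X p) -> convex e -> shortest_curve X gamma P Q ->
  let S := fun p => image01 gamma p /\ e p in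
  (forall p, ~ S p) \/
  ((exists Ks : list (pt -> Prop), forall K, conn_component S K ->
       exists K', In K' Ks /\ same_set K K') /\
   (forall K, conn_component S K -> is_singleton K \/ geodesic_segment A K)).
Proof.
  intros HX Hconv Hsh S.
  pose proof (shortest_curve_on_segment X gamma P Q HX Hsh) as Hseg.
  destruct (classic (exists p, S p)) as [Hne|Hempty]; [right|left; intros p Hp; apply Hempty; eauto].
  destruct (classic (P = Q)) as [<-|HPQ].
  { assert (HS : forall p, S p -> p = P).
    { intros p [Hp _]; destruct (Hseg p Hp) as (s & _ & ->); unfold seg_point.
      destruct P; simpl; f_equal; ring. }
    split.
    - exists ((fun q => q = P) :: nil); intros K HK; exists (fun q => q = P); split; [left; reflexivity|].
      apply (conn_component_singleton S); assumption.
    - intros K HK; left; exists P; apply (conn_component_singleton S); assumption. }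
  set (dx := fst Q - fst P); set (dy := snd Q - snd P).
  assert (Hd : 0 < dx * dx + dy * dy).
  { destruct (Req_dec dx 0) as [E1|E1]; [destruct (Req_dec dy 0) as [E2|E2]|]; [|nra|nra].
    exfalso; apply HPQ; destruct P, Q; unfold dx, dy in *; simpl in *; f_equal; lra. }
  (* The coordinate along [P Q] by orthogonal projection; being polynomial, it separates by open
     half-planes. *)
  set (lam := fun p : pt => ((fst p - fst P) * dx + (snd p - snd P) * dy) / (dx * dx + dy * dy)).
  assert (Hlam : forall s, lam (seg_point P Q s) = s).
  { intros s; unfold lam, seg_point; simpl.
    replace ((1 - s) * fst P + s * fst Q - fst P) with (s * dx) by (unfold dx; ring).
    replace ((1 - s) * snd P + s * snd Q - snd P) with (s * dy) by (unfold dy; ring).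
    field; lra. }
  assert (Hpoly : forall w, poly_fun (fun p => lam p - w)).
  { intros w; unfold lam, Rdiv, Rminus.
    repeat (apply poly_fun_plus || apply poly_fun_mult); apply poly_fun_const || apply poly_fun_fst || apply poly_fun_snd. }
  destruct Hsh as (_ & L & HL & _); pose proof (pwC2_continuous gamma L HL) as Hgc.
  assert (Himg : connected2 (fun p => exists s, 0 <= s <= 1 /\ gamma s = p)).
  { apply connected2_path_image; [intros; lra|exact Hgc]. }
  set (T := fun s => 0 <= s <= 1 /\ S (seg_point P Q s)).
  assert (HTconv : forall x y z, T x -> T y -> x <= z <= y -> T z).
  { intros x y z [Hx [Hx1 Hx2]] [Hy [Hy1 Hy2]] Hz; split; [lra|split].
    (* A missed value [z] between [x] and [y] would split the connected image of [gamma] into two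
       open parts. *)
    - apply NNPP; intros Hn.
      assert (Hside : forall p, image01 gamma p -> lam p <> z).
      { intros p Hp E; apply Hn; destruct (Hseg p Hp) as (s & _ & Es).
        rewrite Es, Hlam in E; rewrite <- E, <- Es; exact Hp. }
      assert (Hxz : x <> z) by (intros E; apply Hn; rewrite <- E; exact Hx1).
      assert (Hyz : y <> z) by (intros E; apply Hn; rewrite <- E; exact Hy1).
      destruct (Himg (fun p => lam p - z < 0) (fun p => 0 < lam p - z)) as (p & Hp & Hp1 & Hp2); [| | | | |lra].
      + intros p Hp; destruct (poly_fun_same_sign _ p (Hpoly z) ltac:(lra)) as (d & Hd' & H).
        exists d; split; [exact Hd'|]; intros q Hq; apply (H q Hq); exact Hp.
      + intros p Hp; destruct (poly_fun_same_sign _ p (Hpoly z) ltac:(lra)) as (d & Hd' & H).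
        exists d; split; [exact Hd'|]; intros q Hq; apply (H q Hq); exact Hp.
      + intros p Hp; pose proof (Hside p Hp); lra.
      + exists (seg_point P Q x); split; [exact Hx1|rewrite Hlam; lra].
      + exists (seg_point P Q y); split; [exact Hy1|rewrite Hlam; lra].
    - destruct (Req_dec x y) as [E|E]; [replace z with x by lra; exact Hx2|].
      replace (seg_point P Q z) with (seg_point (seg_point P Q x) (seg_point P Q y) ((z - x) / (y - x))).
      + apply Hconv; try assumption; split; [apply Rdiv_le_0_compat; lra|apply Rle_div_l; lra].
      + unfold seg_point; simpl; f_equal; field; lra. }
  assert (HST : forall p, S p -> exists s, T s /\ p = seg_point P Q s).
  { intros p Hp; destruct (Hseg p (proj1 Hp)) as (s & Hs & ->); exists s; split; [split; assumption|reflexivity]. }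
  assert (HSconn : connected2 S).
  { replace S with (fun p => exists s, T s /\ seg_point P Q s = p).
    - apply connected2_path_image; [intros a b s Ha Hb Hs; apply (HTconv a b); assumption|].
      apply cont_on_of_continuous; intros s _; apply C2fun_continuous, C2fun_affine.
    - apply functional_extensionality; intros p; apply propositional_extensionality; split.
      + intros (s & [_ Hs] & <-); exact Hs.
      + intros Hp; destruct (HST p Hp) as (s & Hs & ->); eauto. }
  assert (HK : forall K, conn_component S K -> same_set K S).
  { intros K (_ & HKS & _ & Hmax) p; split; [apply HKS|].
    apply (Hmax S); auto; intros q Hq; exact Hq. }
  split; [exists (S :: nil); intros K HKc; exists S; split; [left; reflexivity|apply HK, HKc]|].
  intros K HKc; specialize (HK K HKc).
  destruct (convex_subset_of_unit_interval T) as [[t Ht]|(a & b & Hab & HTab & HabT)].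
  - intros s Hs; apply Hs.
  - destruct Hne as [p Hp]; destruct (HST p Hp) as (s & Hs & _); eauto.
  - exact HTconv.
  - left; exists (seg_point P Q t); intros q; rewrite (HK q); split.
    + intros Hq; destruct (HST q Hq) as (s & Hs & ->); apply Ht in Hs; rewrite Hs; reflexivity.
    + intros ->; apply (Ht t); reflexivity.
  - right; left; exists (seg_point P Q a), (seg_point P Q b); split; [|split].
    + intros E; apply (f_equal lam) in E; rewrite !Hlam in E; lra.
    + intros p Hp; apply HK in Hp; destruct (HST p Hp) as (s & Hs & ->); apply HTab in Hs.
      exists ((s - a) / (b - a)); split.
      * split; [apply Rdiv_le_0_compat; lra|apply Rle_div_l; lra].
      * unfold seg_point; simpl; f_equal; field; lra.
    + intros s Hs; apply HK.
      replace (seg_point (seg_point P Q a) (seg_point P Q b) s) with (seg_point P Q (a + s * (b - a)))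
        by (unfold seg_point; simpl; f_equal; ring).
      apply (HabT (a + s * (b - a))); nra.
Qed.

(** * The unit grid *)

Lemma cont_on_plane (D : pt -> Prop) (f g : pt -> R) :
  (forall p, D p -> continuous (f : R * R -> R) p) ->
  (forall p, D p -> continuous (g : R * R -> R) p) ->
  cont_on dist2 dist2 D (fun p => (f p, g p)).
Proof.
  intros Hf Hg p Hp eps Heps; assert (He : 0 < eps / 2) by lra.
  pose proof (proj1 (filterlim_locally _ _) (Hf p Hp) (mkposreal _ He)) as Lf.
  pose proof (proj1 (filterlim_locally _ _) (Hg p Hp) (mkposreal _ He)) as Lg.
  destruct (proj1 (locally_dist2 p _) (locally_and (p : R * R) _ _ Lf Lg)) as (d & Hd & H).
  exists d; split; [exact Hd|]; intros q _ Hq; destruct (H q Hq) as [H1 H2].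
  change (Rabs (f q - f p) < eps / 2) in H1; change (Rabs (g q - g p) < eps / 2) in H2.
  apply Rle_lt_trans with (1 := dist2_le _ _); simpl.
  rewrite (Rabs_minus_sym (f p)), (Rabs_minus_sym (g p)); lra.
Qed.

(** * Radial homeomorphism between disk and square *)

Definition max_norm (p : pt) : R := Rmax (Rabs (fst p)) (Rabs (snd p)).
Definition euclidean_norm (p : pt) : R := sqrt (fst p ^ 2 + snd p ^ 2).

(** What the radial map requires of both norms, so that one argument serves it and its inverse.
    Domination of [max_norm] gives positivity off the origin and the estimate for continuity at the
    origin. *)
Record norm_like (N : pt -> R) : Prop := {
  norm_continuous : forall p : R * R, continuous (N : R * R -> R) p;
  norm_homogeneous : forall a p, 0 <= a -> N (a * fst p, a * snd p) = a * N p;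
  norm_ge_max : forall p, max_norm p <= N p
}.

Lemma max_norm_like : norm_like max_norm.
Proof.
  split.
  - intros p; apply filterlim_locally; intros eps; exists eps; intros q [H1 H2].
    change (Rabs (fst q - fst p) < eps) in H1; change (Rabs (snd q - snd p) < eps) in H2.
    change (Rabs (max_norm q - max_norm p) < eps).
    unfold max_norm; destruct p as [a b], q as [a' b']; simpl in *.
    pose proof (Rabs_triang_inv2 a' a); pose proof (Rabs_triang_inv2 b' b).
    assert (E1 : Rabs (Rabs a' - Rabs a) < eps) by lra; assert (E2 : Rabs (Rabs b' - Rabs b) < eps) by lra.
    apply Rabs_def2 in E1; apply Rabs_def2 in E2.
    unfold Rmax; destruct (Rle_dec _ _), (Rle_dec _ _); apply Rabs_def1; lra.
  - intros a p Ha; unfold max_norm; simpl.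
    rewrite !Rabs_mult, (Rabs_pos_eq a Ha); apply RmaxRmult, Ha.
  - intros p; lra.
Qed.

Lemma euclidean_norm_like : norm_like euclidean_norm.
Proof.
  assert (Hpos : forall p, 0 <= fst p ^ 2 + snd p ^ 2).
  { intros p; pose proof (pow2_ge_0 (fst p)); pose proof (pow2_ge_0 (snd p)); lra. }
  split.
  - intros p; apply (continuous_sqrt_comp (fun p : R * R => fst p ^ 2 + snd p ^ 2)); [|apply Hpos].
    apply (poly_fun_continuous (fun p => fst p ^ 2 + snd p ^ 2)).
    apply poly_fun_plus; apply poly_fun_pow; apply poly_fun_fst || apply poly_fun_snd.
  - intros a p Ha; unfold euclidean_norm; simpl fst; simpl snd.
    replace ((a * fst p) ^ 2 + (a * snd p) ^ 2) with (a ^ 2 * (fst p ^ 2 + snd p ^ 2)) by ring.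
    rewrite sqrt_mult_alt, sqrt_pow2; [reflexivity|exact Ha|apply pow2_ge_0].
  - intros p; unfold max_norm, euclidean_norm; apply Rmax_lub.
    + rewrite <- sqrt_Rsqr_abs, Rsqr_pow2; apply sqrt_le_1_alt; pose proof (pow2_ge_0 (snd p)); lra.
    + rewrite <- sqrt_Rsqr_abs, Rsqr_pow2; apply sqrt_le_1_alt; pose proof (pow2_ge_0 (fst p)); lra.
Qed.

Lemma max_norm_pos (p : pt) : p <> (0, 0) -> 0 < max_norm p.
Proof.
  intros Hp; unfold max_norm; destruct p as [x y]; simpl.
  destruct (Req_dec x 0) as [->|Hx].
  - assert (Hy : y <> 0) by (intros ->; apply Hp; reflexivity).
    apply Rlt_le_trans with (2 := Rmax_r _ _); apply Rabs_pos_lt, Hy.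
  - apply Rlt_le_trans with (2 := Rmax_l _ _); apply Rabs_pos_lt, Hx.
Qed.

Lemma norm_zero (N : pt -> R) : norm_like N -> N (0, 0) = 0.
Proof.
  intros HN; pose proof (norm_homogeneous N HN 0 (0, 0) ltac:(lra)) as H; simpl in H.
  rewrite Rmult_0_l in H; rewrite H; ring.
Qed.

(* Carries the unit ball of [N] onto that of [M]; at the origin the junk quotient is harmless. *)
Definition rescale (N M : pt -> R) (p : pt) : pt := (N p / M p * fst p, N p / M p * snd p).

Section Rescale.
Context (N M : pt -> R) (HN : norm_like N) (HM : norm_like M).

Lemma norm_pos (p : pt) : p <> (0, 0) -> 0 < N p /\ 0 < M p.
Proof.
  intros Hp; apply max_norm_pos in Hp.
  pose proof (norm_ge_max N HN p); pose proof (norm_ge_max M HM p); lra.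
Qed.

Lemma rescale_norm (p : pt) : M (rescale N M p) = N p.
Proof.
  destruct (classic (p = (0, 0))) as [->|Hp].
  - unfold rescale; simpl; rewrite !Rmult_0_r, !norm_zero by assumption; reflexivity.
  - destruct (norm_pos p Hp); unfold rescale; rewrite (norm_homogeneous M HM).
    + field; lra.
    + apply Rdiv_le_0_compat; lra.
Qed.

Lemma rescale_rescale (p : pt) : rescale M N (rescale N M p) = p.
Proof.
  destruct (classic (p = (0, 0))) as [->|Hp].
  - unfold rescale; simpl; rewrite !Rmult_0_r; reflexivity.
  - destruct (norm_pos p Hp).
    assert (HNr : N (rescale N M p) = N p / M p * N p).
    { unfold rescale; apply (norm_homogeneous N HN), Rdiv_le_0_compat; lra. }
    unfold rescale at 1; rewrite rescale_norm, HNr; destruct p as [x y]; unfold rescale; simpl in *.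
    f_equal; field; lra.
Qed.

(** At the origin both coordinates of the image are bounded by [M (rescale N M q) = N q], which
    tends to 0; elsewhere the quotient has a nonzero denominator. *)
Lemma rescale_continuous (p : R * R) :
  continuous (fun q : R * R => fst (rescale N M q)) p /\
  continuous (fun q : R * R => snd (rescale N M q)) p.
Proof.
  destruct (classic (p = (0, 0))) as [->|Hp].
  - assert (Hle : forall q, Rabs (fst (rescale N M q)) <= N q /\ Rabs (snd (rescale N M q)) <= N q).
    { intros q; rewrite <- (rescale_norm q).
      pose proof (norm_ge_max M HM (rescale N M q)) as H; unfold max_norm in H.
      pose proof (Rmax_l (Rabs (fst (rescale N M q))) (Rabs (snd (rescale N M q)))).
      pose proof (Rmax_r (Rabs (fst (rescale N M q))) (Rabs (snd (rescale N M q)))); lra. }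
    assert (Hn : forall eps : posreal, locally ((0, 0) : R * R) (fun q : R * R => N q < eps)).
    { intros eps.
      pose proof (proj1 (filterlim_locally _ _) (norm_continuous N HN (0, 0)) eps) as H.
      apply (locally_imp _ _ _ H); intros q Hq; change (Rabs (N q - N (0, 0)) < eps) in Hq.
      rewrite (norm_zero N HN), Rminus_0_r in Hq; apply Rabs_def2 in Hq; lra. }
    split; apply filterlim_locally; intros eps; apply (locally_imp _ _ _ (Hn eps)); intros q Hq.
    + change (Rabs (fst (rescale N M q) - N (0, 0) / M (0, 0) * 0) < eps).
      rewrite Rmult_0_r, Rminus_0_r; apply Rle_lt_trans with (2 := Hq); apply Hle.
    + change (Rabs (snd (rescale N M q) - N (0, 0) / M (0, 0) * 0) < eps).
      rewrite Rmult_0_r, Rminus_0_r; apply Rle_lt_trans with (2 := Hq); apply Hle.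
  - destruct (norm_pos p Hp) as [_ HMp].
    assert (Hq : continuous (fun q : R * R => N q / M q) p).
    { apply (continuous_mult (fun q : R * R => N q) (fun q => / M q)); [apply (norm_continuous N HN)|].
      apply (continuous_comp (M : R * R -> R) Rinv); [apply (norm_continuous M HM)|].
      apply continuous_Rinv; lra. }
    split.
    + apply (continuous_mult (fun q : R * R => N q / M q) fst); [exact Hq|apply continuous_fst].
    + apply (continuous_mult (fun q : R * R => N q / M q) snd); [exact Hq|apply continuous_snd].
Qed.

End Rescale.

(** The flag is the dimension, so [grid_cell] has as many dimensions as flags equal to [true]. *)
Definition unit_interval (b : bool) (i : Z) (x : R) : Prop :=
  if b then IZR i < x < IZR i + 1 else x = IZR i.

Definition grid_cell (a b : bool) (i j : Z) (p : pt) : Prop :=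
  unit_interval a i (fst p) /\ unit_interval b j (snd p).

Definition grid (e : pt -> Prop) : Prop := exists a b i j, e = grid_cell a b i j.

Lemma unit_interval_exists (x : R) : exists b i, unit_interval b i x.
Proof.
  destruct (archimed x) as [H1 H2].
  destruct (Req_dec x (IZR (up x - 1))) as [E|E].
  - exists false, (up x - 1)%Z; exact E.
  - exists true, (up x - 1)%Z; simpl; rewrite minus_IZR in *; lra.
Qed.

Lemma unit_interval_floor (b : bool) (i : Z) (x : R) : unit_interval b i x -> IZR i <= x < IZR i + 1.
Proof. destruct b; simpl; lra. Qed.

Lemma unit_interval_unique (b b' : bool) (i i' : Z) (x : R) :
  unit_interval b i x -> unit_interval b' i' x -> b = b' /\ i = i'.
Proof.
  intros H H'; pose proof (unit_interval_floor b i x H) as F.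
  pose proof (unit_interval_floor b' i' x H') as F'.
  assert (i = i') as ->.
  { assert (H1 : IZR i < IZR (i' + 1)) by (rewrite plus_IZR; lra).
    assert (H2 : IZR i' < IZR (i + 1)) by (rewrite plus_IZR; lra).
    apply lt_IZR in H1; apply lt_IZR in H2; lia. }
  split; [|reflexivity]; destruct b, b'; simpl in *; try reflexivity; lra.
Qed.

Lemma grid_cover (p : pt) : exists a b i j, grid_cell a b i j p.
Proof.
  destruct (unit_interval_exists (fst p)) as (a & i & Hi).
  destruct (unit_interval_exists (snd p)) as (b & j & Hj).
  exists a, b, i, j; split; assumption.
Qed.

Lemma grid_cell_convex (a b : bool) (i j : Z) : convex (grid_cell a b i j).
Proof.
  assert (H : forall b i x y s, unit_interval b i x -> unit_interval b i y -> 0 <= s <= 1 ->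
    unit_interval b i ((1 - s) * x + s * y)).
  { intros [|] k x y s; simpl; [|intros -> -> _; ring].
    intros Hx Hy Hs; destruct (Rle_lt_dec s (1 / 2)); split; nra. }
  intros p q s [H1 H2] [H3 H4] Hs; split; apply H; assumption.
Qed.

Lemma grid_vertex (i j : Z) : cell0 (grid_cell false false i j).
Proof.
  exists (IZR i, IZR j); intros [x y]; unfold grid_cell; simpl; split.
  - intros [-> ->]; reflexivity.
  - intros E; inversion E; auto.
Qed.

(** The flags [a] and [negb a] treat horizontal and vertical edges at once. *)
Lemma grid_edge_char_map (a : bool) (i j : Z) :
  char_map1 grid (grid_cell a (negb a) i j).
Proof.
  set (f := fun (b : bool) (k : Z) (t : R) => if b then IZR k + (1 + t) / 2 else IZR k).
  assert (Hf : forall b k t, Defs.open_interval t -> unit_interval b k (f b k t)).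
  { intros [|] k t; unfold Defs.open_interval; simpl; lra. }
  assert (Hfc : forall b k t, continuous (f b k) t).
  { intros [|] k t; [|apply continuous_const].
    apply (ex_derive_continuous (f true k)); unfold f; auto_derive; auto. }
  assert (Hvert : forall t, t = -1 \/ t = 1 -> forall b k, exists k', f b k t = IZR k').
  { intros t Ht [|] k; simpl; [|eauto].
    destruct Ht as [->| ->]; [exists k; field|exists (k + 1)%Z; rewrite plus_IZR; field]. }
  set (Phi := fun t => (f a i t, f (negb a) j t)).
  assert (Hc : forall D, cont_on dist1 dist2 D Phi).
  { intros D; apply cont_on_of_continuous; intros; apply Hfc. }
  set (g := fun p : pt => if a then 2 * (fst p - IZR i) - 1 else 2 * (snd p - IZR j) - 1).
  exists Phi; split; [apply Hc|split; [split; [|split; [apply Hc|]]|]].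
  - intros t Ht; split; apply Hf, Ht.
  - exists g; split; [|split; [|split]].
    + intros p [H1 H2]; unfold g, Defs.open_interval; destruct a; simpl in *; lra.
    + intros p _ eps Heps.
      assert (Hg : poly_fun g).
      { unfold g; destruct a; unfold Rminus;
          repeat (apply poly_fun_plus || apply poly_fun_mult); apply poly_fun_const || apply poly_fun_fst || apply poly_fun_snd. }
      destruct (poly_fun_dist2 g p eps Hg Heps) as (d & Hd & H).
      exists d; split; [exact Hd|]; intros q _ Hq; unfold dist1; rewrite Rabs_minus_sym; auto.
    + intros t _; unfold g, Phi; destruct a; simpl; field.
    + intros [x y] [H1 H2]; unfold g, Phi; destruct a; simpl in *; f_equal; try field; symmetry; assumption.
  - intros t Ht; destruct (Hvert t Ht a i) as [k Hk]; destruct (Hvert t Ht (negb a) j) as [m Hm].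
    exists (grid_cell false false k m); split; [exists false, false, k, m; reflexivity|].
    split; [apply grid_vertex|split; assumption].
Qed.

(** The radial map turns the disk into the square [[-1, 1]^2], which is then moved affinely. The
    circle goes to [max_norm = 1], where some coordinate becomes an integer, so its image lies in
    edges and vertices. *)
Lemma grid_square_char_map (i j : Z) : char_map2 grid (grid_cell true true i j).
Proof.
  set (h := rescale euclidean_norm max_norm); set (h' := rescale max_norm euclidean_norm).
  set (Phi := fun p => (IZR i + (1 + fst (h p)) / 2, IZR j + (1 + snd (h p)) / 2)).
  set (g := fun p : pt => (2 * (fst p - IZR i) - 1, 2 * (snd p - IZR j) - 1)).
  assert (Hh : forall p, max_norm (h p) = euclidean_norm p).
  { apply rescale_norm; [apply euclidean_norm_like|apply max_norm_like]. }
  assert (Hh' : forall p, euclidean_norm (h' p) = max_norm p).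
  { apply rescale_norm; [apply max_norm_like|apply euclidean_norm_like]. }
  assert (Hdisk : forall p, open_disk p <-> euclidean_norm p < 1).
  { intros p; unfold open_disk, euclidean_norm; split; intros H.
    - rewrite <- sqrt_1; apply sqrt_lt_1_alt; split; [|exact H].
      pose proof (pow2_ge_0 (fst p)); pose proof (pow2_ge_0 (snd p)); lra.
    - apply sqrt_lt_0_alt; rewrite sqrt_1; exact H. }
  assert (Hsquare : forall p, max_norm p < 1 <-> -1 < fst p < 1 /\ -1 < snd p < 1).
  { intros p; unfold max_norm; split.
    - intros H; pose proof (Rmax_l (Rabs (fst p)) (Rabs (snd p))); pose proof (Rmax_r (Rabs (fst p)) (Rabs (snd p))).
      assert (E1 : Rabs (fst p) < 1) by lra; assert (E2 : Rabs (snd p) < 1) by lra.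
      apply Rabs_def2 in E1; apply Rabs_def2 in E2; lra.
    - intros [H1 H2]; apply Rmax_lub_lt; apply Rabs_def1; lra. }
  assert (HPhi : forall D, cont_on dist2 dist2 D Phi).
  { assert (Haff : forall k (f : R * R -> R) (p : R * R), continuous f p ->
      continuous (fun q => k + (1 + f q) / 2) p).
    { intros k f p Hf; apply (continuous_comp f (fun x => k + (1 + x) / 2)); [exact Hf|].
      apply (ex_derive_continuous (fun x => k + (1 + x) / 2)); auto_derive; auto. }
    intros D; apply cont_on_plane; intros p _; apply Haff;
      apply (rescale_continuous euclidean_norm max_norm euclidean_norm_like max_norm_like p). }
  exists Phi; split; [apply HPhi|split; [split; [|split; [apply HPhi|]]|]].
  - intros p Hp; apply Hdisk in Hp; rewrite <- Hh in Hp; apply Hsquare in Hp.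
    unfold grid_cell, unit_interval, Phi; cbn [fst snd]; lra.
  - exists (fun p => h' (g p)); split; [|split; [|split]].
    + intros p [H1 H2]; apply Hdisk; rewrite Hh'; apply Hsquare; unfold g; simpl in *; lra.
    + apply (cont_on_comp dist2 dist2 dist2 _ (fun _ => True) g h'); [auto| |].
      * apply cont_on_plane; intros p _; apply (poly_fun_continuous (fun p : pt => 2 * (_ - _) - 1));
          unfold Rminus; repeat (apply poly_fun_plus || apply poly_fun_mult);
          apply poly_fun_const || apply poly_fun_fst || apply poly_fun_snd.
      * apply (cont_on_ext _ _ _ (fun p => (fst (h' p), snd (h' p)))).
        -- intros p _; symmetry; apply surjective_pairing.
        -- apply cont_on_plane; intros p _;
             apply (rescale_continuous max_norm euclidean_norm max_norm_like euclidean_norm_like p).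
    + intros p _; replace (g (Phi p)) with (h p).
      * apply rescale_rescale; [apply euclidean_norm_like|apply max_norm_like].
      * unfold g, Phi; cbn [fst snd]; destruct (h p) as [u v]; cbn [fst snd]; f_equal; field.
    + intros p _; unfold Phi.
      replace (h (h' (g p))) with (g p)
        by (symmetry; apply rescale_rescale; [apply max_norm_like|apply euclidean_norm_like]).
      unfold g; destruct p as [x y]; simpl; f_equal; field.
  - intros p Hp; destruct (grid_cover (Phi p)) as (a & b & k & m & Hkm).
    exists (grid_cell a b k m); split; [exists a, b, k, m; reflexivity|split; [|exact Hkm]].
    assert (Hmax : max_norm (h p) = 1).
    { rewrite Hh; unfold euclidean_norm; rewrite Hp; apply sqrt_1. }
    (* A coordinate equal to 1 or -1 becomes an integer, and the uniqueness of [unit_interval] then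
       forces the flag [false]. *)
    assert (Hint : forall b k z x, Rabs x = 1 -> unit_interval b k (IZR z + (1 + x) / 2) -> b = false).
    { intros b' k' z x Hx Hb.
      assert (Hz : exists z', unit_interval false z' (IZR z + (1 + x) / 2)).
      { revert Hx; unfold Rabs; destruct (Rcase_abs x); intros Hx.
        - exists z; simpl; lra.
        - exists (z + 1)%Z; simpl; rewrite plus_IZR; lra. }
      destruct Hz as [z' Hz']; exact (proj1 (unit_interval_unique _ _ _ _ _ Hb Hz')). }
    assert (Hab : a = false \/ b = false).
    { destruct Hkm as [H1 H2]; unfold max_norm, Rmax in Hmax; destruct (Rle_dec _ _).
      - right; apply (Hint b m j _ Hmax H2).
      - left; apply (Hint a k i _ Hmax H1). }
    destruct a, b; [destruct Hab; discriminate| | |left; apply grid_vertex].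
    + right; apply char_map1_cell1 with grid, (grid_edge_char_map true).
    + right; apply char_map1_cell1 with grid, (grid_edge_char_map false).
Qed.

Lemma grid_cell_in_box (a b : bool) (i j : Z) (p : pt) :
  grid_cell a b i j p -> in_box (Rabs (IZR i) + Rabs (IZR j) + 1) p.
Proof.
  intros [H1 H2]; apply unit_interval_floor in H1; apply unit_interval_floor in H2.
  assert (Hb : forall z x, IZR z <= x < IZR z + 1 -> Rabs x <= Rabs (IZR z) + 1).
  { intros z x Hx; replace x with (IZR z + (x - IZR z)) by ring.
    apply Rle_trans with (1 := Rabs_triang _ _); rewrite (Rabs_pos_eq (x - IZR z)); lra. }
  pose proof (Rabs_pos (IZR i)); pose proof (Rabs_pos (IZR j)).
  apply Hb in H1; apply Hb in H2; split; lra.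
Qed.

Lemma grid_locally_finite (N : R) :
  exists L, forall e, grid e -> (exists p, e p /\ in_box N p) -> In e L.
Proof.
  (* The integer that labels a cell is at most one below the coordinate of its points. *)
  destruct (finite_integers (N + 1)) as [Lz HLz].
  set (Lb := true :: false :: nil).
  exists (map (fun x => grid_cell (fst (fst x)) (snd (fst x)) (fst (snd x)) (snd (snd x)))
           (list_prod (list_prod Lb Lb) (list_prod Lz Lz))).
  intros e (a & b & i & j & ->) (p & [H1 H2] & [N1 N2]).
  assert (Hz : forall b z x, unit_interval b z x -> Rabs x <= N -> In z Lz).
  { intros b' z x Hx Hn; apply unit_interval_floor in Hx; apply HLz.
    replace (IZR z) with (x + (IZR z - x)) by ring; apply Rle_trans with (1 := Rabs_triang _ _).
    rewrite (Rabs_minus_sym (IZR z)), (Rabs_pos_eq (x - IZR z)); lra. }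
  apply in_map_iff; exists (a, b, (i, j)); split; [reflexivity|].
  apply in_prod; apply in_prod; eauto; [destruct a|destruct b]; unfold Lb; simpl; auto.
Qed.

Lemma plane_cell_structure (X : pt -> Prop) : (forall p, X p) ->
  cell_decomposition X grid /\ finiteness_property X grid /\ CW_complex X grid.
Proof.
  intros HX.
  assert (H : cell_decomposition X grid /\ CW_complex X grid).
  { apply cw_of_locally_finite.
    - intros p _; apply HX.
    - intros e (a & b & i & j & ->).
      assert (Hu : forall b k g, poly_fun g -> semialgebraic (fun p => unit_interval b k (g p))).
      { intros [|] k g Hg; simpl; [apply semialgebraic_and; apply semialgebraic_lt|apply semialgebraic_eq];
          auto using poly_fun_const. }
      apply semialgebraic_and; apply Hu; [apply poly_fun_fst|apply poly_fun_snd].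
    - intros e (a & b & i & j & ->); destruct a, b.
      + right; right; apply grid_square_char_map.
      + right; left; apply (grid_edge_char_map true).
      + right; left; apply (grid_edge_char_map false).
      + left; apply grid_vertex.
    - intros p; split; [intros _|auto].
      destruct (grid_cover p) as (a & b & i & j & Hp); exists (grid_cell a b i j).
      split; [exists a, b, i, j; reflexivity|exact Hp].
    - intros e1 e2 (a1 & b1 & i1 & j1 & ->) (a2 & b2 & i2 & j2 & ->) p [H1 H2] [H3 H4].
      destruct (unit_interval_unique _ _ _ _ _ H1 H3) as [-> ->].
      destruct (unit_interval_unique _ _ _ _ _ H2 H4) as [-> ->]; reflexivity.
    - intros e (a & b & i & j & ->); exists (Rabs (IZR i) + Rabs (IZR j) + 1).
      intros p; apply grid_cell_in_box.
    - apply grid_locally_finite. }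
  split; [apply H|split; [|apply H]].
  intros gamma P Q _ _ Hsh e (a & b & i & j & ->).
  apply (shortest_curve_meets_convex X _ grid gamma P Q HX (grid_cell_convex a b i j) Hsh).
Qed.

(** Over the reals a sum of squares vanishes only where all its terms do; nonnegativity is carried
    along in the induction. *)
Lemma alg_set_single_equation (fs : list poly2) :
  exists h : poly2, alg_set fs = (fun p => peval h p = 0).
Proof.
  assert (H : exists g, poly_fun g /\ forall p, 0 <= g p /\ (alg_set fs p <-> g p = 0)).
  { induction fs as [|f fs (g & Hg & IH)].
    - exists (fun _ => 0); split; [apply poly_fun_const|]; intros p; split; [lra|].
      split; [reflexivity|intros _ f []].
    - exists (fun p => peval f p ^ 2 + g p); split.
      + apply poly_fun_plus; [apply poly_fun_pow; exists f; reflexivity|exact Hg].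
      + intros p; destruct (IH p) as [H0 H1]; pose proof (pow2_ge_0 (peval f p)) as Hsq; split; [lra|].
        split.
        * intros H; rewrite (H f (or_introl eq_refl)).
          rewrite (proj1 H1); [ring|]; intros f' Hf'; apply H; right; exact Hf'.
        * intros E f' [<-|Hf']; [nra|]; apply H1; [lra|exact Hf']. }
  destruct H as (g & [h Hh] & H); exists h.
  apply functional_extensionality; intros p; apply propositional_extensionality.
  rewrite (proj2 (H p)), Hh; reflexivity.
Qed.

Theorem theorem2p8 (fs : list poly2) :
  exists A : (pt -> Prop) -> Prop,
    cell_decomposition (alg_set fs) A /\
    finiteness_property (alg_set fs) A /\
    CW_complex (alg_set fs) A.
Proof.
  destruct (alg_set_single_equation fs) as [h ->].
  destruct (classic (exists p, peval h p <> 0)) as [Hnz|Hz].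
  - destruct (Algebra.curve_shear h Hnz) as (c & D & G & B & HC).
    destruct (curve_cell_structure _ c D G B HC) as [H1 H2].
    exists (curve_cells (fun p => peval h p = 0) c D G B).
    split; [exact H1|split; [exact (curve_finiteness _ c D G B HC)|exact H2]].
  - exists grid; apply plane_cell_structure; intros p; apply NNPP; intros Hp; eauto.
Qed.
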